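(* Let $1<p<\infty$ and let $G$ be a locally compact group. If $G$ has the $p$-approximation property ($p$-AP), then $CV_p(G)=PM_p(G)$.
   Context: Let $G$ be a locally compact group with a left Haar measure and modular function $\Delta$, $1<p<\infty$, $p'$ with $\frac1p+\frac1{p'}=1$. $\lambda_p(s)f(t)=f(s^{-1}t)$ and $\rho_p(s)f(t)=f(ts)\Delta(s)^{1/p}$ are the left and right regular representations on $L_p(G)$. $\mathcal B(L_p(G))$ is identified with the dual of the projective tensor product $L_{p'}(G)\hat\otimes L_p(G)$ via $\langle T,g\otimes f\rangle=\langle g,T(f)\rangle$. $PM_p(G)$ (the $p$-pseudo-measures) is the weak*-closed linear span of $\{\lambda_p(s):s\in G\}$ in $\mathcal B(L_p(G))$. $CV_p(G)$ (the $p$-convoluters) is the commutant of $\{\rho_p(s):s\in G\}$ in $\mathcal B(L_p(G))$. The Figà-Talamanca–Herz algebra $A_p(G)$ is the image of the map $\Lambda_p:L_{p'}(G)\hat\otimes L_p(G)\to C_0(G)$, $\Lambda_p(g\otimes f)(s)=\langle g,\lambda_p(s)f\rangle=\int_G g(t)f(s^{-1}t)\,dt$, with the quotient norm of $L_{p'}(G)\hat\otimes L_p(G)/\ker\Lambda_p$. $SQ_p$ is the class of (complex) Banach spaces that are quotients of closed subspaces (equivalently, subspaces of quotients) of $L_p$ spaces. $M_{p\text{-}cb}(G)$ is the space of functions $\varphi:G\to\mathbb{C}$ for which there exist $E\in SQ_p$ and continuous bounded maps $\alpha:G\to E$, $\beta:G\to E^*$ with $\varphi(st^{-1})=\langle\beta(s),\alpha(t)\rangle$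 for all $s,t\in G$; its norm is the infimum of $\sup_t\|\alpha(t)\|\,\sup_s\|\beta(s)\|$ over all such $E,\alpha,\beta$. There are contractive inclusions $A_p(G)\hookrightarrow M_{p\text{-}cb}(G)\hookrightarrow C_b(G)$. $L_1(G)$ embeds in $M_{p\text{-}cb}(G)^*$ via $\langle f,\varphi\rangle=\int_G f\varphi$, and $Q_{p\text{-}cb}(G)$ denotes its norm closure in $M_{p\text{-}cb}(G)^*$; one has $M_{p\text{-}cb}(G)=Q_{p\text{-}cb}(G)^*$. $G$ has the $p$-AP if there is a net $(\varphi_i)$ in $A_p(G)$ such that $\varphi_i\to1$ in the weak* topology $\sigma(M_{p\text{-}cb}(G),Q_{p\text{-}cb}(G))$. *)

(* Defs.v *)
From HB Require Import structures.
From mathcomp Require Import all_boot all_order all_algebra.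
From mathcomp Require Import all_classical all_reals all_analysis.
From mathcomp Require Import measurable_realfun complex.
Set Implicit Arguments. Unset Strict Implicit. Unset Printing Implicit Defensive.
Import Order.TTheory GRing.Theory Num.Theory.
Import numFieldNormedType.Exports.
Local Open Scope classical_set_scope.
Local Open Scope ring_scope.
Local Open Scope complex_scope.
Local Open Scope quotient_scope.

HB.instance Definition _ (R : realType) :=
  NormedModule.copy R[i] ((R[i] : numFieldType)^o).

Section rnorm.
Context {R : realType} {V : normedModType R[i]}.
Implicit Types x y : V.

(* The norm of a normed R[i]-module is R[i]-valued; [rnorm] is its real value. *)
Definition rnorm x : R := complex.Re `|x|.

Lemma rnormE x : (rnorm x)%:C = `|x|.
Proof. by rewrite /rnorm RRe_real// ger0_real. Qed.

Lemma rnorm_ge0 x : 0 <= rnorm x.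
Proof. by rewrite -ler0c rnormE. Qed.

Lemma ler_rnormD x y : rnorm (x + y) <= rnorm x + rnorm y.
Proof. by rewrite -lecR raddfD/= !rnormE ler_normD. Qed.

Lemma rnormN x : rnorm (- x) = rnorm x.
Proof. by rewrite /rnorm normrN. Qed.

Lemma rnorm0 : rnorm 0 = 0.
Proof. by rewrite /rnorm normr0. Qed.

Lemma rnorm0_eq0 x : rnorm x = 0 -> x = 0.
Proof. by move=> x0; apply/normr0_eq0; rewrite -rnormE x0. Qed.

End rnorm.

Lemma rnormZ {R : realType} {V : normedModType R[i]} (a : R[i]) (x : V) :
  rnorm (a *: x) = rnorm a * rnorm x.
Proof. by apply: complexI; rewrite rmorphM/= !rnormE normrZ. Qed.

Lemma rnorm_complexE {R : realType} (z : R[i]) :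
  rnorm z = Num.sqrt (complex.Re z ^+ 2 + complex.Im z ^+ 2).
Proof. by case: z. Qed.

Section Lp_fun.
Context d (T : measurableType d) (R : realType).

Definition cmeasurable (f : T -> R[i]) :=
  measurable_fun setT (@complex.Re R \o f) /\ measurable_fun setT (@complex.Im R \o f).

Lemma cmeasurable_cst z : cmeasurable (cst z).
Proof. by split; exact: measurable_cst. Qed.

Lemma cmeasurableD f g : cmeasurable f -> cmeasurable g -> cmeasurable (f + g).
Proof.
move=> [f1 f2] [g1 g2]; split.
- rewrite (_ : _ \o _ = (@complex.Re R \o f) \+ (@complex.Re R \o g)); last first.
    by apply/funext => x /=; rewrite raddfD.
  exact: measurable_funD.
- rewrite (_ : _ \o _ = (@complex.Im R \o f) \+ (@complex.Im R \o g)); last first.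
    by apply/funext => x /=; rewrite raddfD.
  exact: measurable_funD.
Qed.

Lemma cmeasurableZ (a : R[i]) f : cmeasurable f -> cmeasurable (a *: f).
Proof.
case: a => a b [f1 f2]; split.
- rewrite (_ : _ \o _ = (fun x => a * complex.Re (f x) - b * complex.Im (f x))).
    by apply: measurable_funB; apply: measurable_funM.
  by apply/funext => x /=; rewrite /GRing.scale/=; case: (f x).
- rewrite (_ : _ \o _ = (fun x => a * complex.Im (f x) + b * complex.Re (f x))).
    by apply: measurable_funD; apply: measurable_funM.
  by apply/funext => x /=; rewrite /GRing.scale/=; case: (f x).
Qed.

Lemma cmeasurable_rnorm f : cmeasurable f -> measurable_fun setT (rnorm \o f).
Proof.
move=> [f1 f2].
rewrite (_ : _ \o _ = Num.sqrt \o
    (fun x => complex.Re (f x) ^+ 2 + complex.Im (f x) ^+ 2)); last first.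
  by apply/funext => x /=; rewrite rnorm_complexE.
apply: (measurableT_comp (continuous_measurable_fun (@sqrt_continuous R))).
by apply: measurable_funD; exact: measurable_funX.
Qed.

Section norm.
Variables (mu : {measure set T -> \bar R}) (p : R) (p1 : 1 <= p).
Implicit Types f g : T -> R[i].

Definition cLnorm f : \bar R := 'N[mu]_p%:E[EFin \o (rnorm \o f)]%E.

Let p0 : 0 < p. Proof. exact: lt_le_trans p1. Qed.

Let measurable_powR_norm (h : T -> R) : measurable_fun setT h ->
  measurable_fun setT (fun x => (`|h x| `^ p)%:E).
Proof.
move=> mh; apply/measurable_EFinP.
apply: (measurableT_comp (measurable_powR p)).
exact: measurableT_comp.
Qed.

Lemma le_cLnorm f (h : T -> R) : cmeasurable f -> measurable_fun setT h ->
  (forall x, rnorm (f x) <= h x) -> (cLnorm f <= 'N[mu]_p%:E[EFin \o h])%E.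
Proof.
move=> mf mh fh; rewrite /cLnorm unlock /Lnorm.
apply: gt0_ler_poweR; rewrite ?in_itv/= ?leey ?andbT ?invr_ge0 ?(ltW p0)//.
- by apply: integral_ge0 => x _; rewrite lee_fin powR_ge0.
- by apply: integral_ge0 => x _; rewrite lee_fin powR_ge0.
apply: ge0_le_integral => //.
- by apply: measurable_powR_norm; exact: cmeasurable_rnorm.
- exact: measurable_powR_norm.
- move=> x _; rewrite lee_fin ge0_ler_powR ?nnegrE ?(ltW p0)//.
  by rewrite ger0_norm ?rnorm_ge0// (le_trans (fh x))// ler_norm.
Qed.

Lemma cLnormD f g : cmeasurable f -> cmeasurable g ->
  (cLnorm (f + g)%R <= cLnorm f + cLnorm g)%E.
Proof.
move=> mf mg; have mf' := cmeasurable_rnorm mf; have mg' := cmeasurable_rnorm mg.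
apply: le_trans (minkowski_EFin mu mf' mg' p1).
apply: le_cLnorm; [exact: cmeasurableD|exact: measurable_funD|].
by move=> x; exact: ler_rnormD.
Qed.

Lemma cLnormZ (a : R[i]) f : cmeasurable f ->
  cLnorm (a *: f) = ((rnorm a)%:E * cLnorm f)%E.
Proof.
move=> mf; rewrite /cLnorm unlock /Lnorm /=.
under eq_integral => x _ do rewrite (rnormZ a (f x)) normrM powRM// EFinM.
rewrite ge0_integralZl//; last first.
  by apply: measurable_powR_norm; exact: cmeasurable_rnorm.
rewrite poweRM ?lee_fin ?powR_ge0//; last first.
  by apply: integral_ge0 => x _; rewrite lee_fin powR_ge0.
rewrite poweR_EFin -powRrM mulfV ?gt_eqF// powRr1// ger0_norm//.
exact: rnorm_ge0.
Qed.

Lemma ae_eq_cLnorm f g : cmeasurable f -> cmeasurable g ->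
  {ae mu, forall x, f x = g x} -> cLnorm f = cLnorm g.
Proof.
move=> mf mg fg; rewrite /cLnorm unlock /Lnorm /=; congr (_ `^ _)%E.
apply: ge0_ae_eq_integral => //.
- by apply: measurable_powR_norm; exact: cmeasurable_rnorm.
- by apply: measurable_powR_norm; exact: cmeasurable_rnorm.
- by apply: filterS fg => x /= ->.
Qed.

Lemma cLnorm0_ae f : cmeasurable f -> cLnorm f = 0 ->
  {ae mu, forall x, f x = 0}.
Proof.
move=> mf /Lnorm_eq0_eq0; rewrite lte_fin => /(_ _ p0).
have /measurable_EFinP mf' := cmeasurable_rnorm mf.
move=> /(_ mf'); apply: filterS => x /(_ I) [].
exact: rnorm0_eq0.
Qed.

(* The complex-valued functions with finite p-norm. *)
Definition cLfun : {pred T -> R[i]} :=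
  mem [set f | cmeasurable f /\ (cLnorm f < +oo)%E].
Definition cLfun_key : pred_key cLfun. Proof. exact. Qed.
Canonical cLfun_keyed := KeyedPred cLfun_key.

Lemma cLfun_submod_closed : submod_closed cLfun.
Proof.
split=> [|a f g].
  rewrite inE/=; split; first exact: cmeasurable_cst.
  rewrite /cLnorm (_ : _ \o _ = cst 0%E); first by rewrite Lnorm0// gt_eqF.
  by apply/funext => x /=; rewrite rnorm0.
rewrite !inE/= => -[mf lf] [mg lg].
have maf := cmeasurableZ a mf.
split; first exact: cmeasurableD.
apply: le_lt_trans (cLnormD maf mg) _.
by rewrite lte_add_pinfty// cLnormZ// lte_mul_pinfty// lee_fin rnorm_ge0.
Qed.

HB.instance Definition _ := GRing.isSubmodClosed.Build _ _ cLfun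
  cLfun_submod_closed.

Definition cLfunType & 1 <= p : Type := {f : T -> R[i] | f \in cLfun}.
Local Notation LT := (cLfunType p1).
HB.instance Definition _ := SubChoice.on LT.
HB.instance Definition _ := [SubChoice_isSubLmodule of LT by <:].

Definition cae_eq (f g : LT) := `[< {ae mu, forall x, val f x = val g x} >].

Let cae_eq_refl : reflexive cae_eq.
Proof. by move=> f; apply/asboolP; exact: aeW. Qed.

Let cae_eq_sym : symmetric cae_eq.
Proof.
by move=> f g; apply/idP/idP => /asboolP h; apply/asboolP; apply: filterS h.
Qed.

Let cae_eq_trans : transitive cae_eq.
Proof.
move=> f g h /asboolP gf /asboolP fh; apply/asboolP.
by apply: filterS2 gf fh => x -> ->.
Qed.

Canonical cae_eq_canonical :=
  EquivRel cae_eq cae_eq_refl cae_eq_sym cae_eq_trans.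

Definition Lp : Type := {eq_quot cae_eq}.
HB.instance Definition _ := Choice.on Lp.
HB.instance Definition _ := EqQuotient.on Lp.

Lemma Lp_piP (f g : LT) :
  (\pi_Lp f = \pi_Lp g) <-> {ae mu, forall x, val f x = val g x}.
Proof. by split=> [/eqmodP/asboolP//|h]; apply/eqmodP/asboolP. Qed.

Lemma Lp_repr_pi (f : LT) : {ae mu, forall x, val (repr (\pi_Lp f)) x = val f x}.
Proof. by apply/Lp_piP; rewrite reprK. Qed.

Definition Lp_zero : Lp := \pi_Lp 0.
Definition Lp_opp (x : Lp) : Lp := \pi_Lp (- repr x).
Definition Lp_add (x y : Lp) : Lp := \pi_Lp (repr x + repr y).
Definition Lp_scale (a : R[i]) (x : Lp) : Lp := \pi_Lp (a *: repr x).

Let Lp_piD (f g : LT) : \pi_Lp (f + g) = Lp_add (\pi_Lp f) (\pi_Lp g).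
Proof.
apply/Lp_piP; apply: filterS2 (Lp_repr_pi f) (Lp_repr_pi g) => x /= fx gx.
by rewrite -[RHS]/(sval (repr (\pi_Lp f)) x + sval (repr (\pi_Lp g)) x) fx gx.
Qed.

Let Lp_piN (f : LT) : \pi_Lp (- f) = Lp_opp (\pi_Lp f).
Proof.
apply/Lp_piP; apply: filterS (Lp_repr_pi f) => x /= fx.
by rewrite -[RHS]/(- sval (repr (\pi_Lp f)) x) fx.
Qed.

Let Lp_piZ a (f : LT) : \pi_Lp (a *: f) = Lp_scale a (\pi_Lp f).
Proof.
apply/Lp_piP; apply: filterS (Lp_repr_pi f) => x /= fx.
by rewrite -[RHS]/(a *: sval (repr (\pi_Lp f)) x) fx.
Qed.

Let Lp_addA : associative Lp_add.
Proof.
move=> x y z; rewrite -[x]reprK -[y]reprK -[z]reprK.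
rewrite -(Lp_piD (repr y) (repr z)) -(Lp_piD (repr x) (repr y)).
by rewrite -(Lp_piD (repr x) (_ + _)) -(Lp_piD (_ + _) (repr z)) addrA.
Qed.

Let Lp_addC : commutative Lp_add.
Proof. by move=> x y; rewrite /Lp_add addrC. Qed.

Let Lp_add0 : left_id Lp_zero Lp_add.
Proof. by move=> x; rewrite -[x]reprK -Lp_piD add0r. Qed.

Let Lp_addN : left_inverse Lp_zero Lp_opp Lp_add.
Proof. by move=> x; rewrite -[x]reprK -(Lp_piN (repr x)) -(Lp_piD (- repr x)) addNr. Qed.

HB.instance Definition _ :=
  GRing.isZmodule.Build Lp Lp_addA Lp_addC Lp_add0 Lp_addN.

Let Lp_scaleA a b x : Lp_scale a (Lp_scale b x) = Lp_scale (a * b) x.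
Proof. by rewrite -[x]reprK -(Lp_piZ b (repr x)) -!(Lp_piZ _ (_ : LT)) scalerA. Qed.

Let Lp_scale1 : left_id 1 Lp_scale.
Proof. by move=> x; rewrite -[x]reprK -Lp_piZ scale1r. Qed.

Let Lp_scaleDr : right_distributive Lp_scale +%R.
Proof.
move=> a x y; rewrite -[x]reprK -[y]reprK.
rewrite -[_ + _]/(Lp_add _ _) -[RHS]/(Lp_add _ _) -(Lp_piD (repr x) (repr y)).
rewrite -(Lp_piZ a (repr x)) -(Lp_piZ a (repr y)) -(Lp_piZ a (_ + _)).
by rewrite -(Lp_piD (a *: _)) scalerDr.
Qed.

Let Lp_scaleDl x : {morph Lp_scale^~ x : a b / a + b}.
Proof.
move=> a b; rewrite -[x]reprK.
rewrite -[RHS]/(Lp_add _ _) -!(Lp_piZ _ (repr x)).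
by rewrite -(Lp_piD (a *: _)) scalerDl.
Qed.

HB.instance Definition _ := GRing.Zmodule_isLmodule.Build R[i] Lp
  Lp_scaleA Lp_scale1 Lp_scaleDr Lp_scaleDl.

Lemma cLfunP (f : LT) : cmeasurable (val f) /\ (cLnorm (val f) < +oo)%E.
Proof. by have := valP f; rewrite inE. Qed.

Definition Lp_norm (x : Lp) : R[i] := (fine (cLnorm (val (repr x))))%:C.

Let Lp_norm_pi (f : LT) : Lp_norm (\pi_Lp f) = (fine (cLnorm (val f)))%:C.
Proof.
rewrite /Lp_norm (ae_eq_cLnorm _ _ (Lp_repr_pi f))//.
- by have [] := cLfunP (repr (\pi_Lp f)).
- by have [] := cLfunP f.
Qed.

Let cLnorm_fin (f : LT) : cLnorm (val f) \is a fin_num.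
Proof. by rewrite ge0_fin_numE ?Lnorm_ge0//; have [] := cLfunP f. Qed.

Let Lp_normD x y : Lp_norm (x + y) <= Lp_norm x + Lp_norm y.
Proof.
rewrite -[x]reprK -[y]reprK -[X in Lp_norm X]/(Lp_add _ _) -Lp_piD !Lp_norm_pi.
rewrite -rmorphD/= lecR -lee_fin EFinD !fineK.
- by apply: cLnormD; [have [] := cLfunP (repr x)|have [] := cLfunP (repr y)].
- exact: cLnorm_fin.
- exact: cLnorm_fin.
- exact: (cLnorm_fin (repr x + repr y)).
Qed.

Let Lp_normZ (a : R[i]) x : Lp_norm (a *: x) = `|a| * Lp_norm x.
Proof.
rewrite -[x]reprK -[X in Lp_norm X]/(Lp_scale _ _) -Lp_piZ !Lp_norm_pi.
rewrite cLnormZ; last by have [] := cLfunP (repr x).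
rewrite fineM//.
by rewrite rmorphM/= (rnormE (a : R[i])).
Qed.

Let Lp_norm0_eq0 x : Lp_norm x = 0 -> x = 0.
Proof.
rewrite -[x]reprK Lp_norm_pi => /complexI fx0; apply/Lp_piP.
apply: cLnorm0_ae; first by have [] := cLfunP (repr x).
by rewrite -[LHS]fineK ?fx0//; exact: cLnorm_fin.
Qed.

HB.instance Definition _ :=
  Lmodule_isNormed.Build R[i] Lp Lp_normD Lp_normZ Lp_norm0_eq0.

Definition Lp_fun (x : Lp) : T -> R[i] := val (repr x).
Coercion Lp_fun : Lp >-> Funclass.

End norm.
End Lp_fun.

Section bounded_operators.
Context (R : realType) (X Y : normedModType R[i]).

Definition bounded_linear : {pred X -> Y} := mem [set T : X -> Y |
  linear T /\ exists M : R, forall x, rnorm (T x) <= M * rnorm x].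
Definition bounded_linear_key : pred_key bounded_linear. Proof. exact. Qed.
Canonical bounded_linear_keyed := KeyedPred bounded_linear_key.

Lemma bounded_linear_submod_closed : submod_closed bounded_linear.
Proof.
split=> [|a f g].
  rewrite inE/=; split; first by move=> a u v; rewrite scaler0 addr0.
  by exists 0 => x; rewrite rnorm0 mul0r.
rewrite !inE/= => -[lf [M fM]] [lg [N gN]]; split.
  move=> b u v; rewrite -![(_ + _) _]/(a *: f _ + g _) lf lg.
  by rewrite !scalerDr !scalerA (mulrC a) addrACA.
exists (rnorm a * M + N) => x.
rewrite mulrDl (le_trans (ler_rnormD _ _))// lerD// -mulrA.
by rewrite [leLHS](rnormZ a (f x)) ler_wpM2l ?rnorm_ge0.
Qed.

HB.instance Definition _ := GRing.isSubmodClosed.Build _ _ bounded_linear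
  bounded_linear_submod_closed.

(* The space B(X, Y) of bounded linear operators with the operator norm. *)
Definition Bop : Type := {T : X -> Y | T \in bounded_linear}.
HB.instance Definition _ := SubChoice.on Bop.
HB.instance Definition _ := [SubChoice_isSubLmodule of Bop by <:].

Definition Bop_fun (T : Bop) : X -> Y := val T.
Coercion Bop_fun : Bop >-> Funclass.
Implicit Types S T : Bop.

Lemma Bop_linear T : linear T.
Proof. by have := valP T; rewrite inE => -[]. Qed.

HB.instance Definition _ T := GRing.isLinear.Build R[i] X Y _ T (Bop_linear T).

Definition opnorm T : R := sup [set rnorm (T x) | x in [set x | rnorm x <= 1]].

Let opnorm_has_sup T :
  has_sup [set rnorm (T x) | x in [set x | rnorm x <= 1]].
Proof.
split; first by exists (rnorm (T 0)), 0 => //=; rewrite rnorm0.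
have := valP T; rewrite inE => -[_ [M TM]]; exists `|M| => _ [x /= x1 <-].
rewrite (le_trans (TM x))// (@le_trans _ _ (`|M| * rnorm x))//.
  by rewrite ler_wpM2r ?rnorm_ge0// ler_norm.
by rewrite ler_piMr.
Qed.

Lemma opnorm_ge0 T : 0 <= opnorm T.
Proof.
apply: le_trans (ub_le_sup (opnorm_has_sup T).2 _); first exact: (rnorm_ge0 (T 0)).
by exists 0 => //=; rewrite rnorm0.
Qed.

Lemma opnormP T x : rnorm (T x) <= opnorm T * rnorm x.
Proof.
have [x0|x0] := eqVneq (rnorm x) 0.
  by rewrite (rnorm0_eq0 x0) linear0 !rnorm0 mulr0.
have xgt0 : 0 < rnorm x by rewrite lt_neqAle eq_sym x0 rnorm_ge0.
rewrite -ler_pdivrMr//; apply: ub_le_sup; first exact: (opnorm_has_sup T).2.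
have ix : rnorm ((rnorm x)^-1%:C : R[i]) = (rnorm x)^-1.
  by apply: complexI; rewrite rnormE ger0_norm// ler0c invr_ge0 ltW.
exists ((rnorm x)^-1%:C *: x) => /=.
  by rewrite rnormZ ix mulVf.
by rewrite linearZ rnormZ ix mulrC.
Qed.

Let opnorm_le T M : (forall x, rnorm x <= 1 -> rnorm (T x) <= M) -> opnorm T <= M.
Proof.
move=> TM; apply: ge_sup; first exact: (opnorm_has_sup T).1.
by move=> _ [x /= x1 <-]; exact: TM.
Qed.

Let opnormD S T : (opnorm (S + T))%:C <= (opnorm S)%:C + (opnorm T)%:C.
Proof.
rewrite -rmorphD/= lecR; apply: opnorm_le => x x1.
rewrite -[Bop_fun _ x]/(S x + T x) (le_trans (ler_rnormD _ _))//.
by apply: lerD; apply: ub_le_sup; (exact: (opnorm_has_sup _).2 || by exists x).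
Qed.

Let opnormZ_le (a : R[i]) T : opnorm (a *: T) <= rnorm a * opnorm T.
Proof.
apply: opnorm_le => x x1; rewrite -[Bop_fun _ x]/(a *: T x) rnormZ.
rewrite ler_wpM2l ?rnorm_ge0//.
by apply: ub_le_sup; [exact: (opnorm_has_sup _).2|exists x].
Qed.

Let opnorm0_eq0 T : (opnorm T)%:C = 0 -> T = 0.
Proof.
move=> /complexI T0; apply/val_inj/funext => x /=; apply: rnorm0_eq0.
by apply/eqP; rewrite eq_le rnorm_ge0 andbT (le_trans (opnormP T x))// T0 mul0r.
Qed.

Let opnormZ (a : R[i]) T : (opnorm (a *: T))%:C = `|a| * (opnorm T)%:C.
Proof.
rewrite -(rnormE a) -rmorphM/=; congr (_%:C); apply/eqP; rewrite eq_le opnormZ_le/=.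
have [->|a0] := eqVneq a 0; first by rewrite rnorm0 mul0r opnorm_ge0.
have na0 : 0 < rnorm a.
  rewrite lt_neqAle rnorm_ge0 andbT eq_sym; apply: contra a0 => /eqP.
  by move=> /rnorm0_eq0 ->.
rewrite mulrC -ler_pdivlMr//.
apply: le_trans (_ : opnorm (a^-1 *: (a *: T)) <= _).
  by rewrite scalerA mulVf// scale1r.
apply: le_trans (opnormZ_le _ _) _; rewrite mulrC ler_wpM2l ?opnorm_ge0//.
rewrite (_ : rnorm a^-1 = (rnorm a)^-1)//; apply: complexI.
by rewrite fmorphV/= !rnormE normfV.
Qed.

HB.instance Definition _ :=
  Lmodule_isNormed.Build R[i] Bop opnormD opnormZ opnorm0_eq0.

End bounded_operators.

Section projective_tensor_product.
Context (R : realType) (X Y : normedModType R[i]).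
Implicit Types (u v : seq (X * Y)) (B : X -> Y -> R[i]).

(* A finite sequence [:: (x_1, y_1); ...] stands for the element
   x_1 (x) y_1 + ... of the algebraic tensor product; two sequences stand for
   the same element iff no bilinear form separates them. *)
Definition bilinear_form B :=
  (forall y, scalar (B ^~ y)) /\ (forall x, scalar (B x)).

Definition tensor_eval B u : R[i] := \sum_(z <- u) B z.1 z.2.

Definition tensor_eq u v :=
  forall B, bilinear_form B -> tensor_eval B u = tensor_eval B v.

Definition tensor_sub u v := u ++ [seq (- z.1, z.2) | z <- v].

Definition proj_norm u : R :=
  inf [set \sum_(z <- v) rnorm z.1 * rnorm z.2 | v in [set v | tensor_eq u v]].

Definition proj_cauchy (u : nat -> seq (X * Y)) :=
  forall e : R, 0 < e -> exists N, forall m n, (N <= m)%N -> (N <= n)%N ->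
    proj_norm (tensor_sub (u m) (u n)) < e.

(* The completed projective tensor product. Its elements are represented by
   Cauchy sequences without identifying equivalent ones: only the values of
   [ptensor_eval B] at bounded bilinear forms [B] are used, and these depend
   only on the element represented. *)
Definition ptensor : Type := {u : nat -> seq (X * Y) | proj_cauchy u}.

Definition ptensor_eval B (u : ptensor) : R[i] :=
  lim ((fun n => tensor_eval B (sval u n)) @ \oo).

End projective_tensor_product.

Definition cintegral d (T : measurableType d) (R : realType)
    (mu : {measure set T -> \bar R}) (f : T -> R[i]) : R[i] :=
  (Rintegral mu setT (fun x => complex.Re (f x)))
  +i* (Rintegral mu setT (fun x => complex.Im (f x))).

(* The class of [f] in L_p, or 0 if [f] is not p-integrable. *)
Definition Lp_class d (T : measurableType d) (R : realType)
    (mu : {measure set T -> \bar R}) (p : R) (p1 : 1 <= p) (f : T -> R[i]) :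
    Lp mu p1 :=
  \pi_(Lp mu p1) (insubd (0 : cLfunType mu p1) f).

Lemma Lp_classP d (T : measurableType d) (R : realType)
    (mu : {measure set T -> \bar R}) (p : R) (p1 : 1 <= p) (f : T -> R[i]) :
  f \in cLfun mu p -> {ae mu, forall x, Lp_class mu p1 f x = f x}.
Proof.
move=> fp; have fE : val (insubd (0 : cLfunType mu p1) f) = f by rewrite insubdK.
by rewrite -[in X in {ae _, forall x, _ = X x}]fE; exact: Lp_repr_pi.
Qed.

(* [E] is isometric to the quotient of the closed subspace [F] of some L_p
   space by the kernel of [q]. *)
Definition SQ (R : realType) (p : R) (p1 : 1 <= p)
    (E : completeNormedModType R[i]) : Prop :=
  exists (d : measure_display) (T : measurableType d)
    (mu : {measure set T -> \bar R}) (F : set (Lp mu p1)) (q : Lp mu p1 -> E),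
  [/\ closed F, F 0,
      (forall (a : R[i]) f g, F f -> F g -> F (a *: f + g)),
      (forall (a : R[i]) f g, F f -> F g -> q (a *: f + g) = a *: q f + q g) &
      (forall e : E, (exists2 f, F f & q f = e) /\
         rnorm e = inf [set rnorm f | f in F `&` [set f | q f = e]])].

HB.mixin Record isLocallyCompactGroup G & PointedTopological G & Group G := {
  lcg_mul_continuous : continuous (fun xy : G * G => (xy.1 * xy.2)%g) ;
  lcg_inv_continuous : continuous (fun x : G => (x^-1)%g) ;
  lcg_hausdorff : hausdorff_space G ;
  lcg_locally_compact : locally_compact [set: G]
}.

(* The distinguished point of a pointed type, required by [measurableType],
   plays no role: a group is nonempty. *)
#[short(type=lcGroupType)]
HB.structure Definition LocallyCompactGroup :=
  {G of PointedTopological G & Group G & isLocallyCompactGroup G}.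

Definition borel (G : lcGroupType) := g_sigma_algebraType (@open G).

Section haar.
Context (R : realType) (G : lcGroupType)
  (mu : {measure set (borel G) -> \bar R}).
Implicit Types A U K : set (borel G).

(* Nonzero left-invariant Radon measures: finite on compact sets, outer regular
   on Borel sets and inner regular on open sets. *)
Definition left_haar : Prop :=
  [/\ (0 < mu setT)%E,
      (forall K, compact (K : set G) -> (mu K < +oo)%E),
      (forall (s : G) A, measurable A -> mu [set (s * t)%g | t in A] = mu A),
      (forall A, measurable A ->
         mu A = ereal_inf [set mu U | U in [set U | open (U : set G) /\ A `<=` U]]) &
      (forall U, open (U : set G) ->
         mu U = ereal_sup [set mu K | K in [set K | compact (K : set G) /\ K `<=` U]])].

(* The convention for which rho_p(s) f(t) = f(ts) Delta(s)^(1/p) is isometric. *)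
Definition modular_function (Delta : G -> R) : Prop :=
  (forall s, 0 < Delta s) /\
  (forall (s : G) A, measurable A ->
     mu [set (t * s)%g | t in A] = ((Delta s)%:E * mu A)%E).

End haar.

Lemma conj_gt1 (R : realType) (p p' : R) :
  1 < p -> p^-1 + p'^-1 = 1 -> 1 < p'.
Proof.
move=> p1 pp'; have p0 : 0 < p by exact: lt_trans p1.
have p'E : p'^-1 = 1 - p^-1 by rewrite -pp' addrC addKr.
have p'0 : 0 < p'^-1 by rewrite p'E subr_gt0 invf_lt1.
have : p'^-1 < 1 by rewrite p'E ltrBlDr ltrDl invr_gt0.
by rewrite invf_lt1// -invr_gt0.
Qed.

Section pAP.
Context (R : realType) (G : lcGroupType) (mu : {measure set (borel G) -> \bar R})
  (Delta : G -> R) (p p' : R) (p1 : 1 < p) (pp' : p^-1 + p'^-1 = 1).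

Local Notation LpG := (Lp mu (ltW p1)).
Local Notation Lp'G := (Lp mu (ltW (conj_gt1 p1 pp'))).
Local Notation L1G := (Lp mu (lexx 1)).

Definition lambda_p (s : G) (f : LpG) : LpG :=
  Lp_class mu (ltW p1) (fun t : G => f (s^-1 * t)%g).

Definition rho_p (s : G) (f : LpG) : LpG :=
  Lp_class mu (ltW p1) (fun t : G => f (t * s)%g * (Delta s `^ p^-1)%:C).

Definition duality (g : Lp'G) (f : LpG) : R[i] :=
  cintegral mu (fun t => g t * f t).

Definition op_pairing (T : Bop LpG LpG) (u : ptensor Lp'G LpG) : R[i] :=
  ptensor_eval (fun g f => duality g (T f)) u.

Definition weakstar_Bop : Type :=
  initial_topology (op_pairing : Bop LpG LpG -> {ptws ptensor Lp'G LpG -> R[i]}).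
HB.instance Definition _ := Topological.on weakstar_Bop.

Definition lin_span (A : set (Bop LpG LpG)) : set (Bop LpG LpG) :=
  [set T | exists (n : nat) (c : 'I_n -> R[i]) (S : 'I_n -> Bop LpG LpG),
    (forall i, A (S i)) /\ T = \sum_(i < n) c i *: S i].

Definition lambda_ops : set (Bop LpG LpG) :=
  [set T | exists s, forall f, T f = lambda_p s f].

Definition PM : set (Bop LpG LpG) :=
  closure (lin_span lambda_ops : set weakstar_Bop).

Definition CV : set (Bop LpG LpG) :=
  [set T | forall s f, T (rho_p s f) = rho_p s (T f)].

Definition Lambda_p (u : ptensor Lp'G LpG) (s : G) : R[i] :=
  ptensor_eval (fun g f => duality g (lambda_p s f)) u.

Definition Ap : set (G -> R[i]) := range Lambda_p.

(* [Bop E R[i]] is the dual Banach space of [E]. *)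
Definition pcb_rep (phi : G -> R[i]) (E : completeNormedModType R[i])
    (alpha : G -> E) (beta : G -> Bop E R[i]) : Prop :=
  [/\ SQ (ltW p1) E,
      continuous alpha /\ has_ubound (range (rnorm \o alpha)),
      continuous beta /\ has_ubound (range (rnorm \o beta)) &
      forall s t : G, phi (s * t^-1)%g = beta s (alpha t)].

Definition Mpcb : set (G -> R[i]) :=
  [set phi | exists E alpha beta, @pcb_rep phi E alpha beta].

Definition Mpcb_norm (phi : G -> R[i]) : R :=
  inf [set r | exists E alpha beta, @pcb_rep phi E alpha beta /\
    r = sup (range (rnorm \o alpha)) * sup (range (rnorm \o beta))].

(* Elements of the dual of M_{p-cb}(G) are functions on all of G -> R[i], of
   which only the restriction to M_{p-cb}(G) matters. *)
Definition Mpcb_dual : set ((G -> R[i]) -> R[i]) :=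
  [set q | (forall (a : R[i]) phi psi, Mpcb phi -> Mpcb psi ->
              q (a *: phi + psi) = a * q phi + q psi) /\
           (exists M : R, forall phi, Mpcb phi ->
              rnorm (q phi) <= M * Mpcb_norm phi)].

Definition Mpcb_dual_norm (q : (G -> R[i]) -> R[i]) : R :=
  sup [set rnorm (q phi) | phi in Mpcb `&` [set phi | Mpcb_norm phi <= 1]].

Definition L1_functional (f : L1G) (phi : G -> R[i]) : R[i] :=
  cintegral mu (fun t => f t * phi t).

Definition Qpcb : set ((G -> R[i]) -> R[i]) :=
  [set q | Mpcb_dual q /\ forall e : R, 0 < e ->
    exists f : L1G, Mpcb_dual_norm (q \- L1_functional f) < e].

Definition directed (I : Type) (le : I -> I -> Prop) : Prop :=
  [/\ inhabited I, (forall i, le i i),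
      (forall i j k, le i j -> le j k -> le i k) &
      (forall i j, exists k, le i k /\ le j k)].

Definition tails (I : Type) (le : I -> I -> Prop) : set_system I :=
  [set A | exists i0, forall i, le i0 i -> A i].

Definition has_pAP : Prop :=
  exists (I : Type) (le : I -> I -> Prop) (phi : I -> G -> R[i]),
  [/\ directed le, (forall i, Ap (phi i)) &
      forall q, Qpcb q -> q (phi i) @[i --> tails le] --> q (cst 1)].

End pAP.

Arguments PM {R G} mu {p p'} p1 pp'.
Arguments CV {R G} mu Delta {p} p1.

(* Main.v *)
(** Let T commute with right translations. By linear algebra in finite dimension,
    T is a weak* limit of linear combinations of the lambda_p(s) as soon as every
    e in the projective tensor product of L_p' and L_p that is killed by all the
    lambda_p(s), i.e. Lambda_p(e) = 0, is killed by T. Fix h >= 0 in C_c(G) with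
    int Delta(y^-1) h(z y^-1) dy = 1 for all z and put, for g, f in C_c(G),
      b_phi(g, f) = int <phi g_y, T (h f_y)> dy,   where g_y(t) = g(t y).
    Then b_1(g, f) = <g, T f>. If phi(s t^-1) = <beta(s), alpha(t)> with alpha in a
    subquotient of L_p, a Riemann sum in y exhibits b_phi(g, f) as a finite sum
    which lifts to the L_p space, so that
      |b_phi(g, f)| <= C |alpha| |beta| |T| |g| |f|.
    For fixed g and f, phi |-> b_phi(g, f) is a norm limit of L_1 functionals.
    Hence q(phi) = e(b_phi) defines an element q of Q_pcb with q(1) = <T, e>.
    If phi is in C_c(G), then |b_phi(g, f)| <= C |T| |g| |f| for every bounded T by
    Hoelder's inequality in y; replacing T by T P with P an averaging operator of
    finite rank, e(b_phi) only depends on Lambda_p(e), hence q(phi) = 0. By density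
    q vanishes on A_p(G), and the p-AP gives <T, e> = q(1) = lim q(phi_i) = 0. *)

Require Import Defs.
From HB Require Import structures.
From mathcomp Require Import all_boot all_order all_algebra.
From mathcomp Require Import all_classical all_reals all_analysis.
From mathcomp Require Import measurable_realfun complex lra ring.
Set Implicit Arguments. Unset Strict Implicit. Unset Printing Implicit Defensive.
Import Order.TTheory GRing.Theory Num.Theory.
Import numFieldNormedType.Exports.
Local Open Scope classical_set_scope.
Local Open Scope ring_scope.
Local Open Scope complex_scope.

(** * Complex-valued L_p functions *)

(** The cut-off h cures a lack of integrability: without it the integrand of b_1 would be
    Delta(y^-1) <g, T f>, whereas h f_y vanishes unless y lies in a compact set. As T commutes with
    right translations, y can be moved to the weights h(z y^-1), whose integral is 1. The two bounds
    on b_phi have different scopes. The one by |alpha| |beta| needs the commutation. The one for phi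
    in C_c holds for every bounded operator and thus survives the passage from T to T P, which
    destroys commutation. Finite rank separates g from f: b_phi becomes a finite sum of integrals in
    y of products of two correlations, and regrouping leaves only int g(s y) f(z y) dy, a value of a
    coefficient of the left regular representation. Since mu need not be sigma-finite, iterated
    integrals are not exchanged directly: each integral over y runs over a compact set and is
    compared with a Riemann sum over a finite Borel partition, chosen independently of phi. The
    constant C is 5, a price for crude approximations; only its finiteness counts. Taking L_p itself
    for the subquotient gives the same bound for coefficients of the regular representation, hence
    the density argument on A_p(G). *)

Section complex_modulus.
Context {R : realType}.
Implicit Types z w : R[i].

Lemma rnormM z w : rnorm (z * w) = rnorm z * rnorm w.
Proof. exact: (rnormZ z w). Qed.

Lemma rnorm_real (r : R) : rnorm (r%:C : R[i]) = `|r|.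
Proof. by rewrite rnorm_complexE /= expr0n/= addr0 sqrtr_sqr. Qed.

Lemma rnorm1 : rnorm (1 : R[i]) = 1.
Proof. by rewrite -[1]/(1%:C) rnorm_real normr1. Qed.

Lemma ler_Re_rnorm z : `|complex.Re z| <= rnorm z.
Proof. by rewrite rnorm_complexE -sqrtr_sqr ler_wsqrtr// lerDl sqr_ge0. Qed.

Lemma ler_Im_rnorm z : `|complex.Im z| <= rnorm z.
Proof. by rewrite rnorm_complexE -sqrtr_sqr ler_wsqrtr// lerDr sqr_ge0. Qed.

Lemma rnorm_le_ReIm z : rnorm z <= `|complex.Re z| + `|complex.Im z|.
Proof.
rewrite rnorm_complexE -(ger0_norm (addr_ge0 (normr_ge0 _) (normr_ge0 _))).
rewrite -sqrtr_sqr ler_wsqrtr// sqrrD !real_normK ?num_real// lerD2r lerDl.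
by rewrite mulrn_wge0// mulr_ge0.
Qed.

Lemma rnorm_gt0 {V : normedModType R[i]} (x : V) : x != 0 -> 0 < rnorm x.
Proof. by move=> x0; rewrite lt_neqAle rnorm_ge0 andbT eq_sym; apply: contra x0 => /eqP /rnorm0_eq0 ->. Qed.

Lemma rnorm_sum {V : normedModType R[i]} I (s : seq I) (P : pred I) (F : I -> V) :
  rnorm (\sum_(i <- s | P i) F i) <= \sum_(i <- s | P i) rnorm (F i).
Proof.
elim/big_rec2: _ => [|i x y _ h]; first by rewrite rnorm0.
by rewrite (le_trans (ler_rnormD _ _))// lerD2l.
Qed.

Lemma ler_rnormB {V : normedModType R[i]} (x y : V) :
  rnorm (x - y) <= rnorm x + rnorm y.
Proof. by rewrite (le_trans (ler_rnormD _ _))// rnormN. Qed.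

Lemma rnormBC {V : normedModType R[i]} (x y : V) : rnorm (x - y) = rnorm (y - x).
Proof. by rewrite -rnormN opprB. Qed.

Lemma lerB_rnormD {V : normedModType R[i]} (x y : V) :
  `|rnorm x - rnorm y| <= rnorm (x - y).
Proof.
rewrite ler_norml; apply/andP; split.
- by rewrite lerNl opprB lerBlDr rnormBC -[X in rnorm X <= _](subrK x y) ler_rnormD.
- by rewrite lerBlDr -[X in rnorm X <= _](subrK y x) ler_rnormD.
Qed.

End complex_modulus.

Section cmeasurable_theory.
Context d (T : measurableType d) (R : realType).
Implicit Types f g : T -> R[i].

Lemma cmeasurableM f g : cmeasurable f -> cmeasurable g ->
  cmeasurable (fun x => f x * g x).
Proof.
move=> [f1 f2] [g1 g2]; split.
- rewrite (_ : _ \o _ = (fun x => complex.Re (f x) * complex.Re (g x)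
     - complex.Im (f x) * complex.Im (g x))).
    by apply: measurable_funB; apply: measurable_funM.
  by apply/funext => x /=; case: (f x) => a b; case: (g x).
- rewrite (_ : _ \o _ = (fun x => complex.Re (f x) * complex.Im (g x)
     + complex.Im (f x) * complex.Re (g x))).
    by apply: measurable_funD; apply: measurable_funM.
  by apply/funext => x /=; case: (f x) => a b; case: (g x).
Qed.

Lemma cmeasurableB f g : cmeasurable f -> cmeasurable g -> cmeasurable (f - g).
Proof.
move=> mf mg; rewrite -scaleN1r; apply: cmeasurableD => //.
exact: cmeasurableZ.
Qed.

Lemma cmeasurable_sum I (s : seq I) (F : I -> T -> R[i]) :
  (forall i, cmeasurable (F i)) -> cmeasurable (\sum_(i <- s) F i).
Proof.
move=> mF; elim/big_rec: _ => [|i f _ mf]; first exact: cmeasurable_cst.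
exact: cmeasurableD.
Qed.

Lemma cmeasurable_real (f : T -> R) : measurable_fun setT f ->
  cmeasurable (fun x => (f x)%:C).
Proof.
move=> mf; split; first by rewrite (_ : _ \o _ = f).
by rewrite (_ : _ \o _ = cst 0); [exact: measurable_cst|exact/funext].
Qed.

Lemma cmeasurable_conj f : cmeasurable f -> cmeasurable (fun x => (f x)^*)%C.
Proof.
move=> [f1 f2]; split.
  by rewrite (_ : _ \o _ = @complex.Re R \o f)//; apply/funext => x /=; case: (f x).
rewrite (_ : _ \o _ = \- (@complex.Im R \o f)); last first.
  by apply/funext => x /=; case: (f x).
exact: measurableT_comp.
Qed.

Definition cindic (A : set T) : T -> R[i] := fun x => (\1_A x)%:C.

Lemma cmeasurable_cindic A : measurable A -> cmeasurable (cindic A).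
Proof. by move=> mA; apply: cmeasurable_real; exact: measurable_indic. Qed.

Lemma cmeasurable_comp d' (T' : measurableType d') (h : T' -> T) f :
  measurable_fun setT h -> cmeasurable f -> cmeasurable (f \o h).
Proof. by move=> mh [f1 f2]; split; rewrite compA; exact: measurableT_comp. Qed.

End cmeasurable_theory.

Section cnorm.
Context d (T : measurableType d) (R : realType) (mu : {measure set T -> \bar R}).
Variables (p : R) (p1 : 1 <= p).
Implicit Types f g : T -> R[i].
Local Notation cLf := (cLfun mu p).

Let p0 : 0 < p. Proof. exact: lt_le_trans p1. Qed.

Lemma cLfunE f : (f \in cLf) <-> cmeasurable f /\ (cLnorm mu p f < +oo)%E.
Proof. by rewrite inE. Qed.

Lemma cLfun_meas f : f \in cLf -> cmeasurable f.
Proof. by rewrite inE => -[]. Qed.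

Lemma cLfun_sub f g : f \in cLf -> g \in cLf -> f - g \in cLf.
Proof.
move=> fp gp; rewrite addrC -scaleN1r.
exact: (cLfun_submod_closed mu p1).2.
Qed.

Lemma cLfun0 : 0 \in cLf.
Proof. exact: (cLfun_submod_closed mu p1).1. Qed.

Lemma cLfunZ a f : f \in cLf -> a *: f \in cLf.
Proof.
move=> fp; rewrite -[_ *: _]addr0.
by apply: (cLfun_submod_closed mu p1).2 => //; exact: cLfun0.
Qed.

Lemma cLfunD f g : f \in cLf -> g \in cLf -> f + g \in cLf.
Proof.
by move=> fp gp; rewrite -[f]scale1r; apply: (cLfun_submod_closed mu p1).2.
Qed.

Lemma cLfun_sum I (s : seq I) (F : I -> T -> R[i]) :
  (forall i, F i \in cLf) -> \sum_(i <- s) F i \in cLf.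
Proof.
by move=> h; elim/big_rec: _ => [|i f _ mf]; [exact: cLfun0|exact: cLfunD].
Qed.

(** [fine] sends an infinite norm to 0, so the value is meaningful only on [cLfun]. This is why the
    estimates below deliver membership and bound together. *)
Definition cnorm f : R := fine (cLnorm mu p f).

Lemma cnorm_ge0 f : 0 <= cnorm f.
Proof. by apply: fine_ge0; exact: Lnorm_ge0. Qed.

Lemma cnormE f : f \in cLf -> (cnorm f)%:E = cLnorm mu p f.
Proof.
by move=> /cLfunE[_ h]; rewrite fineK// ge0_fin_numE ?Lnorm_ge0.
Qed.

Lemma cnormD f g : f \in cLf -> g \in cLf -> cnorm (f + g) <= cnorm f + cnorm g.
Proof.
move=> fp gp; rewrite -lee_fin EFinD !cnormE ?cLfunD//.
by apply: cLnormD => //; exact: cLfun_meas.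
Qed.

Lemma cnormZ a f : f \in cLf -> cnorm (a *: f) = rnorm a * cnorm f.
Proof.
move=> fp; apply: EFin_inj; rewrite EFinM !cnormE ?cLfunZ//.
by apply: cLnormZ => //; exact: cLfun_meas.
Qed.

Lemma cnorm_dom f g (M : R) : 0 <= M -> cmeasurable f -> g \in cLf ->
  (forall x, rnorm (f x) <= M * rnorm (g x)) ->
  f \in cLf /\ cnorm f <= M * cnorm g.
Proof.
move=> M0 mf gp fg; have mg := cLfun_meas gp.
have key : (cLnorm mu p f <= M%:E * cLnorm mu p g)%E.
  have rM : rnorm (M%:C : R[i]) = M by rewrite rnorm_real ger0_norm.
  rewrite -[X in (X%:E * _)%E]rM -cLnormZ//; apply: le_cLnorm => //.
    by apply: cmeasurable_rnorm; exact: cmeasurableZ.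
  by move=> x /=; rewrite [leRHS](rnormM M%:C (g x)) rM.
have fp : f \in cLf.
  apply/cLfunE; split => //; apply: le_lt_trans key _.
  by rewrite -cnormE// -EFinM ltry.
by split => //; rewrite -lee_fin EFinM !cnormE.
Qed.

Lemma cLfunMb f g (M : R) : cmeasurable f -> (forall x, rnorm (f x) <= M) ->
  g \in cLf -> (fun x => f x * g x) \in cLf /\
  cnorm (fun x => f x * g x) <= M * cnorm g.
Proof.
move=> mf fM gp; apply: cnorm_dom => //.
- exact: le_trans (rnorm_ge0 _) (fM point).
- by apply: cmeasurableM => //; exact: cLfun_meas.
- by move=> x; rewrite rnormM ler_wpM2r ?rnorm_ge0.
Qed.

Lemma cnormX f : f \in cLf ->
  ((cnorm f `^ p)%:E = \int[mu]_x (rnorm (f x) `^ p)%:E)%E.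
Proof.
move=> fp; rewrite -poweR_EFin (cnormE fp) /cLnorm (poweR_Lnorm _ _ (lt0r_neq0 p0)).
by apply: eq_integral => x _ /=; rewrite ger0_norm ?rnorm_ge0.
Qed.

Lemma measurable_rnorm_powR f : cmeasurable f ->
  measurable_fun setT (fun x => (rnorm (f x) `^ p)%:E).
Proof.
move=> mf; apply/measurable_EFinP.
apply: (measurableT_comp (measurable_powR p)).
exact: cmeasurable_rnorm.
Qed.

Lemma cLfun_powR f : cmeasurable f ->
  (\int[mu]_x (rnorm (f x) `^ p)%:E < +oo)%E -> f \in cLf.
Proof.
move=> mf fi; apply/cLfunE; split => //.
rewrite /cLnorm unlock /Lnorm.
under eq_integral do rewrite /= ger0_norm ?rnorm_ge0//.
by apply: poweR_lty.
Qed.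

Lemma cnorm_powR_le f M : 0 <= M -> cmeasurable f ->
  (\int[mu]_x (rnorm (f x) `^ p)%:E <= (M `^ p)%:E)%E ->
  f \in cLf /\ cnorm f <= M.
Proof.
move=> M0 mf fM; have fp : f \in cLf.
  by apply: cLfun_powR => //; rewrite (le_lt_trans fM) ?ltry.
split => //; move: fM; rewrite -cnormX// lee_fin => h.
have := @ge0_ler_powR _ p^-1; rewrite invr_ge0 (ltW p0) => /(_ isT).
move=> /(_ _ _ _ _ h); rewrite !nnegrE !powR_ge0 -!powRrM => /(_ isT isT).
by rewrite divff ?gt_eqF// !powRr1// cnorm_ge0.
Qed.

Lemma ae_cnorm f g : f \in cLf -> cmeasurable g -> {ae mu, forall x, f x = g x} ->
  g \in cLf /\ cnorm g = cnorm f.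
Proof.
move=> fp mg fg; have mf := cLfun_meas fp.
have E : cLnorm mu p f = cLnorm mu p g by apply: ae_eq_cLnorm.
split; last by rewrite /cnorm E.
by apply/cLfunE; split => //; rewrite -E; have /cLfunE[] := fp.
Qed.

End cnorm.

(** * Integrals of complex-valued functions *)

Section cintegral.
Context d (T : measurableType d) (R : realType) (mu : {measure set T -> \bar R}).
Implicit Types f g : T -> R[i].
Local Notation L1 := (cLfun mu 1).

Let p1 : 1 <= 1 :> R := lexx 1.

Lemma cnorm1E f : f \in L1 -> ((cnorm mu 1 f)%:E = \int[mu]_x (rnorm (f x))%:E)%E.
Proof.
move=> fp; rewrite -[cnorm _ _ _]powRr1 ?cnorm_ge0// cnormX//.
by apply: eq_integral => x _; rewrite powRr1// rnorm_ge0.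
Qed.

Lemma cL1P f : f \in L1 <->
  cmeasurable f /\ (\int[mu]_x (rnorm (f x))%:E < +oo)%E.
Proof.
have E : (\int[mu]_x (rnorm (f x))%:E)%E = (\int[mu]_x (rnorm (f x) `^ 1)%:E)%E.
  by apply: eq_integral => x _; rewrite powRr1// rnorm_ge0.
split=> [fp|[mf]]; last by rewrite E; exact: cLfun_powR.
by split; [exact: cLfun_meas fp|rewrite -cnorm1E// ltry].
Qed.

Lemma integrable_rnorm f : f \in L1 ->
  mu.-integrable setT (EFin \o (fun x => rnorm (f x))).
Proof.
move=> /cL1P[mf fi]; apply/integrableP; split.
  by apply/measurable_EFinP; exact: cmeasurable_rnorm.
by under eq_integral do rewrite /= ger0_norm ?rnorm_ge0//.
Qed.

Let integrable_part f (h : R[i] -> R) : measurable_fun setT (h \o f) ->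
  (forall z, `|h z| <= rnorm z) -> f \in L1 ->
  mu.-integrable setT (EFin \o (h \o f)).
Proof.
move=> mh hr f1; apply: le_integrable (integrable_rnorm f1) => //.
  exact/measurable_EFinP.
by move=> x _ /=; rewrite lee_fin [leRHS]ger0_norm ?rnorm_ge0.
Qed.

Lemma integrable_cRe f : f \in L1 -> mu.-integrable setT (EFin \o (@complex.Re R \o f)).
Proof.
move=> f1; apply: integrable_part => //; last exact: ler_Re_rnorm.
by have [] := cLfun_meas f1.
Qed.

Lemma integrable_cIm f : f \in L1 -> mu.-integrable setT (EFin \o (@complex.Im R \o f)).
Proof.
move=> f1; apply: integrable_part => //; last exact: ler_Im_rnorm.
by have [] := cLfun_meas f1.
Qed.

Lemma cintegralD f g : f \in L1 -> g \in L1 ->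
  cintegral mu (f + g) = cintegral mu f + cintegral mu g.
Proof.
move=> f1 g1; rewrite /cintegral; apply/eqP; rewrite eq_complex/=.
rewrite -(RintegralD measurableT (integrable_cRe f1) (integrable_cRe g1)).
rewrite -(RintegralD measurableT (integrable_cIm f1) (integrable_cIm g1)).
by apply/andP; split; apply/eqP/eq_Rintegral => x _ /=;
  rewrite -[(f + g) x]/(f x + g x) raddfD.
Qed.

Lemma cintegralZ (a : R[i]) f : f \in L1 -> cintegral mu (a *: f) = a * cintegral mu f.
Proof.
move=> f1; have fR := integrable_cRe f1; have fI := integrable_cIm f1.
have ZE (r : R) (h : T -> R) : mu.-integrable setT (EFin \o h) ->
    mu.-integrable setT (EFin \o (fun x => r * h x)).
  by move=> hi; apply: (integrableZl measurableT r hi).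
case: a => a b; rewrite /cintegral; apply/eqP; rewrite eq_complex/=.
rewrite -!(RintegralZl _ measurableT fR) -!(RintegralZl _ measurableT fI).
rewrite -RintegralB//; [|exact: ZE..].
rewrite -RintegralD//; [|exact: ZE..].
by apply/andP; split; apply/eqP/eq_Rintegral => x _ /=; rewrite /GRing.scale/=;
  case: (f x).
Qed.

Lemma cintegral0 : cintegral mu (0 : T -> R[i]) = 0.
Proof. by rewrite -(scale0r (0 : T -> R[i])) cintegralZ ?mul0r// cLfun0. Qed.

Lemma cintegral_sum I (s : seq I) (F : I -> T -> R[i]) : (forall i, F i \in L1) ->
  cintegral mu (\sum_(i <- s) F i) = \sum_(i <- s) cintegral mu (F i).
Proof.
move=> F1; elim: s => [|i s ih]; first by rewrite !big_nil cintegral0.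
by rewrite !big_cons cintegralD ?ih//; exact: cLfun_sum.
Qed.

Lemma cintegralB f g : f \in L1 -> g \in L1 ->
  cintegral mu (f - g) = cintegral mu f - cintegral mu g.
Proof.
move=> f1 g1; rewrite -scaleN1r cintegralD ?cLfunZ// cintegralZ//.
by rewrite mulN1r.
Qed.

Lemma ae_eq_cintegral f g : cmeasurable f -> cmeasurable g ->
  {ae mu, forall x, f x = g x} -> cintegral mu f = cintegral mu g.
Proof.
move=> [f1 f2] [g1 g2] fg; rewrite /cintegral /Rintegral.
congr (fine _ +i* fine _); apply: ae_eq_integral => //;
  [exact/measurable_EFinP..| |exact/measurable_EFinP|exact/measurable_EFinP|].
- by apply: filterS fg => x /= ->.
- by apply: filterS fg => x /= ->.
Qed.

(* Rotate the integral onto the real axis. *)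
Lemma rnorm_cintegral f : f \in L1 -> rnorm (cintegral mu f) <= cnorm mu 1 f.
Proof.
move=> f1; have [->|I0] := eqVneq (cintegral mu f) 0.
  by rewrite rnorm0 cnorm_ge0.
set I := cintegral mu f in I0 *.
have rI := rnorm_gt0 I0.
pose a : R[i] := I^* / (rnorm I)%:C.
have aI : a * I = (rnorm I)%:C.
  rewrite /a mulrAC [_^* * _]mulrC -normCK -rnormE expr2 mulfK//.
  by rewrite -[0]/(0%:C) (inj_eq (@complexI R)) gt_eqF.
have ra : rnorm a = 1.
  have : rnorm (a * I) = rnorm I by rewrite aI rnorm_real ger0_norm// ltW.
  by rewrite rnormM => /(canRL (mulfK (lt0r_neq0 rI))) ->; rewrite divff// gt_eqF.
have : complex.Re (cintegral mu (a *: f)) = rnorm I.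
  by rewrite cintegralZ// aI.
rewrite /= => <-; rewrite (le_trans (ler_norm _))//.
have af1 := cLfunZ p1 a f1.
rewrite (le_trans (le_normr_Rintegral _ (integrable_cRe af1)))//.
have <- : cnorm mu 1 (a *: f) = cnorm mu 1 f by rewrite cnormZ// ra mul1r.
rewrite -lee_fin cnorm1E//.
rewrite /Rintegral fineK; last first.
  by apply: integrable_fin_num => //; exact: (integrable_norm (integrable_cRe af1)).
apply: ge0_le_integral => //.
- apply/measurable_EFinP; apply: measurableT_comp => //.
  by have [] := cLfun_meas af1.
- by apply/measurable_EFinP; apply: cmeasurable_rnorm; exact: cLfun_meas af1.
- by move=> x _; rewrite lee_fin ler_Re_rnorm.
Qed.

End cintegral.

Section hoelder.
Context d (T : measurableType d) (R : realType) (mu : {measure set T -> \bar R}).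
Variables (p q : R) (p1 : 1 <= p) (q1 : 1 <= q) (pq : p^-1 + q^-1 = 1).
Implicit Types f g : T -> R[i].

Lemma cLfun_hoelder g f : g \in cLfun mu q -> f \in cLfun mu p ->
  (fun x => g x * f x) \in cLfun mu 1 /\
  cnorm mu 1 (fun x => g x * f x) <= cnorm mu q g * cnorm mu p f.
Proof.
move=> gq fp; have mf := cLfun_meas fp; have mg := cLfun_meas gq.
have p0 : 0 < p by exact: lt_le_trans p1.
have q0 : 0 < q by exact: lt_le_trans q1.
have H : (\int[mu]_x (rnorm (g x * f x))%:E <= (cnorm mu q g * cnorm mu p f)%:E)%E.
  rewrite EFinM !cnormE//; apply: le_trans
    (hoelder mu (cmeasurable_rnorm mg) (cmeasurable_rnorm mf) q0 p0 _); last first.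
    by rewrite addrC.
  rewrite Lnorm1 le_eqVlt; apply/orP; left; apply/eqP/eq_integral => x _ /=.
  by rewrite rnormM ger0_norm// mulr_ge0 ?rnorm_ge0.
have h1 : (fun x => g x * f x) \in cLfun mu 1.
  apply/cL1P; split; first exact: cmeasurableM.
  by rewrite (le_lt_trans H)// ltry.
by split => //; rewrite -lee_fin cnorm1E.
Qed.

End hoelder.

Section Lp_class_theory.
Context d (T : measurableType d) (R : realType) (mu : {measure set T -> \bar R}).
Variables (p : R) (p1 : 1 <= p).
Implicit Types (f g : T -> R[i]) (x y : Lp mu p1).
Local Notation cl := (Lp_class mu p1).
Local Notation cLf := (cLfun mu p).

Lemma Lp_cLfun x : (x : T -> R[i]) \in cLf.
Proof. exact: valP (repr x). Qed.

Lemma Lp_cmeasurable x : cmeasurable (x : T -> R[i]).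
Proof. exact: cLfun_meas (Lp_cLfun x). Qed.

Lemma Lp_ext x y : {ae mu, forall t, x t = y t} -> x = y.
Proof. by move=> xy; rewrite -[x]reprK -[y]reprK; apply/Lp_piP. Qed.

Lemma Lp_class_ext f g : f \in cLf -> g \in cLf -> {ae mu, forall t, f t = g t} ->
  cl f = cl g.
Proof.
move=> fp gp fg; apply: Lp_ext.
apply: filterS3 fg (Lp_classP p1 fp) (Lp_classP p1 gp).
by move=> t + -> ->.
Qed.

Lemma Lp_classK x : cl x = x.
Proof. by apply: Lp_ext; apply: Lp_classP; exact: Lp_cLfun. Qed.

Lemma Lp_piE (f : cLfunType mu p1) : cl (val f) = \pi_(Lp mu p1)%qT f.
Proof. by rewrite /Lp_class; congr (\pi_(Lp mu p1)%qT _); rewrite valKd. Qed.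

Lemma Lp_class_linear a f g : f \in cLf -> g \in cLf ->
  cl (a *: f + g) = a *: cl f + cl g.
Proof.
move=> fp gp; have fgp : a *: f + g \in cLf by exact: cLfunD (cLfunZ _ _ _) _.
have afp : a *: f \in cLf by exact: cLfunZ.
pose f' : cLfunType mu p1 := exist _ f fp; pose g' : cLfunType mu p1 := exist _ g gp.
have E1 : cl (a *: f) = a *: cl f.
  rewrite -[a *: cl f]/(\pi_(Lp mu p1)%qT (a *: repr (cl f))) -Lp_piE.
  apply: Lp_class_ext => //; first exact: (valP (a *: repr (cl f))).
  apply: filterS (Lp_classP p1 fp) => t ft.
  by rewrite -[RHS]/(a * Lp_fun (cl f) t) ft.
rewrite -E1 -[RHS]/(\pi_(Lp mu p1)%qT (repr (cl (a *: f)) + repr (cl g))) -Lp_piE.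
apply: Lp_class_ext => //; first exact: (valP (repr (cl (a *: f)) + repr (cl g))).
apply: filterS2 (Lp_classP p1 afp) (Lp_classP p1 gp) => t ft gt.
by rewrite -[RHS]/(Lp_fun (cl (a *: f)) t + Lp_fun (cl g) t) ft gt.
Qed.

Lemma Lp_class0 : cl 0 = 0.
Proof.
have h := cLfun0 mu p1.
by have := Lp_class_linear (-1) h h; rewrite scaler0 addr0 scaleN1r addNr.
Qed.

Lemma Lp_classZ a f : f \in cLf -> cl (a *: f) = a *: cl f.
Proof.
by move=> fp; rewrite -[a *: f]addr0 Lp_class_linear ?Lp_class0 ?addr0// cLfun0.
Qed.

Lemma Lp_classD f g : f \in cLf -> g \in cLf -> cl (f + g) = cl f + cl g.
Proof. by move=> fp gp; rewrite -[f]scale1r Lp_class_linear// !scale1r. Qed.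

Lemma Lp_classB f g : f \in cLf -> g \in cLf -> cl (f - g) = cl f - cl g.
Proof.
by move=> fp gp; rewrite -scaleN1r Lp_classD ?cLfunZ// Lp_classZ// scaleN1r.
Qed.

Lemma Lp_class_sum I (s : seq I) (F : I -> T -> R[i]) : (forall i, F i \in cLf) ->
  cl (\sum_(i <- s) F i) = \sum_(i <- s) cl (F i).
Proof.
move=> F1; elim: s => [|i s ih]; first by rewrite !big_nil Lp_class0.
by rewrite !big_cons Lp_classD ?ih//; exact: cLfun_sum.
Qed.

Lemma Lp_fun_linear a x y : {ae mu, forall t, Lp_fun (a *: x + y) t = a * x t + y t}.
Proof.
have := @Lp_class_linear a x y (Lp_cLfun _) (Lp_cLfun _).
rewrite !Lp_classK => <-.
have h : a *: (x : T -> R[i]) + (y : T -> R[i]) \in cLf.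
  by apply: cLfunD => //; [apply: cLfunZ|]; rewrite ?Lp_cLfun.
by apply: filterS (Lp_classP p1 h) => t ->.
Qed.

Lemma Lp_normE x : rnorm x = cnorm mu p x.
Proof. by []. Qed.

Lemma Lp_class_norm f : f \in cLf -> rnorm (cl f) = cnorm mu p f.
Proof.
move=> fp; rewrite Lp_normE.
have := ae_cnorm fp (Lp_cmeasurable (cl f)); case=> //.
by apply: filterS (Lp_classP p1 fp) => t ->.
Qed.

End Lp_class_theory.

Section pairing.
Context d (T : measurableType d) (R : realType) (mu : {measure set T -> \bar R}).
Variables (p q : R) (p1 : 1 <= p) (q1 : 1 <= q) (pq : p^-1 + q^-1 = 1).
Implicit Types (g : Lp mu q1) (f : Lp mu p1).

Definition Lpair g f : R[i] := cintegral mu (fun t => g t * f t).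

Let int_gf g f : (fun t => g t * f t) \in cLfun mu 1.
Proof. by have [] := cLfun_hoelder p1 q1 pq (Lp_cLfun g) (Lp_cLfun f). Qed.

Lemma Lpair_bound g f : rnorm (Lpair g f) <= rnorm g * rnorm f.
Proof.
rewrite (le_trans (rnorm_cintegral (int_gf g f)))//.
by have [_] := cLfun_hoelder p1 q1 pq (Lp_cLfun g) (Lp_cLfun f).
Qed.

Lemma Lpair_bilinear : bilinear_form Lpair.
Proof.
split=> [f|g] a u v /=.
- rewrite /Lpair -cintegralZ//.
  have /= <- := cintegralD (cLfunZ (lexx 1) a (int_gf u f)) (int_gf v f).
  apply: ae_eq_cintegral.
  + exact: cLfun_meas (int_gf _ _).
  + by apply: cmeasurableD; [apply: cmeasurableZ|]; exact: cLfun_meas (int_gf _ _).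
  + apply: filterS (Lp_fun_linear a u v) => t ->.
    by rewrite -[RHS]/(a * (Lp_fun u t * Lp_fun f t) + Lp_fun v t * Lp_fun f t) mulrDl mulrA.
- rewrite /Lpair -cintegralZ//.
  have /= <- := cintegralD (cLfunZ (lexx 1) a (int_gf g u)) (int_gf g v).
  apply: ae_eq_cintegral.
  + exact: cLfun_meas (int_gf _ _).
  + by apply: cmeasurableD; [apply: cmeasurableZ|]; exact: cLfun_meas (int_gf _ _).
  + apply: filterS (Lp_fun_linear a u v) => t ->.
    by rewrite -[RHS]/(a * (Lp_fun g t * Lp_fun u t) + Lp_fun g t * Lp_fun v t) mulrDr mulrCA.
Qed.

Lemma Lpair_class (g f : T -> R[i]) : g \in cLfun mu q -> f \in cLfun mu p ->
  Lpair (Lp_class mu q1 g) (Lp_class mu p1 f) = cintegral mu (fun t => g t * f t).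
Proof.
move=> gq fp; apply: ae_eq_cintegral.
- exact: cLfun_meas (int_gf _ _).
- by apply: cmeasurableM; [exact: cLfun_meas gq|exact: cLfun_meas fp].
- by apply: filterS2 (Lp_classP q1 gq) (Lp_classP p1 fp) => t -> ->.
Qed.

Lemma Lpair_classl (g : T -> R[i]) f : g \in cLfun mu q ->
  Lpair (Lp_class mu q1 g) f = cintegral mu (fun t => g t * f t).
Proof. by move=> gq; rewrite -{1}[f]Lp_classK Lpair_class// Lp_cLfun. Qed.

(* Test against [conj f * |f| ^ (p - 2)]. *)
Lemma Lpair_separates f : (forall g, Lpair g f = 0) -> f = 0.
Proof.
move=> f0; have mf := Lp_cmeasurable f.
have p0 : 0 < p by exact: lt_le_trans p1.
have q0 : 0 < q by exact: lt_le_trans q1.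
(* Away from the zeros of f one has |g| = |f| ^ (p - 1), so this identity gives |g| ^ q = |f| ^ p
   and puts g in L_q. *)
have pqE : q * (p - 1) = p.
  have E : p * q = q + p by rewrite -[LHS]mulr1 -pq; field; rewrite !gt_eqF.
  by rewrite mulrBr mulr1 mulrC E addrC addKr.
pose g t := (f t)^*%C * ((rnorm (f t) `^ (p - 2%:R))%:C).
(* The zeros of f are treated apart because the exponent p - 2 need not be positive. *)
have rg t : rnorm (g t) = if f t == 0 then 0 else rnorm (f t) `^ (p - 1).
  have rc : rnorm ((f t)^*)%C = rnorm (f t) by rewrite !rnorm_complexE; case: (f t) => a b /=; rewrite sqrrN.
  rewrite /g rnormM rc rnorm_real ger0_norm ?powR_ge0//.
  case: ifPn => [/eqP ->|/rnorm_gt0 ft0]; first by rewrite rnorm0 mul0r.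
  rewrite -{1}[rnorm _]powRr1 ?rnorm_ge0// -powRD; last by apply/implyP => _; rewrite gt_eqF.
  by congr (_ `^ _); lra.
have mg : cmeasurable g.
  apply: cmeasurableM; first exact: cmeasurable_conj.
  apply: cmeasurable_real; apply: (measurableT_comp (measurable_powR _)).
  exact: cmeasurable_rnorm.
have gq : g \in cLfun mu q.
  apply: cLfun_powR => //.
  rewrite (_ : (\int[mu]_x _)%E = (\int[mu]_x (rnorm (f x) `^ p)%:E)%E).
    by rewrite -cnormX ?ltry// Lp_cLfun.
  apply: eq_integral => t _; congr EFin; rewrite rg.
  case: ifPn => [/eqP->|_]; last by rewrite -powRrM mulrC pqE.
  by rewrite rnorm0 !powR0// gt_eqF.
have : complex.Re (Lpair (Lp_class mu q1 g) f) = 0 by rewrite f0.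
rewrite Lpair_classl//= /Rintegral => E.
have E2 : (\int[mu]_x (complex.Re (g x * f x))%:E)%E = (\int[mu]_x (rnorm (f x) `^ p)%:E)%E.
  apply: eq_integral => t _; congr EFin; rewrite /g mulrAC.
  have -> : (f t)^*%C * f t = (rnorm (f t) ^+ 2)%:C.
    by rewrite mulrC -normCK -rnormE rmorphXn.
  rewrite -rmorphM/=; have [->|/rnorm_gt0 ft0] := eqVneq (f t) 0.
    by rewrite rnorm0 expr0n mul0r powR0// gt_eqF.
  rewrite -powR_mulrn ?rnorm_ge0// -powRD; last by apply/implyP => _; rewrite gt_eqF.
  by congr (_ `^ _); lra.
rewrite {}E2 -cnormX ?Lp_cLfun//= in E.
by apply: rnorm0_eq0; rewrite Lp_normE; have /eqP := E; rewrite powR_eq0 => /andP[/eqP].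
Qed.

End pairing.

(** * Change of variables for maps that scale the measure *)

Section substitution.
Context d (T : measurableType d) (R : realType) (mu : {measure set T -> \bar R}).
Variables (phi : T -> T) (c : R).
Hypotheses (mphi : measurable_fun setT phi) (c0 : 0 <= c)
  (muphi : forall A, measurable A -> mu (phi @^-1` A) = (c%:E * mu A)%E).

Lemma ge0_integral_subst (f : T -> \bar R) : measurable_fun setT f ->
  (forall x, (0 <= f x)%E) ->
  (\int[mu]_x f (phi x) = c%:E * \int[mu]_x f x)%E.
Proof.
move=> mf f0.
have := ge0_integral_pushforward mphi mu measurableT mf (fun x _ => f0 x).
rewrite preimage_setT /= => <-.
rewrite -[c]/((NngNum c0)%:num) -ge0_integral_mscale//.
by apply: eq_measure_integral => A mA _; exact: muphi.
Qed.

Lemma ae_subst (P : T -> Prop) : {ae mu, forall x, P x} -> {ae mu, forall x, P (phi x)}.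
Proof.
move=> [A [mA muA PA]]; exists (phi @^-1` A); split.
- by rewrite -[_ @^-1` _]setTI; exact: mphi.
- by rewrite muphi// muA mule0.
- by move=> x Px; exact: PA.
Qed.

Lemma Rintegral_subst (f : T -> R) : mu.-integrable setT (EFin \o f) ->
  Rintegral mu setT (f \o phi) = c * Rintegral mu setT f.
Proof.
move=> fi; have mf := measurable_int _ fi.
rewrite /Rintegral -[c in RHS]/(fine c%:E) -fineM//; last first.
  exact: integrable_fin_num.
congr fine; rewrite [LHS]integralE [in RHS]integralE.
have Ep : (\int[mu]_x ((EFin \o (f \o phi))^\+ x) =
    \int[mu]_x (((EFin \o f)^\+) (phi x)))%E by apply: eq_integral => x _; rewrite !funeposE.
have En : (\int[mu]_x ((EFin \o (f \o phi))^\- x) =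
    \int[mu]_x (((EFin \o f)^\-) (phi x)))%E by apply: eq_integral => x _; rewrite !funenegE.
rewrite [X in (X - _)%E]Ep [X in (_ - X)%E]En.
rewrite !ge0_integral_subst//; [|exact: measurable_funeneg|exact: measurable_funepos].
by rewrite [RHS]muleBr//; exact: (integrable_add_def measurableT fi).
Qed.

Lemma cmeasurable_subst (f : T -> R[i]) : cmeasurable f -> cmeasurable (f \o phi).
Proof. exact: cmeasurable_comp. Qed.

Lemma cnorm_subst p (p1 : 1 <= p) (f : T -> R[i]) : f \in cLfun mu p ->
  f \o phi \in cLfun mu p /\ cnorm mu p (f \o phi) = c `^ p^-1 * cnorm mu p f.
Proof.
have p0 : 0 < p by exact: lt_le_trans p1.
move=> fp; have mf := cLfun_meas fp.
have E : (\int[mu]_x (rnorm (f (phi x)) `^ p)%:E = (c * cnorm mu p f `^ p)%:E)%E.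
  rewrite EFinM cnormX// -ge0_integral_subst//.
  - exact: measurable_rnorm_powR.
  - by move=> x; rewrite lee_fin powR_ge0.
have fphip : f \o phi \in cLfun mu p.
  by apply: cLfun_powR; [exact: cmeasurable_subst|rewrite /= E ltry].
split=> //; apply: (powR_injective p0).
- by rewrite nnegrE cnorm_ge0.
- by rewrite nnegrE mulr_ge0 ?powR_ge0 ?cnorm_ge0.
apply: EFin_inj; rewrite cnormX//= E powRM ?powR_ge0 ?cnorm_ge0//.
by rewrite -powRrM mulVf ?gt_eqF// powRr1.
Qed.

Lemma cintegral_subst (f : T -> R[i]) : f \in cLfun mu 1 ->
  cintegral mu (f \o phi) = c%:C * cintegral mu f.
Proof.
move=> f1; have [r i] := (integrable_cRe f1, integrable_cIm f1).
have := (Rintegral_subst r, Rintegral_subst i).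
rewrite /cintegral /=; set a := Rintegral _ _ _; set b := Rintegral _ _ _.
move=> [/= -> ->]; apply/eqP; rewrite eq_complex /=.
by rewrite !mul0r subr0 addr0 !eqxx.
Qed.

End substitution.

(** * Locally compact groups and Haar measure *)

Section group_topology.
Context (G : lcGroupType).
Implicit Types (x y s t : G) (A B K U : set G).

Lemma mulgl_continuous s : continuous (fun t : G => (s * t)%g).
Proof.
move=> t; apply: (@continuous_comp _ _ _ (fun u => (s, u)) (fun z => (z.1 * z.2)%g)).
  by apply: cvg_pair; [exact: cvg_cst|exact: cvg_id].
exact: lcg_mul_continuous.
Qed.

Lemma mulgr_continuous s : continuous (fun t : G => (t * s)%g).
Proof.
move=> t; apply: (@continuous_comp _ _ _ (fun u => (u, s)) (fun z => (z.1 * z.2)%g)).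
  by apply: cvg_pair; [exact: cvg_id|exact: cvg_cst].
exact: lcg_mul_continuous.
Qed.

Lemma cvg_mulg (I : Type) (F : set_system I) (FF : Filter F) (f g : I -> G) x y :
  f @ F --> x -> g @ F --> y -> (f i * g i)%g @[i --> F] --> (x * y)%g.
Proof.
move=> fx gy; apply: (@cvg_comp _ _ _ (fun i => (f i, g i))
  (fun z => (z.1 * z.2)%g) _ (nbhs (x, y))); first exact: cvg_pair.
exact: (@lcg_mul_continuous G (x, y)).
Qed.

Lemma cvg_invg (I : Type) (F : set_system I) (FF : Filter F) (f : I -> G) x :
  f @ F --> x -> (f i)^-1%g @[i --> F] --> (x^-1)%g.
Proof. by move=> fx; apply: cvg_comp fx _; exact: lcg_inv_continuous. Qed.

Lemma lc_nbhs x : exists2 K, nbhs x K & compact K.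
Proof.
have := @lcg_locally_compact G x I; rewrite withinET => -[K xK [cK _]].
by exists K.
Qed.

Lemma lc_compact_closed K : compact K -> closed K.
Proof. exact: compact_closed (@lcg_hausdorff G). Qed.

Lemma compact_mulg A B : compact A -> compact B ->
  compact [set (a.1 * a.2)%g | a in A `*` B].
Proof.
move=> cA cB; apply: continuous_compact; last exact: compact_setX.
by apply: continuous_subspaceT; exact: lcg_mul_continuous.
Qed.

Lemma compact_invg A : compact A -> compact [set (a^-1)%g | a in A].
Proof.
move=> cA; apply: continuous_compact => //.
by apply: continuous_subspaceT; exact: lcg_inv_continuous.
Qed.

Lemma open_mulgl s U : open U -> open [set t | U (s * t)%g].
Proof. by move=> oU; apply: open_comp oU => ? _; exact: mulgl_continuous. Qed.

End group_topology.

Section borel.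
Context (R : realType) (G : lcGroupType).

Lemma open_borel (U : set G) : open U -> measurable (U : set (borel G)).
Proof. by move=> oU; exact: sub_sigma_algebra. Qed.

Lemma closed_borel (U : set G) : closed U -> measurable (U : set (borel G)).
Proof.
by move=> cU; rewrite -[U]setCK; apply: measurableC; apply: open_borel; exact: closed_openC.
Qed.

Lemma compact_borel (K : set G) : compact K -> measurable (K : set (borel G)).
Proof. by move=> cK; apply: closed_borel; exact: lc_compact_closed. Qed.

Lemma continuous_borel (f : G -> R) : continuous f ->
  measurable_fun setT (f : borel G -> R).
Proof.
move=> cf; apply: (measurability _ (RGenOInfty.measurableE R)).
move=> _ [_ [x ->] <-]; rewrite setTI; apply: open_borel.
by apply: open_comp => // t _; exact: cf.
Qed.

Lemma continuous_borel_map (h : G -> G) : continuous h ->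
  measurable_fun setT (h : borel G -> borel G).
Proof.
move=> ch; apply: (@measurability _ _ (borel G) (borel G) _ _ (@open G : set (set (borel G)))) => //.
move=> _ [U oU <-]; rewrite setTI; apply: open_borel.
by apply: open_comp => // t _; exact: ch.
Qed.

Lemma continuous_cRe : continuous (@complex.Re R : R[i] -> R).
Proof.
move=> z; apply/(@cvgrPdist_lt _ _ _ _ (nbhs_filter z)) => e e0.
have e0' : 0 < e%:C :> R[i] by rewrite ltcE/= eqxx.
have := nbhsx_ballx z e%:C e0'.
apply: filterS => w zw; rewrite -raddfB (le_lt_trans (ler_Re_rnorm _))//.
by rewrite -ltcR rnormE.
Qed.

Lemma continuous_cIm : continuous (@complex.Im R : R[i] -> R).
Proof.
move=> z; apply/(@cvgrPdist_lt _ _ _ _ (nbhs_filter z)) => e e0.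
have e0' : 0 < e%:C :> R[i] by rewrite ltcE/= eqxx.
have := nbhsx_ballx z e%:C e0'.
apply: filterS => w zw; rewrite -raddfB (le_lt_trans (ler_Im_rnorm _))//.
by rewrite -ltcR rnormE.
Qed.

Lemma continuous_cmeasurable (f : G -> R[i]) : continuous f ->
  cmeasurable (f : borel G -> R[i]).
Proof.
move=> cf; split; apply: continuous_borel => x.
- by apply: continuous_comp; [exact: cf|exact: continuous_cRe].
- by apply: continuous_comp; [exact: cf|exact: continuous_cIm].
Qed.

End borel.

Section rnorm_topology.
Context (R : realType) (V : normedModType R[i]).

Lemma nbhs_rnormP (x : V) (A : set V) :
  nbhs x A <-> exists2 e : R, 0 < e & forall y, rnorm (x - y) < e -> A y.
Proof.
split.
  move=> /nbhs_ballP[e /= e0 eA].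
  have eE : (complex.Re e)%:C = e by rewrite RRe_real// gtr0_real.
  exists (complex.Re e) => [|y xy]; first by move: e0; rewrite -eE ltcE/= eqxx.
  by apply: eA; rewrite -ball_normE/= -eE -rnormE ltcR.
move=> [e e0 eA]; apply/nbhs_ballP; exists e%:C => /=.
  by rewrite ltcE/= eqxx.
by move=> y; rewrite -ball_normE/= -rnormE ltcR => /eA.
Qed.

Lemma cvg_rnormP (I : Type) (F : set_system I) (FF : Filter F) (f : I -> V) (l : V) :
  f @ F --> l <-> forall e : R, 0 < e -> \forall i \near F, rnorm (l - f i) < e.
Proof.
split=> [fl e e0|h A /nbhs_rnormP[e e0 eA]].
  have /fl : nbhs l [set y | rnorm (l - y) < e] by apply/nbhs_rnormP; exists e.
  by [].
by apply: filterS (h e e0) => i /eA.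
Qed.

End rnorm_topology.

Section haar.
Context (R : realType) (G : lcGroupType) (mu : {measure set (borel G) -> \bar R}).
Hypothesis mu_haar : left_haar mu.
Implicit Types (s t x y : G) (A : set (borel G)) (K : set G).

Lemma haar_compact K : compact K -> (mu K < +oo)%E.
Proof. by case: mu_haar => _ + _ _ _; apply. Qed.

Lemma haar_mull s A : measurable A ->
  mu (((fun t => s * t)%g : borel G -> borel G) @^-1` A) = (1%:E * mu A)%E.
Proof.
move=> mA; rewrite mul1e; case: mu_haar => _ _ h _ _; rewrite -[in RHS](h (s^-1)%g)//.
congr (mu _); apply/seteqP; split=> t /=.
  by move=> At; exists (s * t)%g => //; rewrite mulgA mulVg mul1g.
by move=> [u Au <-]; rewrite mulgA mulgV mul1g.
Qed.

Lemma measurable_mull s : measurable_fun setT ((fun t => s * t)%g : borel G -> borel G).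
Proof. by apply: continuous_borel_map; exact: mulgl_continuous. Qed.

Lemma measurable_mulr s : measurable_fun setT ((fun t => t * s)%g : borel G -> borel G).
Proof. by apply: continuous_borel_map; exact: mulgr_continuous. Qed.

Lemma haar_compact_pos : exists2 K, compact K & (0 < mu K)%E.
Proof.
case: mu_haar => mu0 _ _ _ /(_ setT openT) E; move: mu0; rewrite E.
move=> /ereal_sup_gt[_ [K [cK _] <-]] K0.
by exists K.
Qed.

(** Some compact set has positive measure, and finitely many left translates of U cover it; if U
    were null, so would be that compact set. *)
Lemma haar_open_pos (U : set G) : open U -> U !=set0 -> (0 < mu U)%E.
Proof.
move=> oU [u Uu]; have [K cK K0] := haar_compact_pos.
rewrite lt0e measure_ge0 andbT; apply/negP => /eqP U0.
have tr s : mu [set (s * t)%g | t in U] = 0%E.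
  by case: mu_haar => _ _ h _ _; rewrite h//; exact: open_borel.
have := cK; rewrite compact_cover => /(_ G setT (fun s => [set (s * t)%g | t in U])).
have op s : open [set (s * t)%g | t in U].
  rewrite (_ : [set _ | _ in U] = [set t | U (s^-1 * t)%g]); first exact: open_mulgl.
  apply/seteqP; split=> t /=; first by move=> [v Uv <-]; rewrite mulgA mulVg mul1g.
  by move=> Ut; exists (s^-1 * t)%g => //; rewrite mulgA mulgV mul1g.
case.
- by move=> s _; exact: op.
- move=> k Kk; exists (k * u^-1)%g => //=; exists u => //.
  by rewrite -mulgA mulVg mulg1.
- move=> D _ KD; move: K0; rewrite (measure_negligible (compact_borel cK)) ?ltxx//.
  apply: (@negligibleS _ _ _ mu _ (K : set (borel G)) KD).
  rewrite /cover bigcup_fset.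
  elim/big_ind: _ => [|A B|s _]; [exact: negligible_set0|exact: negligibleU|].
  by apply/negligibleP; [apply: open_borel; exact: op|exact: tr].
Qed.

(** The preimage under right multiplication by s is the translate by s^-1, hence the inverse in the
    argument of [Delta]. *)
Lemma modular_mulr Delta : modular_function mu Delta -> forall s A, measurable A ->
  mu (((fun t => t * s)%g : borel G -> borel G) @^-1` A) = ((Delta (s^-1)%g)%:E * mu A)%E.
Proof.
move=> [_ h] s A mA; rewrite -h//; congr (mu _); apply/seteqP; split=> t /=.
  by move=> At; exists (t * s)%g => //; rewrite -mulgA mulgV mulg1.
by move=> [u Au <-]; rewrite -mulgA mulVg mulg1.
Qed.

(** Both sides are scaling factors of one compact set whose measure is finite and positive, so that
    this measure can be cancelled. *)
Lemma modularM Delta : modular_function mu Delta -> {morph Delta : x y / (x * y)%g >-> x * y}.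
Proof.
move=> [D0 h] x y; have [K cK K0] := haar_compact_pos.
have mK := compact_borel cK.
have Kfin : mu K \is a fin_num by rewrite ge0_fin_numE// haar_compact.
have mKx : measurable ([set (t * x)%g | t in K] : set (borel G)).
  apply: compact_borel; apply: continuous_compact => //.
  by apply: continuous_subspaceT; exact: mulgr_continuous.
have E : mu [set (t * (x * y))%g | t in K] = mu [set (t * y)%g | t in [set (t * x)%g | t in K]].
  congr (mu _); apply/seteqP; split=> t /=.
    by move=> [u Ku <-]; exists (u * x)%g; [exists u|rewrite mulgA].
  by move=> [_ [u Ku <-] <-]; exists u => //; rewrite mulgA.
move: E; rewrite !h// -(fineK Kfin) -!EFinM => -[].
rewrite mulrA => /(mulIf _) ->; first by rewrite mulrC.
by rewrite gt_eqF// fine_gt0// K0 -ge0_fin_numE.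
Qed.

Lemma modular1 Delta : modular_function mu Delta -> Delta 1%g = 1.
Proof.
move=> hD; have := modularM hD 1%g 1%g; rewrite mulg1 => /eqP.
rewrite -{1}[Delta 1%g]mulr1 => /eqP/mulfI <-//.
by rewrite gt_eqF//; case: hD.
Qed.

Lemma modularV Delta : modular_function mu Delta -> forall x, Delta (x^-1)%g = (Delta x)^-1.
Proof.
move=> hD x; have D0 : Delta x != 0 by rewrite gt_eqF//; case: hD.
by apply: (mulIf D0); rewrite -modularM// mulVg modular1// mulVf.
Qed.

End haar.

(** * Continuous functions with compact support *)

Section compact_support.
Context (R : realType) (G : lcGroupType).
Implicit Types (f g : G -> R[i]) (K : set G).

Definition Cc f := continuous f /\ exists2 K, compact K & forall x, ~ K x -> f x = 0.

Lemma Cc_bounded f : Cc f -> exists2 M : R, 0 <= M & forall x, rnorm (f x) <= M.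
Proof.
move=> [cf [K cK fK]].
have /compact_near_coveringP /(_ nat \oo (fun n x => rnorm (f x) <= n%:R) _) := cK.
case=> [x Kx|N _ hN].
  have : \forall x' \near x, rnorm (f x - f x') < 1.
    by have /cvg_rnormP := cf x; apply.
  move=> h; near=> x' n => /=.
  apply: (@le_trans _ _ (rnorm (f x) + 1)); last by near: n; exact: nbhs_infty_ger.
  rewrite -[f x'](subKr (f x)) (le_trans (ler_rnormB _ _))// lerD2l ltW//.
  by near: x'.
exists N%:R => // x; have [Kx|/fK ->] := pselect (K x); last by rewrite rnorm0.
by apply: (hN N) => //=.
Unshelve. all: by end_near. Qed.

Lemma continuous_pair_rnorm (F : G -> G -> R[i]) y0 t0 :
  {for (y0, t0), continuous (fun z => F z.1 z.2)} -> forall e : R, 0 < e ->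
  \forall t \near t0 & y \near y0, rnorm (F y0 t0 - F y t) < e.
Proof.
move=> cF e e0.
have : \forall z \near (y0, t0), rnorm (F y0 t0 - F z.1 z.2) < e.
  by have /cvg_rnormP := cF; apply.
move=> [[A B] [/= Ay Bt] AB]; exists (B, A) => //= -[t y] [/= Bt' Ay'].
by apply: (AB (y, t)).
Qed.

(** The tube lemma: compactness of K turns continuity at the points (y0, t) into an estimate uniform
    in t. The uniform continuity of left and right translations and the control of the weights in
    [smooth_form_discretize] are instances of it. *)
Lemma kernel_unif (F : G -> G -> R[i]) (y0 : G) K : compact K ->
  (\forall y \near y0, forall t, ~ K t -> F y t = 0) ->
  (forall t, {for (y0, t), continuous (fun z => F z.1 z.2)}) ->
  forall e : R, 0 < e -> \forall y \near y0, forall t, rnorm (F y t - F y0 t) < e.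
Proof.
move=> cK F0 cF e e0; have e20 : 0 < e / 2 by rewrite divr_gt0.
have /compact_near_coveringP /(_ G (nbhs y0) (fun y t => rnorm (F y t - F y0 t) < e) _) := cK.
move=> h; have {h} : \forall y \near y0, K `<=` (fun t => rnorm (F y t - F y0 t) < e).
  apply: h => t Kt; have := continuous_pair_rnorm (cF t) e20.
  move=> [[B A] [/= Bt Ay] BA]; exists (B, A) => //= -[t' y] [/= Bt' Ay'].
  have h1 := BA (t', y) (conj Bt' Ay'); have h2 := BA (t', y0) (conj Bt' (nbhs_singleton Ay)).
  rewrite /= in h1 h2 *.
  rewrite -(subrKA (F y0 t)) (le_lt_trans (ler_rnormD _ _))//.
  by rewrite rnormBC [ltRHS]splitr ltrD.
have F00 := nbhs_singleton F0.
move=> h; apply: filterS2 h F0 => y hy Fy t.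
have [Kt|Kt] := pselect (K t); first exact: hy.
by rewrite Fy// F00// subrr rnorm0.
Qed.

Lemma Cc0 : Cc 0.
Proof. by split; [exact: cst_continuous|exists set0; [exact: compact0|]]. Qed.

Lemma Cc_linear a f g : Cc f -> Cc g -> Cc (a *: f + g).
Proof.
move=> [cf [K cK fK]] [cg [L cL gL]]; split.
  move=> x; apply: continuousD; last exact: cg.
  by apply: continuousZr; exact: cf.
exists (K `|` L); first exact: compactU.
move=> x /not_orP[/fK fx /gL gx]; rewrite -[LHS]/(a * f x + g x).
by rewrite fx gx mulr0 addr0.
Qed.

Lemma CcZ a f : Cc f -> Cc (a *: f).
Proof. by move=> fc; rewrite -[_ *: _]addr0; apply: Cc_linear => //; exact: Cc0. Qed.

Lemma CcMl f (k : G -> R[i]) : Cc f -> continuous k -> Cc (fun x => k x * f x).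
Proof.
move=> [cf [K cK fK]] ck; split; last by exists K => // x /fK ->; rewrite mulr0.
by move=> x; apply: continuousM; [exact: ck|exact: cf].
Qed.

Lemma Cc_mulr f (y : G) : Cc f -> Cc (fun t => f (t * y)%g).
Proof.
move=> [cf [K cK fK]]; split.
  by move=> t; apply: continuous_comp; [exact: mulgr_continuous|exact: cf].
exists [set (t * y^-1)%g | t in K].
  apply: continuous_compact => //.
  by apply: continuous_subspaceT; exact: mulgr_continuous.
move=> t nKt; apply: fK => Kt; apply: nKt; exists (t * y)%g => //.
by rewrite -mulgA mulgV mulg1.
Qed.

End compact_support.

Section urysohn.
Context (R : realType) (G : lcGroupType).

(** Normality is taken from the one-point compactification, which is compact and Hausdorff.
    Separating K there from the complement of a relatively compact open set yields the compact
    support. *)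
Lemma lc_urysohn (K U : set G) : compact K -> open U -> K `<=` U ->
  exists chi : G -> R, [/\ continuous chi, forall x, 0 <= chi x <= 1,
    forall x, K x -> chi x = 1, forall x, ~ U x -> chi x = 0 &
    exists2 L, compact L & forall x, ~ L x -> chi x = 0].
Proof.
move=> cK oU KU; have [W W1 cW] := @lc_nbhs G 1%g.
pose L := [set (a.1 * a.2)%g | a in K `*` W].
(* An open neighbourhood of K inside the compact set K W; the function will vanish off U and off
   O. *)
pose O := \bigcup_(k in K) [set t | W° (k^-1 * t)%g].
have oO : open O.
  by apply: bigcup_open => k _; apply: open_mulgl; exact: open_interior.
have KO : K `<=` O by move=> k Kk; exists k => //=; rewrite mulVg.
have OL : O `<=` L.
  move=> t [k Kk /= /interior_subset Wt]; exists (k, (k^-1 * t)%g) => //=.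
  by rewrite mulgA mulgV mul1g.
pose X := one_point_compactification G.
have hX : hausdorff_space X.
  by apply: one_point_compactification_hausdorff;
    [exact: lcg_locally_compact|exact: lcg_hausdorff].
have cS : continuous (Some : G -> X) := @one_point_compactification_some_continuous G.
have nX : normal_space X.
  by apply: compact_normal => //; exact: one_point_compactification_compact.
pose A : set X := Some @` K; pose B : set X := ~` (Some @` (U `&` O)).
have clA : closed A.
  apply: compact_closed => //; apply: continuous_compact => //.
  exact: continuous_subspaceT.
have clB : closed B.
  by apply: open_closedC; apply: one_point_compactification_open_some; exact: openI.
have AB : A `&` B = set0.
  apply/seteqP; split=> // x [[k Kk <-]]; apply.
  by exists k => //; split; [exact: KU|exact: KO].
have sep := (@normal_separatorP R X).1 nX A B clA clB AB.
pose f : G -> R := Urysohn A B \o Some.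
have cf : continuous f.
  by move=> x; apply: continuous_comp; [exact: cS|exact: Urysohn_continuous].
have f1 x : ~ (U `&` O) x -> f x = 1.
  move=> UO; have : [set Urysohn A B z | z in B] (f x).
    by exists (Some x) => // -[y UOy [yx]]; apply: UO; rewrite -yx.
  by move/(Urysohn_sub1 sep).
(* [Urysohn A B] is 0 on A and 1 on B, hence the reversal. *)
exists (fun x => 1 - f x); split.
- by move=> x; apply: continuousB; [exact: cst_continuous|exact: cf].
- move=> x; have : [set` `[0%R, 1%R]] (f x).
    by apply: (@Urysohn_range _ R A B); exists (Some x).
  by rewrite /= in_itv/= => /andP[f0 f1']; rewrite subr_ge0 f1' gerBl f0.
- move=> x Kx; have : [set Urysohn A B z | z in A] (f x).
    by exists (Some x) => //; exists x.
  by move/(Urysohn_sub0 sep) => ->; rewrite subr0.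
- by move=> x Ux; rewrite f1 ?subrr// => -[].
- exists L; first exact: compact_mulg.
  by move=> x Lx; rewrite f1 ?subrr// => -[_ /OL].
Qed.

End urysohn.

(** * Regularity and density of C_c(G) in L_p *)

Section regularity.
Context (R : realType) (G : lcGroupType) (mu : {measure set (borel G) -> \bar R}).
Hypothesis mu_haar : left_haar mu.

(** Inner regularity is given for open sets only. For A of finite measure take an open U around A,
    an open V of small measure around U minus A, and a large compact K in U: then K minus V is
    compact and contained in A. *)
Lemma haar_regular (A : set (borel G)) (e : R) : measurable A -> (mu A < +oo)%E ->
  0 < e -> exists K U : set G, [/\ compact K, open U, K `<=` A, A `<=` U &
    (mu ((U : set (borel G)) `\` K) < e%:E)%E].
Proof.
move=> mA Afin e0; have [_ _ _ outer inner] := mu_haar.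
pose d := e / 4; have d0 : 0 < d by rewrite divr_gt0.
have outer_ex (B : set (borel G)) (r : R) : measurable B -> (mu B < r%:E)%E ->
    exists U : set G, [/\ open U, B `<=` U & (mu U < r%:E)%E].
  move=> mB; rewrite outer// => /ereal_inf_lt[_ [U [oU BU] <-] Ur].
  by exists U.
have finA : mu A \is a fin_num by rewrite ge0_fin_numE.
have [U [oU AU Ult]] : exists U : set G, [/\ open U, A `<=` U & (mu U < (fine (mu A) + d)%:E)%E].
  by apply: outer_ex => //; rewrite EFinD fineK// lteDl// lte_fin.
have mU := open_borel oU.
have finU : mu U \is a fin_num by rewrite ge0_fin_numE// (lt_trans Ult)// ltry.
have UA : (mu ((U : set (borel G)) `\` A) < d%:E)%E.
  rewrite measureD//; last by rewrite -ge0_fin_numE.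
  rewrite (_ : _ `&` A = A); last exact/setIidr.
  by rewrite lteBlDl//; move: Ult; rewrite EFinD fineK.
have [V [oV UAV Vlt]] := outer_ex _ _ (measurableD mU mA) UA.
have mV := open_borel oV.
have [K [cK KU Klt]] : exists K : set G, [/\ compact K, K `<=` U & (mu U - d%:E < mu K)%E].
  have : (mu U - d%:E < mu U)%E by rewrite lteBlDr// lteDl// lte_fin.
  by rewrite [X in (_ < X)%E -> _]inner// => /ereal_sup_gt[_ [K [cK KU] <-] h]; exists K.
have mK := compact_borel cK.
have finK : mu K \is a fin_num by rewrite ge0_fin_numE// haar_compact.
exists (K `\` V), U; split => //.
- apply: (subclosed_compact _ cK); last by move=> x [].
  by apply: (@closedI G K (~` V)); [exact: lc_compact_closed cK|exact: open_closedC].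
- by move=> x [Kx Vx]; apply: contrapT => Ax; apply: Vx; apply: UAV; split => //; exact: KU.
- apply: (@le_lt_trans _ _ (mu ((U : set (borel G)) `\` K) + mu V)%E).
    apply: le_trans (measureU2 _ _ _) => //; last exact: measurableD.
    apply: le_measure; rewrite ?inE.
    + by apply: measurableD => //; exact: measurableD.
    + by apply: measurableU => //; exact: measurableD.
    + move=> x [Ux nKV]; have [Vx|nV] := pselect (V x); first by right.
      by left; split => // Kx; apply: nKV.
  apply: (@lt_trans _ _ (d%:E + d%:E)%E); last by rewrite -EFinD lte_fin /d; lra.
  apply: lteD => //.
  rewrite measureD//; last by rewrite -ge0_fin_numE.
  rewrite (_ : _ `&` K = (K : set (borel G))); last exact/setIidr.
  by rewrite lteBlDl//; move: Klt; rewrite lteBlDr.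
Qed.

End regularity.

Section Cc_Lp.
Context (R : realType) (G : lcGroupType) (mu : {measure set (borel G) -> \bar R}).
Hypothesis mu_haar : left_haar mu.
Variables (p : R) (p1 : 1 <= p).
Local Notation cLf := (cLfun mu p).

Let p0 : 0 < p. Proof. exact: lt_le_trans p1. Qed.

Lemma cindicE (A : set (borel G)) x : cindic R A x = if `[<A x>] then 1 else 0.
Proof.
rewrite /cindic indicE; case: asboolP => [Ax|Ax].
  by rewrite mem_set.
by rewrite memNset.
Qed.

Lemma cnorm_cindic (A : set (borel G)) : measurable A -> (mu A < +oo)%E ->
  cindic R A \in cLf /\ cnorm mu p (cindic R A) = fine (mu A) `^ p^-1.
Proof.
move=> mA Afin; have finA : mu A \is a fin_num by rewrite ge0_fin_numE.
have E : (\int[mu]_x (rnorm (cindic R A x) `^ p)%:E = mu A)%E.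
  transitivity (\int[mu]_x (\1_A x)%:E)%E; last by rewrite integral_indic// setIT.
  apply: eq_integral => x _; congr EFin.
  rewrite /cindic rnorm_real ger0_norm// indicE; case: (_ \in _).
    by rewrite powR1.
  by rewrite powR0 ?gt_eqF.
have Ap : cindic R A \in cLf.
  by apply: cLfun_powR => //; [exact: cmeasurable_cindic|rewrite E].
split => //; have := cnormX p1 Ap; rewrite E -(fineK finA) => -[/= <-].
by rewrite -powRrM mulfV ?gt_eqF// powRr1// cnorm_ge0.
Qed.

Lemma cnorm_sup (A : set (borel G)) f (e : R) : measurable A -> (mu A < +oo)%E ->
  cmeasurable f -> 0 <= e -> (forall x, A x -> rnorm (f x) <= e) ->
  (forall x, ~ A x -> f x = 0) ->
  f \in cLf /\ cnorm mu p f <= e * fine (mu A) `^ p^-1.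
Proof.
move=> mA Afin mf e0 fe f0; have [Ap <-] := cnorm_cindic mA Afin.
apply: (cnorm_dom p1) => // x; rewrite cindicE; case: asboolP => Ax.
  by rewrite rnorm1 mulr1 fe.
by rewrite f0// rnorm0 mulr0.
Qed.

Lemma Cc_cLfun (f : G -> R[i]) : Cc f -> f \in cLf.
Proof.
move=> fc; have [M M0 fM] := Cc_bounded fc; case: fc => cf [K cK fK].
have [] // := cnorm_sup (compact_borel cK) (haar_compact mu_haar cK)
  (continuous_cmeasurable cf) M0 (fun x _ => fM x) fK.
Qed.

Lemma cindic_Cc_approx (A : set (borel G)) (e : R) : measurable A -> (mu A < +oo)%E ->
  0 < e -> exists2 f, Cc f & cnorm mu p (cindic R A - f) < e.
Proof.
(* The error function is bounded by 1 and lives on U minus K, so its norm is at most e' ^ (1 / p) =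
   e / 2. *)
move=> mA Afin e0; pose e' := (e / 2) `^ p.
have e'0 : 0 < e' by rewrite powR_gt0// divr_gt0.
have [K [U [cK oU KA AU UK]]] := haar_regular mu_haar mA Afin e'0.
have [chi [cchi chi01 chi1 chi0 [L cL chiL]]] := @lc_urysohn R G K U cK oU (subset_trans KA AU).
have cC : Cc (fun x => (chi x)%:C : R[i]).
  split; last by exists L => // x /chiL ->.
  move=> x; apply/cvg_rnormP => d d0.
  have : \forall t \near x, `|chi x - chi t| < d.
    by have /cvgrPdist_lt := cchi x; apply.
  by apply: filterS => t; rewrite -rmorphB/= rnorm_real.
exists (fun x => (chi x)%:C) => //.
have mUK : measurable ((U : set (borel G)) `\` K).
  by apply: measurableD; [exact: open_borel|exact: compact_borel].
have UKfin : (mu ((U : set (borel G)) `\` K) < +oo)%E by rewrite (lt_trans UK)// ltry.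
have [] := @cnorm_sup (U `\` K) (cindic R A - (fun x => (chi x)%:C)) 1 mUK UKfin _ ler01.
- apply: cmeasurableB; first exact: cmeasurable_cindic.
  by apply: continuous_cmeasurable; case: cC.
- move=> x _; rewrite -[X in rnorm X]/((\1_A x)%:C - (chi x)%:C) -rmorphB/= rnorm_real.
  have /andP[c0 c1] := chi01 x; rewrite indicE ler_norml.
  by case: (_ \in _) => /=; lra.
- move=> x /not_andP[Ux|/contrapT Kx]; rewrite -[LHS]/((\1_A x)%:C - (chi x)%:C) indicE.
    by rewrite chi0// memNset ?subrr// => /AU.
  by rewrite chi1// mem_set ?subrr//; exact: KA.
move=> _; rewrite mul1r => /le_lt_trans; apply.
apply: (@le_lt_trans _ _ (e' `^ p^-1)).
  rewrite ge0_ler_powR ?invr_ge0 ?nnegrE ?(ltW p0) ?fine_ge0 ?(ltW e'0)//.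
  by rewrite -lee_fin fineK ?ge0_fin_numE// ltW.
rewrite -powRrM mulfV ?gt_eqF// powRr1 ?divr_ge0 ?(ltW e0)//.
by rewrite ltr_pdivrMr// ltr_pMr// ltr1n.
Qed.

End Cc_Lp.

Import HBNNSimple.

Section Cc_dense.
Context (R : realType) (G : lcGroupType) (mu : {measure set (borel G) -> \bar R}).
Hypothesis mu_haar : left_haar mu.
Variables (p : R) (p1 : 1 <= p).
Local Notation cLf := (cLfun mu p).

Let p0 : 0 < p. Proof. exact: lt_le_trans p1. Qed.

Let approx (f : borel G -> R[i]) := f \in cLf /\
  forall e : R, 0 < e -> exists2 g, Cc g & cnorm mu p (f - (g : borel G -> R[i])) < e.

Let approx_linear a f g : approx f -> approx g -> approx (a *: f + g).
Proof.
move=> [fp fD] [gp gD]; have fgp : a *: f + g \in cLf by exact: cLfunD (cLfunZ _ _ _) _.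
split=> // e e0; have d0 : 0 < e / 2 / (rnorm a + 1).
  by rewrite !divr_gt0// ltr_wpDl ?rnorm_ge0.
have [f' f'c ff'] := fD _ d0; have [g' g'c gg'] := gD (e / 2) ltac:(by rewrite divr_gt0).
exists (a *: f' + g'); first exact: Cc_linear.
have f'p := Cc_cLfun mu_haar p1 f'c; have g'p := Cc_cLfun mu_haar p1 g'c.
have -> : a *: f + g - (a *: f' + g') = a *: (f - f') + (g - g').
  by rewrite scalerBr opprD addrACA.
have h1 := cLfun_sub p1 fp f'p; have h2 := cLfun_sub p1 gp g'p.
rewrite (le_lt_trans (cnormD p1 (cLfunZ p1 a h1) h2))//.
rewrite cnormZ// [ltRHS]splitr ler_ltD//.
rewrite (le_trans (ler_wpM2l (rnorm_ge0 a) (ltW ff')))//.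
rewrite mulrCA ler_piMr ?divr_ge0 ?(ltW e0)//.
by rewrite ler_pdivrMr ?mul1r ?lerDl// ltr_wpDl ?rnorm_ge0.
Qed.

Let approx0 : approx 0.
Proof.
split; first exact: cLfun0.
move=> e e0; exists 0; first exact: Cc0.
by rewrite subr0 -(scale0r 0) cnormZ ?cLfun0// rnorm0 mul0r.
Qed.

Let approx_sum I (s : seq I) F : (forall i, approx (F i)) -> approx (\sum_(i <- s) F i).
Proof.
move=> h; elim/big_ind: _ => [|f g fD gD|//]; first exact: approx0.
by rewrite -[f]scale1r; exact: approx_linear.
Qed.

Let approx_lim f : f \in cLf ->
  (forall e : R, 0 < e -> exists2 g, approx g & cnorm mu p (f - g) < e) -> approx f.
Proof.
move=> fp fD; split=> // e e0; have e20 : 0 < e / 2 by rewrite divr_gt0.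
have [g [gp gD] fg] := fD _ e20; have [h hc gh] := gD _ e20; exists h => //.
have hp := Cc_cLfun mu_haar p1 hc.
rewrite -(subrKA g) (le_lt_trans (cnormD p1 _ _)) ?cLfun_sub//.
by rewrite [ltRHS]splitr ltrD.
Qed.

Let approx_indic A : measurable A -> (mu A < +oo)%E -> approx (cindic R A).
Proof.
move=> mA Afin; split; first by have [] := cnorm_cindic p1 mA Afin.
by move=> e e0; exact: (cindic_Cc_approx mu_haar p1).
Qed.

(** Simple functions increase to h, and dominated convergence with bound h ^ p makes the convergence
    hold in L_p. Each simple function is approximable because its level sets at positive values have
    finite measure. *)
Let approx_ge0 (h : borel G -> R) : measurable_fun setT h -> (forall x, 0 <= h x) ->
  (fun x => (h x)%:C) \in cLf -> approx (fun x => (h x)%:C).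
Proof.
move=> mh h0 hp; apply: approx_lim => // e e0.
have mh' : measurable_fun setT (EFin \o h) by exact/measurable_EFinP.
have h0' x : setT x -> (0 <= (EFin \o h) x)%E by rewrite lee_fin.
pose s n : borel G -> R := nnsfun_approx measurableT mh' n.
have ms n : measurable_fun setT (s n) by exact: measurable_funPT.
have s0 n x : 0 <= s n x by exact: fun_ge0.
have sh n x : s n x <= h x.
  by rewrite -lee_fin /s nnsfun_approxE; exact: (le_approx n h0').
have scvg x : s n x @[n --> \oo] --> h x.
  by have /fine_cvgP[_] := @cvg_nnsfun_approx _ _ _ _ measurableT _ mh' h0' x I.
have hpi : (\int[mu]_x (h x `^ p)%:E < +oo)%E.
  rewrite (_ : (\int[mu]_x _)%E = (cnorm mu p (fun x => (h x)%:C) `^ p)%:E) ?ltry//.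
  rewrite (cnormX p1 hp); apply: eq_integral => x _.
  by rewrite rnorm_real ger0_norm.
have mhp : measurable_fun setT (fun x => (h x `^ p)%:E).
  by apply/measurable_EFinP; apply: (measurableT_comp (measurable_powR p)).
have sp n : approx (fun x => (s n x)%:C).
  have [N [r snE]] : exists N (r : 'I_N -> R),
      forall x, s n x = \sum_i r i * \1_(s n @^-1` [set r i]) x.
    by eexists; eexists => x; exact: (fimfunEord (nnsfun_approx measurableT mh' n) x).
  rewrite (_ : (fun x => (s n x)%:C) =
      \sum_i (r i)%:C *: cindic R (s n @^-1` [set r i])); last first.
    apply/funext => x; rewrite fct_sumE snE rmorph_sum.
    by apply: eq_bigr => i _; rewrite rmorphM.
  (* The simple functions are nonnegative, so for a value [ri] at most 0 either [ri] = 0 or the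
     level set is empty; the term vanishes even if the level set has infinite measure. *)
  apply: approx_sum => i; set ri := r i; have [r0|r0] := leP ri 0.
    rewrite (_ : _ *: _ = 0) //; apply/funext => x.
    rewrite -[LHS]/(ri%:C * _) /cindic indicE; case: (boolP (_ \in _)); last by rewrite mulr0.
    rewrite inE/= => sr; have := s0 n x; rewrite sr => r0'.
    by rewrite (_ : ri = 0) ?mul0r//; apply/eqP; rewrite eq_le r0.
  rewrite -[_ *: _]addr0; apply: approx_linear => //; apply: approx_indic.
    by rewrite -[_ @^-1` _]setTI; apply: ms.
  have mA : measurable (s n @^-1` [set ri]) by rewrite -[_ @^-1` _]setTI; apply: ms.
  have rp : 0 < ri `^ p by rewrite powR_gt0.
  (* Chebyshev's inequality: h is at least [ri] on this level set. *)
  have : ((ri `^ p)%:E * mu (s n @^-1` [set ri]) <= \int[mu]_x (h x `^ p)%:E)%E.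
    rewrite -[X in mu X]setIT -integral_indic//.
    rewrite -ge0_integralZl//; last 2 first.
      by apply/measurable_EFinP; exact: measurable_indic.
      by rewrite lee_fin ltW.
    apply: ge0_le_integral => //.
    - by move=> x _; rewrite -EFinM lee_fin mulr_ge0// ltW.
    - by apply: measurable_funeM; apply/measurable_EFinP; exact: measurable_indic.
    - move=> x _; rewrite -EFinM lee_fin indicE.
      case: (boolP (_ \in _)); last by rewrite mulr0 powR_ge0.
      rewrite inE/= mulr1 => sr; rewrite ge0_ler_powR ?nnegrE ?(ltW r0) ?(ltW p0)//.
      by rewrite -sr.
  move=> /le_lt_trans /(_ hpi); case: (mu _) => [x||]; rewrite ?ltry//.
  by rewrite mulry gtr0_sg// mul1e.
suff [n hn] : exists n, (\int[mu]_x (rnorm ((h x)%:C - (s n x)%:C) `^ p)%:E < (e `^ p)%:E)%E.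
  exists (fun x => (s n x)%:C) => //.
  have hsp := cLfun_sub p1 hp (sp n).1.
  have : cnorm mu p ((fun x => (h x)%:C) - (fun x => (s n x)%:C)) `^ p < e `^ p.
    by rewrite -lte_fin cnormX.
  apply: contraTT; rewrite -!leNgt => eh.
  by rewrite ge0_ler_powR ?nnegrE ?cnorm_ge0 ?(ltW e0) ?(ltW p0).
pose u n x := ((h x - s n x) `^ p)%:E.
have mu_ n : measurable_fun setT (u n).
  apply/measurable_EFinP; apply: (measurableT_comp (measurable_powR p)).
  exact: measurable_funB.
have u0 n x : (0 <= u n x)%E by rewrite lee_fin powR_ge0.
have hs0 n x : 0 <= h x - s n x by rewrite subr_ge0.
have [] := @dominated_convergence _ _ _ mu setT measurableT u (cst 0%E) (fun x => (h x `^ p)%:E).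
- exact: mu_.
- exact: measurable_cst.
- apply: aeW => x _; apply: cvg_EFin; first by near=> n.
  apply/cvgrPdist_lt => d d0; have d'0 : 0 < d `^ p^-1 by rewrite powR_gt0.
  have := scvg x; move=> /cvgrPdist_lt /(_ _ d'0); apply: filterS => n /=.
  rewrite (ger0_norm (hs0 _ _)) sub0r normrN ger0_norm ?powR_ge0// => hd.
  rewrite -(powRr1 (ltW d0)) -(mulVf (lt0r_neq0 p0)) powRrM.
  by rewrite gt0_ltr_powR ?nnegrE ?powR_ge0.
- apply/integrableP; split => //.
  by under eq_integral do rewrite gee0_abs ?lee_fin ?powR_ge0//.
- apply: aeW => x n _; rewrite gee0_abs// lee_fin ge0_ler_powR ?nnegrE ?(ltW p0)//.
  by rewrite gerBl.
move=> _ + _ => /fine_cvgP[fin /cvgrPdist_lt /(_ (e `^ p))].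
rewrite powR_gt0// => /(_ isT) lt.
have [n [fn ltn]] : exists n, (fun n => (\int[mu]_x `|u n x - 0|)%E) n \is a fin_num /\
    `|0 - fine (\int[mu]_x `|u n x - 0|)%E| < e `^ p.
  near \oo => n; exists n; split; first by near: n; exact: fin.
  by near: n; exact: lt.
exists n; move: ltn; rewrite sub0r normrN => /(le_lt_trans (ler_norm _)).
rewrite -lte_fin fineK//; apply: le_lt_trans.
rewrite le_eqVlt; apply/orP; left; apply/eqP/eq_integral => x _.
by rewrite /u sube0 gee0_abs ?lee_fin ?powR_ge0// -rmorphB rnorm_real ger0_norm.
Unshelve. all: by end_near. Qed.

(** The positive and negative parts of the real and imaginary parts of f are dominated by |f|, hence
    lie in L_p, and approximability is linear. *)
Lemma Cc_dense f (e : R) : f \in cLf -> 0 < e ->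
  exists2 g : G -> R[i], Cc g & cnorm mu p (f - (g : borel G -> R[i])) < e.
Proof.
move=> fp e0; suff [_ /(_ _ e0)] : approx f by [].
have [mr mi] := cLfun_meas fp.
have part (h : R[i] -> R) : measurable_fun setT (h \o f) ->
    (forall z, `|h z| <= rnorm z) -> approx (fun x => (h (f x))%:C).
  move=> mh hr.
  have sgn (k : R -> R) : measurable_fun setT k -> (forall r, 0 <= k r <= `|r|) ->
      approx (fun x => (k (h (f x)))%:C).
    move=> mk k0; have mkh : measurable_fun setT (fun x => k (h (f x))).
      exact: (measurableT_comp mk mh).
    apply: approx_ge0 => //; first by move=> x; have /andP[] := k0 (h (f x)).
    have [] // := @cnorm_dom _ _ _ mu p p1 (fun x => (k (h (f x)))%:C) f 1 ler01 _ fp.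
      exact: cmeasurable_real.
    move=> x; rewrite mul1r rnorm_real; have /andP[kx0 kx] := k0 (h (f x)).
    by rewrite ger0_norm// (le_trans kx).
  have := approx_linear (-1) (sgn (fun r => Num.max (- r) 0) _ _)
    (sgn (fun r => Num.max r 0) _ _).
  rewrite (_ : -1 *: _ + _ = (fun x => (h (f x))%:C)).
    apply.
    - by apply: measurable_maxr => //; exact: measurableT_comp.
    - by move=> r; rewrite le_max lexx orbT/= ge_max normr_ge0 andbT -normrN ler_norm.
    - exact: measurable_maxr.
    - by move=> r; rewrite le_max lexx orbT/= ge_max normr_ge0 andbT ler_norm.
  apply/funext => x; rewrite -[LHS]/(-1 * (Num.max (- h (f x)) 0)%:C + (Num.max (h (f x)) 0)%:C).
  rewrite mulN1r -rmorphN -rmorphD/=; congr (_%:C).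
  by case: (leP 0 (h (f x))) => hx; case: (leP (- h (f x)) 0); lra.
have := approx_linear 'i%C (part _ mi (@ler_Im_rnorm R)) (part _ mr (@ler_Re_rnorm R)).
congr approx; apply/funext => x.
rewrite -[LHS]/('i%C * (complex.Im (f x))%:C + (complex.Re (f x))%:C).
by rewrite addrC -complexE.
Qed.

Lemma Lp_dense (x : Lp mu p1) (e : R) : 0 < e ->
  exists2 g : G -> R[i], Cc g & rnorm (x - Lp_class mu p1 g) < e.
Proof.
move=> e0; have xp := Lp_cLfun x; have [g gc xg] := Cc_dense xp e0; exists g => //.
have gp := Cc_cLfun mu_haar p1 gc.
by rewrite -{1}[x]Lp_classK -Lp_classB// Lp_class_norm// cLfun_sub.
Qed.

End Cc_dense.

(** * Step functions *)

Section partition.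
Context (R : realType) (G : lcGroupType).

(** A finite subcover is made disjoint by removing from each member the earlier ones. The last
    clause says at once that the pieces cover K and that they are disjoint. With N x a set on which
    given functions hardly vary, this produces the Riemann sums used below. *)
Lemma compact_partition (K : set G) (N : G -> set G) : compact K ->
  (forall x, K x -> nbhs x (N x)) ->
  exists (n : nat) (Y : 'I_n -> set (borel G)) (c : 'I_n -> G),
  [/\ forall i, measurable (Y i), forall i, Y i `<=` K, forall i, K (c i),
    forall i, Y i `<=` N (c i) &
    forall x, K x -> exists i, forall j, Y j x <-> j = i].
Proof.
move=> cK NK; have := cK; rewrite compact_cover => /(_ G K (fun x => (N x)°)).
case=> [x Kx|x Kx|D DK KD]; first exact: open_interior.
  by exists x => //; apply: NK.
pose l : seq G := finmap.enum_fset D.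
pose c (i : 'I_(size l)) := nth 1%g l i.
have cK' i : K (c i) by have := DK (c i) (mem_nth 1%g (ltn_ord i)); rewrite inE.
pose Y (i : 'I_(size l)) : set (borel G) :=
  K `&` [set x | (N (c i))° x /\ forall j : 'I_(size l), (j < i)%N -> ~ (N (c j))° x].
have mN i : measurable ((N (c i))° : set (borel G)) by apply: open_borel; exact: open_interior.
exists (size l), Y, c; split.
- move=> i; apply: measurableI; first exact: compact_borel.
  rewrite (_ : [set x | _] = (N (c i))° `&` \bigcap_(j in [set j : 'I_(size l) | (j < i)%N]) ~` (N (c j))°).
    apply: measurableI => //; apply: fin_bigcap_measurable => //.
    by move=> j _; exact: measurableC.
  by apply/seteqP; split => x [h1 h2]; split => // j ji; apply: h2.
- by move=> i x [].
- exact: cK'.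
- by move=> i x [_ [/interior_subset]].
- move=> x Kx; have [y yD yx] := KD x Kx; have yl : y \in l by exact: yD.
  have ex : exists k, (k < size l)%N && `[<(N (nth 1%g l k))° x>].
    exists (index y l); rewrite index_mem; apply/andP; split=> //.
    by apply/asboolP; rewrite nth_index.
  (* The first neighbourhood that contains x determines the only piece that contains x. *)
  have [k /andP[kl /asboolP Nk] kmin] := find_ex_minn ex.
  exists (Ordinal kl) => i; split=> [[_ [Ni Nj]]|-> ].
    apply/val_inj => /=; apply/eqP; rewrite eqn_leq kmin ?andbT; last first.
      by rewrite ltn_ord; apply/asboolP.
    by rewrite leqNgt; apply/negP => ki; exact: (Nj (Ordinal kl)).
  split=> //; split=> // j jk Nj; have := kmin j; rewrite ltn_ord/=.
  by move=> /(_ (asboolT Nj)); rewrite leqNgt jk.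
Qed.

End partition.

Section steps.
Context (R : realType) (G : lcGroupType) (mu : {measure set (borel G) -> \bar R}).
Hypothesis mu_haar : left_haar mu.

Definition partition_of (K : set G) n (Y : 'I_n -> set (borel G)) :=
  [/\ forall i, measurable (Y i), forall i, Y i `<=` K &
      forall x, K x -> exists i, forall j, Y j x <-> j = i].

Definition step n (Y : 'I_n -> set (borel G)) (v : 'I_n -> R[i]) : borel G -> R[i] :=
  \sum_i v i *: cindic R (Y i).

Variables (K : set G) (n : nat) (Y : 'I_n -> set (borel G)).
Hypotheses (cK : compact K) (KY : partition_of K Y).
Implicit Types v w : 'I_n -> R[i].

Lemma partition_in x : K x -> exists i, Y i x /\ forall v, step Y v x = v i.
Proof.
move=> Kx; have [_ _ /(_ x Kx) [i hi]] := KY; exists i; split; first exact/hi.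
move=> v; rewrite /step fct_sumE (bigD1 i)//= big1 => [|j ji].
  by rewrite addr0 -[LHS]/(v i * cindic R (Y i) x) cindicE asboolT ?mulr1//; exact/hi.
rewrite -[LHS]/(v j * cindic R (Y j) x) cindicE asboolF ?mulr0//.
by move=> /hi/eqP; rewrite (negbTE ji).
Qed.

Lemma step_out v x : ~ K x -> step Y v x = 0.
Proof.
move=> Kx; rewrite /step fct_sumE big1// => j _.
rewrite -[LHS]/(v j * cindic R (Y j) x) cindicE asboolF ?mulr0//.
by have [_ YK _] := KY; move/YK.
Qed.

Lemma partition_fin i : (mu (Y i) < +oo)%E.
Proof.
have [mY YK _] := KY; apply: le_lt_trans (haar_compact mu_haar cK).
by apply: le_measure; rewrite ?inE//; exact: compact_borel.
Qed.

Lemma partition_fin_num i : mu (Y i) \is a fin_num.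
Proof. by rewrite ge0_fin_numE// partition_fin. Qed.

Lemma step_cLfun p (p1 : 1 <= p) v : step Y v \in cLfun mu p.
Proof.
have [mY _ _] := KY; apply: cLfun_sum => // i; apply: cLfunZ => //.
by have [] := cnorm_cindic p1 (mY i) (partition_fin i).
Qed.

(** At most one piece contains x, so the power passes inside the sum. *)
Lemma rnorm_step v x (p : R) : 0 < p ->
  rnorm (step Y v x) `^ p = \sum_i rnorm (v i) `^ p * \1_(Y i) x.
Proof.
move=> p0; have [mY YK hY] := KY; have [Kx|Kx] := pselect (K x); last first.
  rewrite step_out// rnorm0 powR0 ?gt_eqF// big1// => i _.
  by rewrite indicE memNset ?mulr0// => /YK.
have [i hi] := hY x Kx; have [i' [Yi' ->]] := partition_in Kx.
have -> : i' = i by apply/hi.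
rewrite (bigD1 i)//= big1 => [|j ji].
  by rewrite indicE mem_set ?mulr1 ?addr0//; exact/hi.
by rewrite indicE memNset ?mulr0// => /hi/eqP; rewrite (negbTE ji).
Qed.

Lemma cnorm_step p (p1 : 1 <= p) v :
  cnorm mu p (step Y v) `^ p = \sum_i rnorm (v i) `^ p * fine (mu (Y i)).
Proof.
have p0 : 0 < p by exact: lt_le_trans p1.
have [mY _ _] := KY; apply: EFin_inj; rewrite (cnormX p1 (step_cLfun p1 v)).
under eq_integral do rewrite rnorm_step// -sumEFin.
rewrite ge0_integral_sum//; last 2 first.
- by move=> i; apply/measurable_EFinP; apply: measurable_funM => //; exact: measurable_indic.
- by move=> i x _; rewrite lee_fin mulr_ge0 ?powR_ge0.
rewrite -sumEFin; apply: eq_bigr => i _; under eq_integral do rewrite EFinM.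
rewrite ge0_integralZl ?lee_fin ?powR_ge0//; last by apply/measurable_EFinP; exact: measurable_indic.
by rewrite integral_indic// setIT EFinM fineK// partition_fin_num.
Qed.

Lemma cintegral_cindic (A : set (borel G)) : measurable A -> (mu A < +oo)%E ->
  cintegral mu (cindic R A) = (fine (mu A))%:C.
Proof.
move=> mA Afin; apply/eqP; rewrite eq_complex /cintegral/=; apply/andP; split; apply/eqP.
  by rewrite /Rintegral/= integral_indic// setIT.
by rewrite /Rintegral integral0.
Qed.

Lemma cintegral_step v : cintegral mu (step Y v) = \sum_i (fine (mu (Y i)))%:C * v i.
Proof.
have [mY _ _] := KY; rewrite cintegral_sum => [|i]; last first.
  by apply: cLfunZ => //; have [] := cnorm_cindic (lexx 1) (mY i) (partition_fin i).
apply: eq_bigr => i _; have [h _] := cnorm_cindic (lexx 1) (mY i) (partition_fin i).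
by rewrite cintegralZ// cintegral_cindic ?partition_fin// mulrC.
Qed.

Lemma step_close p (p1 : 1 <= p) (f : borel G -> R[i]) v (e : R) : 0 <= e ->
  cmeasurable f -> (forall x, ~ K x -> f x = 0) ->
  (forall i x, Y i x -> rnorm (f x - v i) <= e) ->
  f \in cLfun mu p /\ cnorm mu p (f - step Y v) <= e * fine (mu K) `^ p^-1.
Proof.
move=> e0 mf f0 fv; have sp := step_cLfun p1 v.
have [] := @cnorm_sup R G mu p p1 K (f - step Y v) e (compact_borel cK)
  (haar_compact mu_haar cK) _ e0.
- by apply: cmeasurableB => //; exact: cLfun_meas sp.
- move=> x Kx; have [i [Yi si]] := partition_in Kx.
  by rewrite -[X in rnorm X]/(f x - step Y v x) si; exact: fv.
- by move=> x Kx; rewrite -[LHS]/(f x - step Y v x) f0// step_out// subrr.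
by move=> dp le; split=> //; rewrite -[f](subrK (step Y v)); exact: cLfunD.
Qed.

(** The difference is the integral of a function bounded by e and supported in K. Integrals over the
    translation variable are exchanged with other operations only after this replacement by a finite
    sum. *)
Lemma riemann (f : borel G -> R[i]) v (e : R) : 0 <= e ->
  cmeasurable f -> (forall x, ~ K x -> f x = 0) ->
  (forall i x, Y i x -> rnorm (f x - v i) <= e) ->
  rnorm (cintegral mu f - \sum_i (fine (mu (Y i)))%:C * v i) <= e * fine (mu K).
Proof.
move=> e0 mf f0 fv; have [f1 le] := step_close (lexx 1) e0 mf f0 fv.
rewrite -cintegral_step -cintegralB ?step_cLfun//.
rewrite (le_trans (rnorm_cintegral _)) ?cLfun_sub ?step_cLfun//.
by rewrite invr1 powRr1 ?fine_ge0 in le.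
Qed.

End steps.

Section step_approximation.
Context (R : realType) (G : lcGroupType) (mu : {measure set (borel G) -> \bar R}).
Hypothesis mu_haar : left_haar mu.

Lemma Cc_common_support N (f : 'I_N -> G -> R[i]) : (forall l, Cc (f l)) ->
  exists2 K : set G, compact K & forall l x, ~ K x -> f l x = 0.
Proof.
move=> fc; have supp l : exists K : set G, compact K /\ forall x, ~ K x -> f l x = 0.
  by have [_ [K cK fK]] := fc l; exists K.
have [L hL] := choice supp.
exists (\big[setU/set0]_l L l).
  by apply: bigsetU_compact => l _; have [] := hL l.
move=> l x Kx; have [_ h] := hL l; apply: h => Ll; apply: Kx.
by rewrite -bigcup_seq; exists l => //=; rewrite mem_index_enum.
Qed.

Lemma continuous_partition N (f : 'I_N -> G -> R[i]) (K : set G) (e : R) : compact K ->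
  (forall l, continuous (f l)) -> 0 < e ->
  exists n (Y : 'I_n -> set (borel G)) (c : 'I_n -> G),
    partition_of K Y /\ forall l i x, Y i x -> rnorm (f l x - f l (c i)) <= e.
Proof.
move=> cK cf e0; pose Nb (y : G) := [set x | forall l, rnorm (f l x - f l y) <= e].
have hN x : K x -> nbhs x (Nb x).
  move=> _; apply: filter_forall => l.
  have /cvg_rnormP/(_ _ e0) := cf l x.
  by apply: filterS => y xy; rewrite /= rnormBC ltW.
have [n [Y [c [mY YK _ YN hY]]]] := compact_partition cK hN.
by exists n, Y, c; split=> // l i x Yx; have := YN i x Yx; apply.
Qed.

(** One partition serves all the [F l], so that their approximants are encoded by a single matrix
    [v]. *)
Lemma Lp_step_approx p (p1 : 1 <= p) N (F : 'I_N -> Lp mu p1) (e : R) : 0 < e ->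
  exists (K : set G) n (Y : 'I_n -> set (borel G)) (v : 'I_N -> 'I_n -> R[i]),
  [/\ compact K, partition_of K Y &
      forall l, rnorm (F l - Lp_class mu p1 (step Y (v l))) < e].
Proof.
move=> e0; have e20 : 0 < e / 2 by rewrite divr_gt0.
have /choice[f hf] l : exists f : G -> R[i], Cc f /\ rnorm (F l - Lp_class mu p1 f) < e / 2.
  by have [f fc fF] := Lp_dense mu_haar (F l) e20; exists f.
have [K cK fK] := Cc_common_support (fun l => (hf l).1).
pose k := fine (mu K) `^ p^-1; have k0 : 0 <= k by rewrite powR_ge0.
have d0 : 0 < e / 2 / (k + 1) by rewrite divr_gt0// ltr_wpDl.
have [n [Y [c [KY fY]]]] := continuous_partition cK (fun l => (hf l).1.1) d0.
exists K, n, Y, (fun l i => f l (c i)); split=> // l; have [fc lF] := hf l.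
have fp := Cc_cLfun mu_haar p1 fc; have sp := step_cLfun mu_haar cK KY p1 (f l \o c).
rewrite -(subrKA (Lp_class mu p1 (f l))) (le_lt_trans (ler_rnormD _ _))//.
rewrite [ltRHS]splitr ltr_leD// -Lp_classB// Lp_class_norm ?cLfun_sub//.
have [] := step_close mu_haar cK KY p1 (ltW d0) (continuous_cmeasurable fc.1) (fK l) (fY l).
move=> _ /le_trans; apply; rewrite -/k mulrAC ler_pdivrMr ?ltr_wpDl//.
by rewrite ler_wpM2l ?(ltW e20)// lerDl.
Qed.

End step_approximation.

(* Unlike in [SQ], [F] need not be closed nor [E] complete, so that L_p itself
   qualifies. *)
Definition Lp_subquotient (R : realType) (p : R) (p1 : 1 <= p)
    (E : normedModType R[i]) : Prop :=
  exists (d : measure_display) (T : measurableType d)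
    (nu : {measure set T -> \bar R}) (F : set (Lp nu p1)) (q : Lp nu p1 -> E),
  [/\ F 0,
      forall (a : R[i]) f g, F f -> F g -> F (a *: f + g),
      forall (a : R[i]) f g, F f -> F g -> q (a *: f + g) = a *: q f + q g,
      forall f, F f -> rnorm (q f) <= rnorm f &
      forall (e : E) (r : R), 0 < r -> exists f, [/\ F f, q f = e & rnorm f <= rnorm e + r]].

(** * Subquotients of L_p spaces *)

Section subquotients.
Context (R : realType) (p : R) (p1 : 1 <= p).

Lemma SQ_subquotient (E : completeNormedModType R[i]) : SQ p1 E -> Lp_subquotient p1 E.
Proof.
move=> [d [T [nu [F [q [_ F0 Fl ql qn]]]]]]; exists d, T, nu, F, q; split=> //.
- move=> f Ff; have [_ ->] := qn (q f); apply: ge_inf; last by exists f.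
  by exists 0 => _ [g _ <-]; exact: rnorm_ge0.
- move=> e r r0; have [[f0 Ff0 qf0] en] := qn e.
  have hi : has_inf [set rnorm f | f in F `&` [set f | q f = e]].
    split; first by exists (rnorm f0), f0.
    by exists 0 => _ [g _ <-]; exact: rnorm_ge0.
  have [_ [f [Ff qf] <-] lt] := inf_adherent r0 hi.
  by exists f; split => //; rewrite en ltW.
Qed.

Lemma Lp_self_subquotient d (T : measurableType d) (nu : {measure set T -> \bar R}) :
  Lp_subquotient p1 (Lp nu p1).
Proof.
exists d, T, nu, setT, id; split => // e r r0; exists e; split => //.
by rewrite lerDl ltW.
Qed.

(** The constant is crude. Two applications of this inequality in [subquotient_pairing] account for
    the factor 4 there. *)
Lemma powRD_le (x y : R) : 0 <= x -> 0 <= y ->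
  (x + y) `^ p <= 2 `^ p * (x `^ p + y `^ p).
Proof.
have p0 : 0 <= p by exact: le_trans p1.
move=> x0 y0; wlog xy : x y x0 y0 / x <= y.
  by move=> h; have [/h ->//|/ltW/h] := leP x y; rewrite addrC [X in _ * X]addrC; apply.
apply: (@le_trans _ _ ((2 * y) `^ p)).
  by rewrite ge0_ler_powR ?nnegrE ?addr_ge0 ?mulr_ge0//; lra.
by rewrite powRM// ler_wpM2l ?powR_ge0// lerDr powR_ge0.
Qed.

(** The factor N ^ p is harmless: it only ever multiplies an approximation error that is chosen
    after N. *)
Lemma powR_sum_le N (x : 'I_N -> R) : (forall l, 0 <= x l) ->
  (\sum_l x l) `^ p <= N%:R `^ p * \sum_l x l `^ p.
Proof.
have p0 : 0 < p by exact: lt_le_trans p1.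
case: N x => [|N] x x0.
  by rewrite !big_ord0 mulr0 powR0// gt_eqF.
pose k := [arg max_(i > ord0) x i]%O.
have xk l : x l <= x k by rewrite /k; case: Order.TotalTheory.arg_maxP => // i _ h; exact: h.
apply: (@le_trans _ _ ((N.+1%:R * x k) `^ p)).
  rewrite ge0_ler_powR ?nnegrE ?(ltW p0) ?sumr_ge0 ?mulr_ge0//.
  rewrite (le_trans (ler_sum _ (fun l _ => xk l)))//.
  by rewrite sumr_const card_ord -[_ *+ _]mulr_natl.
rewrite powRM// ler_wpM2l ?powR_ge0// (bigD1 k)//= lerDl sumr_ge0// => *.
exact: powR_ge0.
Qed.

End subquotients.

Lemma integral_lincomb d (T : measurableType d) (R : realType)
    (nu : {measure set T -> \bar R}) n (k : 'I_n -> R) (f : 'I_n -> T -> R) :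
  (forall i, 0 <= k i) -> (forall i, measurable_fun setT (fun x => (f i x)%:E)) ->
  (forall i x, 0 <= f i x) ->
  (\sum_i (k i)%:E * \int[nu]_x (f i x)%:E = \int[nu]_x (\sum_i k i * f i x)%:E)%E.
Proof.
move=> k0 mf f0; under [RHS]eq_integral do rewrite -sumEFin.
rewrite ge0_integral_sum//; first last.
- by move=> i x _; rewrite lee_fin mulr_ge0.
- by move=> i; under eq_fun do rewrite EFinM; exact: measurable_funeM.
apply: eq_bigr => i _; under [RHS]eq_integral do rewrite EFinM.
by rewrite ge0_integralZl ?lee_fin//; move=> x _; rewrite lee_fin.
Qed.

Section subquotient_matrix.
Context (R : realType) (p : R) (p1 : 1 <= p).
Variables (N n : nat) (V : 'I_N -> 'I_n -> R[i]) (w : 'I_n -> R) (k : 'I_N -> R).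
Hypotheses (w0 : forall i, 0 <= w i) (k0 : forall l, 0 <= k l)
  (Vle : forall c : 'I_N -> R[i],
    \sum_i rnorm (\sum_l c l * V l i) `^ p * w i <= \sum_l rnorm (c l) `^ p * k l).

(* Integrate the scalar inequality; only finite sums are exchanged with the
   integral. *)
Lemma Lp_matrix_bound d (T : measurableType d) (nu : {measure set T -> \bar R})
    (f : 'I_N -> Lp nu p1) :
  \sum_i rnorm (\sum_l V l i *: f l) `^ p * w i <= \sum_l rnorm (f l) `^ p * k l.
Proof.
have fp l := Lp_cLfun (f l).
have E i : ((rnorm (\sum_l V l i *: f l) `^ p)%:E =
    \int[nu]_x (rnorm (\sum_l f l x * V l i) `^ p)%:E)%E.
  have cp l : V l i *: (f l : T -> R[i]) \in cLfun nu p by exact: cLfunZ.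
  have -> : \sum_l V l i *: f l = Lp_class nu p1 (\sum_l V l i *: (f l : T -> R[i])).
    rewrite Lp_class_sum//; apply: eq_bigr => l _.
    by rewrite Lp_classZ// Lp_classK.
  have sp := cLfun_sum p1 (index_enum 'I_N) cp.
  rewrite (Lp_class_norm p1 sp) (cnormX p1 sp).
  apply: eq_integral => x _; rewrite fct_sumE; congr (rnorm _ `^ p)%:E.
  by apply: eq_bigr => l _; rewrite mulrC.
have mV i : cmeasurable (fun x => \sum_l f l x * V l i).
  rewrite (_ : (fun x => _) = \sum_l (fun x => f l x * V l i)).
    apply: cmeasurable_sum => l; apply: cmeasurableM; first exact: cLfun_meas (fp l).
    exact: cmeasurable_cst.
  by apply/funext => x; rewrite fct_sumE.
rewrite -lee_fin -!sumEFin.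
have m1 i : measurable_fun setT (fun x => (rnorm (\sum_l f l x * V l i) `^ p)%:E).
  exact: measurable_rnorm_powR.
have m2 l : measurable_fun setT (fun x => (rnorm (f l x) `^ p)%:E).
  exact: measurable_rnorm_powR (cLfun_meas (fp l)).
under eq_bigr do rewrite EFinM E muleC.
under [leRHS]eq_bigr => l _ do rewrite EFinM Lp_normE (cnormX p1 (fp l)) muleC.
rewrite !integral_lincomb//; try by move=> *; exact: powR_ge0.
apply: ge0_le_integral => //.
- by move=> x _; rewrite lee_fin; apply: sumr_ge0 => i _; rewrite mulr_ge0 ?powR_ge0.
- under eq_fun do rewrite -sumEFin; apply: emeasurable_sum => i.
  by under eq_fun do rewrite EFinM; exact: measurable_funeM.
- under eq_fun do rewrite -sumEFin; apply: emeasurable_sum => l.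
  by under eq_fun do rewrite EFinM; exact: measurable_funeM.
move=> x _; rewrite lee_fin; have := Vle (fun l => f l x).
by under eq_bigr do rewrite mulrC; under [leRHS]eq_bigr do rewrite mulrC.
Qed.

(** The place where the class SQ_p enters. The vectors [a l] are lifted to L_p, where the scalar
    inequality extends to vectors by integration, and the result comes back through the contraction
    [q]. The slack e is there because a lift attains the norm only approximately. *)
Lemma subquotient_matrix_bound (E : normedModType R[i]) (a : 'I_N -> E) (e : R) :
  Lp_subquotient p1 E -> 0 < e ->
  \sum_i rnorm (\sum_l V l i *: a l) `^ p * w i <= \sum_l (rnorm (a l) + e) `^ p * k l.
Proof.
move=> [d [T [nu [F [q [F0 Fl ql qn lift]]]]]] e0.
have /choice[f hf] l : exists f, [/\ F f, q f = a l & rnorm f <= rnorm (a l) + e].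
  exact: lift.
have pp : 0 <= p by exact: le_trans p1.
have q0 : q 0 = 0.
  by have := ql (-1) 0 0 F0 F0; rewrite scaler0 addr0 scaleN1r addNr.
have qsum (c : 'I_N -> R[i]) : F (\sum_l c l *: f l) /\
    q (\sum_l c l *: f l) = \sum_l c l *: a l.
  elim/big_rec2: _ => [//|l y x _ [Fx qx]].
  by have [Ff qf _] := hf l; split; [exact: Fl|rewrite ql// qx qf].
apply: (@le_trans _ _ (\sum_i rnorm (\sum_l V l i *: f l) `^ p * w i)).
  apply: ler_sum => i _; rewrite ler_wpM2r// ge0_ler_powR ?nnegrE ?rnorm_ge0//.
  by have [Ff <-] := qsum (V ^~ i); exact: qn.
apply: le_trans (Lp_matrix_bound f) _; apply: ler_sum => l _.
rewrite ler_wpM2r// ge0_ler_powR ?nnegrE ?rnorm_ge0//.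
  by rewrite addr_ge0 ?rnorm_ge0 ?(ltW e0).
by have [] := hf l.
Qed.

End subquotient_matrix.

Section subquotient_pairing.
Context (R : realType) (G : lcGroupType) (mu : {measure set (borel G) -> \bar R}).
Hypothesis mu_haar : left_haar mu.
Variables (p q : R) (p1 : 1 <= p) (q1 : 1 <= q) (pq : p^-1 + q^-1 = 1).
Context (E : normedModType R[i]) (hE : Lp_subquotient p1 E).

(** The sum is the integral of g(t) b_t(sum_l F_l(t) a_l), where t |-> sum_l F_l(t) a_l should be
    seen as a function with values in E and norm at most r. Replacing the [F l] by step functions
    makes it finitely valued, so that no space L_p(E) is needed: [subquotient_matrix_bound] controls
    its values. *)
Lemma subquotient_pairing N (F : 'I_N -> Lp mu p1) (m : 'I_N -> R) (a : 'I_N -> E)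
    (b : G -> E -> R[i]) (B : R) (g : borel G -> R[i]) (r : R) :
  (forall l, 0 <= m l) ->
  (forall c : 'I_N -> R[i],
    rnorm (\sum_l c l *: F l) `^ p <= \sum_l rnorm (c l) `^ p * m l) ->
  0 <= B -> (forall t, scalar (b t)) -> (forall t e, rnorm (b t e) <= B * rnorm e) ->
  (forall l, cmeasurable (fun t : borel G => b t (a l))) ->
  g \in cLfun mu q -> 0 < r -> \sum_l rnorm (a l) `^ p * m l < r `^ p ->
  rnorm (\sum_l Lpair (Lp_class mu q1 (fun t => b t (a l) * g t)) (F l))
    <= 5 * (B * cnorm mu q g * r).
Proof.
move=> m0 Fm B0 bl bB mb gq r0 Sr; set S := \sum_l _ in Sr.
have p0 : 0 < p by exact: lt_le_trans p1.
pose A := \sum_l rnorm (a l); have A0 : 0 <= A by apply: sumr_ge0 => *; exact: rnorm_ge0.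
pose Np : R := N%:R `^ p; have Np0 : 0 <= Np by exact: powR_ge0.
pose C := \sum_l m l + Np * (\sum_l rnorm (a l) `^ p) + Np * N%:R.
have Ap0 : 0 <= \sum_l rnorm (a l) `^ p by apply: sumr_ge0 => *; exact: powR_ge0.
have sm0 : 0 <= \sum_l m l by apply: sumr_ge0.
have C0 : 0 <= C by rewrite !addr_ge0 ?mulr_ge0.
(* [dA] pays for replacing each [F l] by a step function. [dC] absorbs all perturbations of the sum
   S and is possible since S < r ^ p strictly; [d1] allows the square of d ^ p to be bounded by d ^
   p. *)
have [d [d0 d1 dA dC]] : exists d : R, [/\ 0 < d, d <= 1, d * A <= r &
    d `^ p * C <= r `^ p - S].
  have s0 : 0 < (r `^ p - S) / (C + 1) by rewrite divr_gt0 ?subr_gt0// ltr_wpDl.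
  have t0 : 0 < r / (A + 1) by rewrite divr_gt0// ltr_wpDl.
  pose s := ((r `^ p - S) / (C + 1)) `^ p^-1; have s0' : 0 < s by exact: powR_gt0.
  exists (Num.min 1 (Num.min (r / (A + 1)) s)); set d := Num.min _ _.
  have d0 : 0 < d by rewrite !lt_min ltr01 t0 s0'.
  have dt : d <= r / (A + 1) by rewrite /d !ge_min lexx orbT.
  have ds : d <= s by rewrite /d !ge_min lexx !orbT.
  split => //; first by rewrite ge_min lexx.
    rewrite (le_trans (ler_wpM2r A0 dt))// mulrAC ler_pdivrMr ?ltr_wpDl//.
    by rewrite ler_wpM2l ?(ltW r0)// lerDl.
  have dps : d `^ p <= (r `^ p - S) / (C + 1).
    rewrite (_ : (r `^ p - S) / (C + 1) = s `^ p).
      by rewrite ge0_ler_powR ?nnegrE ?(ltW p0) ?(ltW d0) ?(ltW s0').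
    by rewrite -powRrM mulVf ?gt_eqF// powRr1// ltW.
  rewrite (le_trans (ler_wpM2r C0 dps))// mulrAC ler_pdivrMr ?ltr_wpDl//.
  by rewrite ler_wpM2l ?lerDl// subr_ge0 ltW.
have [K [n [Y [v [cK KY vF]]]]] := Lp_step_approx mu_haar F d0.
pose h l := step Y (v l); have hp l : h l \in cLfun mu p by exact: (step_cLfun mu_haar cK KY p1).
have gbp l := cLfunMb q1 (mb l) (fun t => bB t (a l)) gq.
pose gb l := Lp_class mu q1 (fun t => b t (a l) * g t).
have Lb := @Lpair_bilinear _ _ _ mu p q p1 q1 pq.
rewrite (_ : \sum_l _ = \sum_l Lpair (gb l) (F l - Lp_class mu p1 (h l))
    + \sum_l Lpair (gb l) (Lp_class mu p1 (h l))); last first.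
  rewrite -big_split/=; apply: eq_bigr => l _.
  have := Lb.2 (gb l) 1 (F l - Lp_class mu p1 (h l)) (Lp_class mu p1 (h l)).
  by rewrite scale1r subrK mul1r.
(* One unit for the step approximation, four for the step functions themselves. *)
rewrite (le_trans (ler_rnormD _ _))// (_ : 5 = 1 + 4); last by lra.
rewrite mulrDl mul1r lerD//.
  rewrite (le_trans (rnorm_sum _ _ _))//.
  apply: (@le_trans _ _ (\sum_l rnorm (a l) * (B * cnorm mu q g * d))).
    apply: ler_sum => l _; rewrite (le_trans (Lpair_bound pq _ _))//.
    rewrite mulrA ler_pM ?rnorm_ge0//; last exact: ltW.
    rewrite Lp_class_norm; last by case: (gbp l).
    by apply: (le_trans (gbp l).2); rewrite mulrA [rnorm _ * B]mulrC.
  rewrite -mulr_suml -/A mulrCA ler_wpM2l ?mulr_ge0 ?cnorm_ge0//.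
  by rewrite mulrC.
(* The value on the piece [Y i] of the approximating function with values in E. *)
pose z i := \sum_l v l i *: a l.
have zle : \sum_i rnorm (z i) `^ p * fine (mu (Y i)) <= (4 * r) `^ p.
  (* The map c |-> sum_l c_l h_l differs from c |-> sum_l c_l F_l by at most d times the sum of the
     |c_l|; [powRD_le] and [powR_sum_le] turn this into an enlargement of the weights [m]. *)
  pose k l := 2 `^ p * (m l + d `^ p * Np).
  have k0 l : 0 <= k l by rewrite mulr_ge0 ?powR_ge0// addr_ge0// mulr_ge0 ?powR_ge0.
  have Vle (c : 'I_N -> R[i]) : \sum_i rnorm (\sum_l c l * v l i) `^ p * fine (mu (Y i))
      <= \sum_l rnorm (c l) `^ p * k l.
    rewrite -(cnorm_step mu_haar cK KY p1 (fun i => \sum_l c l * v l i)).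
    have -> : step Y (fun i => \sum_l c l * v l i) = \sum_l c l *: h l.
      rewrite /h /step; under [RHS]eq_bigr do rewrite scaler_sumr.
      rewrite exchange_big/=; apply: eq_bigr => i _; rewrite scaler_suml.
      by apply: eq_bigr => l _; rewrite scalerA.
    have chp l : c l *: h l \in cLfun mu p by exact: cLfunZ.
    rewrite -(Lp_class_norm p1) ?cLfun_sum// Lp_class_sum//.
    under eq_bigr do rewrite Lp_classZ//.
    apply: (@le_trans _ _ ((rnorm (\sum_l c l *: F l) + d * \sum_l rnorm (c l)) `^ p)).
      rewrite ge0_ler_powR ?nnegrE ?rnorm_ge0 ?(ltW p0)//.
        by rewrite addr_ge0 ?rnorm_ge0 ?mulr_ge0 ?(ltW d0) ?sumr_ge0// => *; exact: rnorm_ge0.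
      rewrite -[X in rnorm X](subrK (\sum_l c l *: F l)) addrC.
      rewrite (le_trans (ler_rnormD _ _))// lerD2l -sumrB mulr_sumr.
      rewrite (le_trans (rnorm_sum _ _ _))//; apply: ler_sum => l _.
      by rewrite -scalerBr rnormZ mulrC ler_wpM2r ?rnorm_ge0// rnormBC ltW.
    rewrite (le_trans (powRD_le p1 _ _)) ?rnorm_ge0//.
      by rewrite mulr_ge0 ?(ltW d0) ?sumr_ge0// => *; exact: rnorm_ge0.
    rewrite /k; under [leRHS]eq_bigr do rewrite mulrCA mulrDr.
    rewrite -mulr_sumr ler_wpM2l ?powR_ge0// big_split/= lerD//.
    rewrite powRM ?(ltW d0) ?sumr_ge0// => [|*]; last exact: rnorm_ge0.
    rewrite -mulr_suml mulrCA ler_wpM2l ?powR_ge0// mulrC.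
    by apply: powR_sum_le => // l; exact: rnorm_ge0.
  have w0 i : 0 <= fine (mu (Y i)) by exact: fine_ge0.
  have := subquotient_matrix_bound w0 k0 Vle a hE d0.
  move=> /le_trans; apply.
  have -> : (4 * r) `^ p = 2 `^ p * (2 `^ p * r `^ p).
    by rewrite !powRM ?(ltW r0)// (_ : 4 = 2 * 2) ?powRM// ?mulrA//; lra.
  apply: (@le_trans _ _ (2 `^ p * (2 `^ p * (S + d `^ p * C)))); last first.
    by rewrite !ler_wpM2l ?powR_ge0// -lerBrDl.
  set tau := d `^ p; have tau0 : 0 <= tau by exact: powR_ge0.
  have tau1 : tau <= 1.
    rewrite (_ : 1 = 1 `^ p); last by rewrite powR1.
    by rewrite ge0_ler_powR ?nnegrE ?(ltW p0) ?(ltW d0).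
  apply: (@le_trans _ _ (\sum_l 2 `^ p * (2 `^ p * ((rnorm (a l) `^ p + tau) * (m l + tau * Np))))).
    apply: ler_sum => l _; rewrite /k mulrCA ler_wpM2l ?powR_ge0// mulrA ler_wpM2r//.
      by rewrite addr_ge0// mulr_ge0.
    by apply: powRD_le => //; [exact: rnorm_ge0|exact: ltW].
  rewrite -!mulr_sumr !ler_wpM2l ?powR_ge0//.
  under eq_bigr do rewrite mulrDl !mulrDr.
  rewrite !big_split/= -/S -addrA lerD2l -mulr_suml -mulr_sumr.
  rewrite sumr_const card_ord -mulr_natl /C.
  have h1 : N%:R * (tau * (tau * Np)) <= tau * (Np * N%:R).
    by rewrite mulrCA ler_wpM2l// mulrC ler_wpM2r// ler_piMl.
  by rewrite !mulrDr; move: h1; lra.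
have Wint l : (fun t => (b t (a l) * g t) * h l t) \in cLfun mu 1.
  by have [] := cLfun_hoelder p1 q1 pq (gbp l).1 (hp l).
rewrite (_ : \sum_l _ = cintegral mu (\sum_l (fun t => (b t (a l) * g t) * h l t))); last first.
  rewrite cintegral_sum//; apply: eq_bigr => l _.
  by rewrite /gb (Lpair_class p1 q1 pq (gbp l).1 (hp l)).
rewrite (le_trans (rnorm_cintegral _)) ?cLfun_sum//.
(* A scalar step function that dominates b_t of the vector-valued one, so that Hoelder's inequality
   finishes the estimate. *)
pose s := step Y (fun i => (B * rnorm (z i))%:C).
have sp : s \in cLfun mu p by exact: (step_cLfun mu_haar cK KY p1).
have [gs1 gsle] := cLfun_hoelder p1 q1 pq gq sp.
apply: (@le_trans _ _ (cnorm mu 1 (fun t => g t * s t))).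
  rewrite -[leRHS]mul1r; apply: (cnorm_dom (lexx 1) ler01 _ gs1 _).2.
    by apply: (cLfun_meas (mu := mu) (p := 1)); apply: cLfun_sum.
  move=> t; rewrite mul1r fct_sumE.
  have -> : \sum_l b t (a l) * g t * h l t = g t * \sum_l h l t * b t (a l).
    by rewrite mulr_sumr; apply: eq_bigr => l _; rewrite -mulrA mulrCA [h l t * _]mulrC.
  rewrite !rnormM ler_wpM2l ?rnorm_ge0//.
  have [Kt|Kt] := pselect (K t); last first.
    rewrite big1 ?rnorm0 ?rnorm_ge0// => l _.
    by rewrite /h (step_out KY)// mul0r.
  have [i [_ si]] := partition_in R KY Kt; rewrite /s si.
  under eq_bigr do rewrite /h si.
  have -> : \sum_l v l i * b t (a l) = b t (z i).
    rewrite /z; elim/big_rec2: _ => [|l y x _ IH].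
      by have := bl t (-1) 0 0; rewrite scaler0 addr0 mulN1r addNr.
    by rewrite bl IH.
  by rewrite rnorm_real ger0_norm ?mulr_ge0 ?rnorm_ge0.
rewrite (le_trans gsle)// [leRHS](_ : _ = cnorm mu q g * (B * (4 * r))); last by ring.
rewrite ler_wpM2l ?cnorm_ge0//.
have Br0 : 0 <= B * (4 * r) by rewrite !mulr_ge0 ?(ltW r0).
have := @ge0_ler_powR _ p^-1; rewrite invr_ge0 (ltW p0) => /(_ isT).
move=> /(_ (cnorm mu p s `^ p) ((B * (4 * r)) `^ p)).
rewrite !nnegrE !powR_ge0 -!powRrM mulfV ?gt_eqF// !powRr1 ?cnorm_ge0// => ->//.
rewrite (cnorm_step mu_haar cK KY p1).
under eq_bigr do rewrite rnorm_real ger0_norm ?mulr_ge0 ?rnorm_ge0// powRM ?rnorm_ge0// -mulrA.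
by rewrite -mulr_sumr powRM ?mulr_ge0 ?(ltW r0)// ler_wpM2l ?powR_ge0.
Qed.

End subquotient_pairing.

(** * Translations and convoluters *)

Section composition_operator.
Context d (T : measurableType d) (R : realType) (mu : {measure set T -> \bar R}).
Variables (phi : T -> T) (c : R).
Hypotheses (mphi : measurable_fun setT phi) (c0 : 0 <= c)
  (muphi : forall A, measurable A -> mu (phi @^-1` A) = (c%:E * mu A)%E).
Variables (p : R) (p1 : 1 <= p).

Definition comp_op (x : Lp mu p1) : Lp mu p1 := Lp_class mu p1 (x \o phi).

Let comp_in f : f \in cLfun mu p -> f \o phi \in cLfun mu p.
Proof. by move=> fp; have [] := cnorm_subst mphi c0 muphi p1 fp. Qed.

Lemma comp_op_class f : f \in cLfun mu p ->
  comp_op (Lp_class mu p1 f) = Lp_class mu p1 (f \o phi).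
Proof.
move=> fp; apply: Lp_class_ext; [exact: comp_in (Lp_cLfun _)|exact: comp_in|].
exact: (ae_subst mphi muphi (Lp_classP p1 fp)).
Qed.

Lemma comp_op_linear : linear comp_op.
Proof.
move=> a x y; rewrite -[x]Lp_classK -[y]Lp_classK; have [xp yp] := (Lp_cLfun x, Lp_cLfun y).
have axy : a *: Lp_fun x + Lp_fun y \in cLfun mu p.
  by apply: cLfunD => //; exact: cLfunZ.
rewrite -Lp_class_linear// !comp_op_class//.
by rewrite -[RHS]Lp_class_linear//; exact: comp_in.
Qed.

Lemma comp_op_norm x : rnorm (comp_op x) = c `^ p^-1 * rnorm x.
Proof.
have xp := Lp_cLfun x; have [h e] := cnorm_subst mphi c0 muphi p1 xp.
by rewrite /comp_op Lp_class_norm// e -Lp_normE.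
Qed.

End composition_operator.

Section translations.
Context (R : realType) (G : lcGroupType) (mu : {measure set (borel G) -> \bar R}).
Hypothesis mu_haar : left_haar mu.
Variables (Delta : G -> R) (hD : modular_function mu Delta).

Definition ltrans (s : G) (f : G -> R[i]) : borel G -> R[i] := fun t => f (s * t)%g.
Definition rtrans (s : G) (f : G -> R[i]) : borel G -> R[i] := fun t => f (t * s)%g.

Let D0 s : 0 <= Delta s. Proof. by apply: ltW; case: hD. Qed.

Section Lp_translations.
Variables (p : R) (p1 : 1 <= p).
Implicit Types (f : G -> R[i]) (x y : Lp mu p1).
Local Notation cl := (Lp_class mu p1).

Lemma cLfun_rtrans s f : f \in cLfun mu p -> rtrans s f \in cLfun mu p /\
  cnorm mu p (rtrans s f) = Delta (s^-1)%g `^ p^-1 * cnorm mu p f.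
Proof.
by move=> fp; apply: (cnorm_subst (measurable_mulr s) (D0 _) (modular_mulr hD s)).
Qed.

Lemma cLfun_ltrans s f : f \in cLfun mu p -> ltrans s f \in cLfun mu p /\
  cnorm mu p (ltrans s f) = cnorm mu p f.
Proof.
move=> fp; have := cnorm_subst (measurable_mull s) ler01 (haar_mull mu_haar s) p1 fp.
by rewrite powR1 mul1r.
Qed.

Lemma cintegral_rtrans s f : f \in cLfun mu 1 ->
  cintegral mu (rtrans s f) = (Delta (s^-1)%g)%:C * cintegral mu f.
Proof. exact: (cintegral_subst (measurable_mulr s) (D0 _) (modular_mulr hD s)). Qed.

Lemma cintegral_ltrans s f : f \in cLfun mu 1 ->
  cintegral mu (ltrans s f) = cintegral mu f.
Proof.
move=> f1; rewrite -[RHS]mul1r.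
exact: (cintegral_subst (measurable_mull s) ler01 (haar_mull mu_haar s)).
Qed.

(* [ltr s] is lambda_p(s^-1), and [rtr s] is rho_p(s) without the scalar
   Delta(s)^(1/p), which is irrelevant for commutation. *)
Definition rtr s x : Lp mu p1 := cl (rtrans s x).
Definition ltr s x : Lp mu p1 := cl (ltrans s x).

Lemma rtr_class s f : f \in cLfun mu p -> rtr s (cl f) = cl (rtrans s f).
Proof. exact: (comp_op_class (measurable_mulr s) (D0 _) (modular_mulr hD s)). Qed.

Lemma ltr_class s f : f \in cLfun mu p -> ltr s (cl f) = cl (ltrans s f).
Proof. exact: (comp_op_class (measurable_mull s) ler01 (haar_mull mu_haar s)). Qed.

Lemma rtr_linear s : linear (rtr s).
Proof. exact: (comp_op_linear (measurable_mulr s) (D0 _) (modular_mulr hD s)). Qed.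

Lemma ltr_linear s : linear (ltr s).
Proof. exact: (comp_op_linear (measurable_mull s) ler01 (haar_mull mu_haar s)). Qed.

Lemma ltr_norm s x : rnorm (ltr s x) = rnorm x.
Proof.
have := comp_op_norm (measurable_mull s) ler01 (haar_mull mu_haar s) x.
by rewrite powR1 mul1r.
Qed.

Lemma ltr_rtr s t x : ltr s (rtr t x) = rtr t (ltr s x).
Proof.
have xp := Lp_cLfun x.
have [h1 _] := cLfun_rtrans t xp; have [h2 _] := cLfun_ltrans s xp.
rewrite -[x]Lp_classK rtr_class// ltr_class// ltr_class// rtr_class//.
by congr cl; apply/funext => u; rewrite /rtrans /ltrans mulgA.
Qed.

End Lp_translations.

Section convolution_operators.
Variables (p p' : R) (p1 : 1 < p) (pp' : p^-1 + p'^-1 = 1).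
Local Notation LpG := (Lp mu (ltW p1)).

Lemma lambda_pE s (x : LpG) : lambda_p s x = ltr (s^-1)%g x.
Proof. by []. Qed.

Lemma rho_pE s (x : LpG) : rho_p Delta s x = (Delta s `^ p^-1)%:C *: rtr s x.
Proof.
rewrite /rtr -Lp_classZ; last by have [] := cLfun_rtrans (ltW p1) s (Lp_cLfun x).
by congr Lp_class; apply/funext => t; rewrite mulrC.
Qed.

Let Dp s : (Delta s `^ p^-1)%:C != 0 :> R[i].
Proof.
rewrite -[0]/(0%:C) (inj_eq (@complexI R)) gt_eqF// powR_gt0//.
by case: hD.
Qed.

Lemma CV_rtr (T : Bop LpG LpG) : CV mu Delta p1 T ->
  forall s (x : LpG), T (rtr s x) = rtr s (T x).
Proof.
move=> TCV s x; have := TCV s x; rewrite !rho_pE linearZ/=.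
by move=> /(scalerI (Dp s)).
Qed.

Lemma rtr_CV (T : Bop LpG LpG) : (forall s (x : LpG), T (rtr s x) = rtr s (T x)) ->
  CV mu Delta p1 T.
Proof. by move=> h s x; rewrite !rho_pE linearZ/= h. Qed.

End convolution_operators.

End translations.

(** * Continuity of translations and of the modular function *)

Section translation_continuity.
Context (R : realType) (G : lcGroupType) (mu : {measure set (borel G) -> \bar R}).
Hypothesis mu_haar : left_haar mu.

Lemma rtrans_common_support (f : G -> R[i]) (y0 : G) : Cc f ->
  exists2 K : set G, compact K & \forall y \near y0, forall t, ~ K t -> rtrans y f t = 0.
Proof.
move=> [cf [K cK fK]]; have [W Wy cW] := @lc_nbhs G y0.
exists [set (a.1 * a.2)%g | a in K `*` [set (w^-1)%g | w in W]].
  by apply: compact_mulg => //; exact: compact_invg.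
apply: filterS Wy => y Wy t nt; apply: fK => Kt; apply: nt.
exists ((t * y)%g, (y^-1)%g) => /=; last by rewrite -mulgA mulgV mulg1.
by split => //=; exists y.
Qed.

Lemma rtrans_unif (f : G -> R[i]) (y0 : G) (e : R) : Cc f -> 0 < e ->
  \forall y \near y0, forall t, rnorm (rtrans y f t - rtrans y0 f t) < e.
Proof.
move=> fc e0; have [K cK fK] := rtrans_common_support y0 fc.
apply: (@kernel_unif R G (fun y t => rtrans y f t) y0 K) => // t.
have [cf _] := fc.
apply: (@continuous_comp _ _ _ (fun z : G * G => (z.2 * z.1)%g) f); last exact: cf.
by apply: cvg_mulg; [exact: cvg_snd|exact: cvg_fst].
Qed.

Lemma rtrans_cnorm_near p (p1 : 1 <= p) (f : G -> R[i]) (y0 : G) (e : R) : Cc f -> 0 < e ->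
  \forall y \near y0, cnorm mu p (rtrans y f - rtrans y0 f) < e.
Proof.
move=> fc e0; have [K cK fK] := rtrans_common_support y0 fc.
pose k := fine (mu K) `^ p^-1; have k0 : 0 <= k by exact: powR_ge0.
have d0 : 0 < e / (k + 1) by rewrite divr_gt0// ltr_wpDl.
have fK0 := nbhs_singleton fK.
apply: filterS2 fK (rtrans_unif y0 fc d0) => y fKy fy.
have [] := @cnorm_sup R G mu p p1 K (rtrans y f - rtrans y0 f) _ (compact_borel cK)
  (haar_compact mu_haar cK) _ (ltW d0).
- apply: cmeasurableB; first exact: (continuous_cmeasurable (Cc_mulr y fc).1).
  exact: (continuous_cmeasurable (Cc_mulr y0 fc).1).
- by move=> t _; rewrite ltW//; exact: fy.
- by move=> t Kt; rewrite -[LHS]/(rtrans y f t - rtrans y0 f t) fKy// fK0// subrr.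
move=> _ /le_lt_trans; apply; rewrite -/k mulrAC ltr_pdivrMr ?ltr_wpDl//.
by rewrite ltr_pM2l// ltrDl.
Qed.

Lemma bump_exists : exists chi : G -> R, [/\ Cc (fun x => (chi x)%:C),
  forall x, 0 <= chi x & chi 1%g = 1].
Proof.
have [chi [cchi chi01 chi1 _ [L cL chiL]]] := @lc_urysohn R G [set 1%g] setT
  (@compact_set1 _ _) openT (@subsetT _ _).
exists chi; split.
- split; last by exists L => // x /chiL ->.
  move=> x; apply/cvg_rnormP => d d0.
  have : \forall t \near x, `|chi x - chi t| < d.
    by have /cvgrPdist_lt := cchi x; apply.
  by apply: filterS => t; rewrite -rmorphB/= rnorm_real.
- by move=> x; have /andP[] := chi01 x.
- exact: chi1.
Qed.

Lemma Cc_integral_gt0 (f : G -> R) (x : G) : Cc (fun x => (f x)%:C) ->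
  (forall x, 0 <= f x) -> 0 < f x ->
  exists2 c : R, 0 < c & cintegral mu (fun x => (f x)%:C) = c%:C.
Proof.
move=> fc f0 fx; have f1 := Cc_cLfun mu_haar (lexx 1) fc.
exists (Rintegral mu setT f); last first.
  rewrite /cintegral/=; apply/eqP; rewrite eq_complex/= eqxx/=.
  by rewrite /Rintegral integral0.
have cf : continuous f.
  move=> y; have [cfc _] := fc; apply/cvgrPdist_lt => e e0.
  have /cvg_rnormP/(_ _ e0) := cfc y.
  by apply: filterS => t; rewrite -rmorphB/= rnorm_real.
have mf := continuous_borel cf.
pose U := [set t | f x / 2 < f t].
have oU : open U.
  by apply: (@open_comp _ _ f [set r | f x / 2 < r]) => [t _|]; [exact: cf|exact: open_gt].
have U0 : (0 < mu U)%E.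
  by apply: haar_open_pos => //; exists x; rewrite /U /= ltr_pdivrMr// ltr_pMr// ltr1n.
have mU := open_borel oU.
rewrite /Rintegral fine_gt0//; apply/andP; split; last first.
  have /cL1P[_] := f1; apply: le_lt_trans; apply: ge0_le_integral => //.
  - by move=> t _; rewrite lee_fin.
  - exact/measurable_EFinP.
  - by apply/measurable_EFinP; apply: cmeasurable_rnorm; exact: cLfun_meas f1.
  - by move=> t _; rewrite lee_fin rnorm_real ler_norm.
apply: (@lt_le_trans _ _ ((f x / 2)%:E * mu U)%E).
  by rewrite mule_gt0// lte_fin divr_gt0.
rewrite -[X in mu X]setIT -integral_indic// -ge0_integralZl//; last 2 first.
- by apply/measurable_EFinP; exact: measurable_indic.
- by rewrite lee_fin divr_ge0// ltW.
apply: ge0_le_integral => //.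
- by move=> t _; rewrite -EFinM lee_fin mulr_ge0// divr_ge0// ltW.
- by apply: measurable_funeM; apply/measurable_EFinP; exact: measurable_indic.
- exact/measurable_EFinP.
- move=> t _; rewrite -EFinM lee_fin indicE; case: (boolP (_ \in _)).
    by rewrite inE/= mulr1 => /ltW.
  by rewrite mulr0.
Qed.

Variables (Delta : G -> R) (hD : modular_function mu Delta).

(** For a bump function chi with integral c, [Delta y] times c is the integral of the right
    translate of chi by y^-1, and translates of chi depend continuously on y in L_1. *)
Lemma modular_continuous : continuous Delta.
Proof.
move=> y0; have [chi [chic chi0 chi1]] := bump_exists.
have [c c0 cE] := @Cc_integral_gt0 chi 1%g chic chi0 (eq_ind_r (fun z => 0 < z) ltr01 chi1).
have chi_in := Cc_cLfun mu_haar (lexx 1) chic.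
have E y : cintegral mu (rtrans (y^-1)%g (fun x => (chi x)%:C)) = (Delta y * c)%:C.
  by rewrite (cintegral_rtrans hD)// invgK cE rmorphM.
apply/cvgrPdist_lt => e e0.
have h := rtrans_cnorm_near (lexx 1) (y0^-1)%g chic (mulr_gt0 e0 c0).
have : \forall y \near y0, cnorm mu 1 (rtrans (y^-1)%g (fun x => (chi x)%:C)
    - rtrans (y0^-1)%g (fun x => (chi x)%:C)) < e * c.
  exact: (@lcg_inv_continuous G y0 _ h).
apply: filterS => y lt.
have in1 s : rtrans s (fun x => (chi x)%:C) \in cLfun mu 1.
  by have [] := cLfun_rtrans hD (lexx 1) s chi_in.
have := rnorm_cintegral (cLfun_sub (lexx 1) (in1 (y^-1)%g) (in1 (y0^-1)%g)).
rewrite cintegralB// !E -rmorphB/= rnorm_real -mulrBl normrM (gtr0_norm c0) distrC.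
by move=> /le_lt_trans /(_ lt); rewrite ltr_pM2r.
Qed.

(* The factor [Delta y^-1] makes the integral independent of [z]. *)
Lemma weight_exists : exists h : G -> R, [/\ Cc (fun x => (h x)%:C), forall x, 0 <= h x &
  forall z, cintegral mu (fun y => (Delta (y^-1)%g * h (z * y^-1)%g)%:C) = 1].
Proof.
have [chi [[cchi [K cK chiK]] chi0 chi1]] := bump_exists.
pose F (y : G) := Delta (y^-1)%g * chi (y^-1)%g.
have D0 x : 0 < Delta x by case: hD.
have cinv : continuous (fun x : G => (x^-1)%g) := @lcg_inv_continuous G.
have cD : continuous (fun x => (Delta x)%:C : R[i]).
  move=> x; apply/cvg_rnormP => d d0.
  have : \forall t \near x, `|Delta x - Delta t| < d.
    by have /cvgrPdist_lt := modular_continuous (x := x); apply.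
  by apply: filterS => t; rewrite -rmorphB/= rnorm_real.
have ic : Cc (fun y => (chi (y^-1)%g)%:C : R[i]).
  split; first by move=> y; exact: (continuous_comp (cinv y) (cchi _)).
  exists [set (x^-1)%g | x in K]; first exact: compact_invg.
  move=> y Ky; apply: chiK => Ky'; apply: Ky.
  by exists (y^-1)%g => //; rewrite invgK.
have Fc : Cc (fun y => (F y)%:C).
  rewrite (_ : (fun y => _) = (fun y => (Delta (y^-1)%g)%:C * (chi (y^-1)%g)%:C)).
    by apply: CcMl ic _ => y; exact: (continuous_comp (cinv y) (cD _)).
  by apply/funext => ?; rewrite rmorphM.
have F1 : 0 < F 1%g by rewrite /F invg1 chi1 mulr1.
have F0 x : 0 <= F x by rewrite mulr_ge0// ltW.
have [c c0 cE] := Cc_integral_gt0 Fc F0 F1.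
have c0' : c%:C != 0 :> R[i] by rewrite -[0]/(0%:C) (inj_eq (@complexI R)) gt_eqF.
exists (fun x => chi x / c); split.
- rewrite (_ : (fun x => _) = c^-1%:C *: (fun x => (chi x)%:C : R[i])).
    by apply: CcZ; split => //; exists K.
  by apply/funext => x; rewrite mulrC rmorphM.
- by move=> x; rewrite divr_ge0// ltW.
(* The integrand equals Delta(z)^-1 F(y z^-1) / c by multiplicativity of [Delta], and undoing the
   right translation of F contributes Delta(z), which cancels. *)
- move=> z; pose k : R[i] := (Delta (z^-1)%g)%:C / c%:C.
  rewrite (_ : (fun y => _) = k *: rtrans (z^-1)%g (fun y => (F y)%:C)); last first.
    apply/funext => y; rewrite -[RHS]/(k * (F (y * z^-1)%g)%:C) /k /F invgM invgK.
    rewrite (modularM mu_haar hD) (modularV mu_haar hD z) !rmorphM/= fmorphV/=.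
    have Dz : (Delta z)%:C != 0 :> R[i] by rewrite -[0]/(0%:C) (inj_eq (@complexI R)) gt_eqF.
    by field; rewrite c0' Dz.
  have Fin := Cc_cLfun mu_haar (lexx 1) Fc.
  rewrite cintegralZ; last by have [] := cLfun_rtrans hD (lexx 1) (z^-1)%g Fin.
  rewrite (cintegral_rtrans hD)// cE invgK /k (modularV mu_haar hD z) fmorphV/=.
  have Dz : (Delta z)%:C != 0 :> R[i] by rewrite -[0]/(0%:C) (inj_eq (@complexI R)) gt_eqF.
  by field; rewrite c0' Dz.
Qed.

End translation_continuity.

Section bilinear_forms.
Context (R : realType) (X Y : normedModType R[i]) (B : X -> Y -> R[i]).
Hypothesis hB : bilinear_form B.

Lemma bilinearDl x x' y : B (x + x') y = B x y + B x' y.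
Proof. by have := hB.1 y 1 x x'; rewrite /= scale1r mul1r. Qed.

Lemma bilinearDr x y y' : B x (y + y') = B x y + B x y'.
Proof. by have := hB.2 x 1 y y'; rewrite /= scale1r mul1r. Qed.

Lemma bilinear0l y : B 0 y = 0.
Proof. by apply: (addIr (B 0 y)); rewrite -bilinearDl !add0r. Qed.

Lemma bilinear0r x : B x 0 = 0.
Proof. by apply: (addIr (B x 0)); rewrite -bilinearDr !add0r. Qed.

Lemma bilinearZl a x y : B (a *: x) y = a * B x y.
Proof. by have := hB.1 y a x 0; rewrite /= !addr0 bilinear0l addr0. Qed.

Lemma bilinearZr a x y : B x (a *: y) = a * B x y.
Proof. by have := hB.2 x a y 0; rewrite /= !addr0 bilinear0r addr0. Qed.

Lemma bilinearBl x x' y : B (x - x') y = B x y - B x' y.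
Proof. by rewrite -scaleN1r bilinearDl bilinearZl mulN1r. Qed.

Lemma bilinearBr x y y' : B x (y - y') = B x y - B x y'.
Proof. by rewrite -scaleN1r bilinearDr bilinearZr mulN1r. Qed.

Lemma bilinear_suml I (s : seq I) (F : I -> X) y :
  B (\sum_(i <- s) F i) y = \sum_(i <- s) B (F i) y.
Proof.
elim: s => [|i s ih]; first by rewrite !big_nil bilinear0l.
by rewrite !big_cons bilinearDl ih.
Qed.

Lemma bilinear_sumr I (s : seq I) x (F : I -> Y) :
  B x (\sum_(i <- s) F i) = \sum_(i <- s) B x (F i).
Proof.
elim: s => [|i s ih]; first by rewrite !big_nil bilinear0r.
by rewrite !big_cons bilinearDr ih.
Qed.

End bilinear_forms.

Definition bounded_by (R : realType) (T : Type) (phi : T -> R[i]) (M : R) :=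
  forall s, rnorm (phi s) <= M.

(** * The forms b_phi *)

Section smoothed_form.
Context (R : realType) (G : lcGroupType) (mu : {measure set (borel G) -> \bar R}).
Hypothesis mu_haar : left_haar mu.
Variables (Delta : G -> R) (hD : modular_function mu Delta).
Variables (p p' : R) (p1 : 1 < p) (pp' : p^-1 + p'^-1 = 1).
Local Notation P := (ltW p1).
Local Notation Q := (ltW (conj_gt1 p1 pp')).
Local Notation LpG := (Lp mu P).
Local Notation LqG := (Lp mu Q).
Local Notation clp := (Lp_class mu P).
Local Notation clq := (Lp_class mu Q).
Local Notation pair := (@Lpair _ _ _ mu p p' P Q).
Local Notation Lpb := (@Lpair_bilinear _ _ _ mu p p' P Q pp').
Variables (h : G -> R) (hc : Cc (fun x => (h x)%:C)).

(* [smooth_form S phi g f] is b_phi(g, f) with [S] in place of [T], and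
   [smooth_int S phi g f] is its integrand. *)
Definition twist y (f : G -> R[i]) : borel G -> R[i] := fun z => (h z)%:C * rtrans y f z.

Implicit Types (S T : Bop LpG LpG) (phi psi : borel G -> R[i]) (f g : G -> R[i]).

Definition smooth_int S phi g f (y : G) : R[i] :=
  pair (clq (fun s => phi s * rtrans y g s)) (S (clp (twist y f))).

Definition smooth_form S phi g f : R[i] :=
  cintegral mu (smooth_int S phi g f : borel G -> R[i]).

Let Cq g : Cc g -> g \in cLfun mu p'. Proof. exact: (Cc_cLfun mu_haar Q). Qed.
Let Cp f : Cc f -> f \in cLfun mu p. Proof. exact: (Cc_cLfun mu_haar P). Qed.

Lemma rtrans_in q (q1 : 1 <= q) y f : Cc f -> rtrans y f \in cLfun mu q.
Proof. by move=> fc; apply: (Cc_cLfun mu_haar q1); exact: Cc_mulr. Qed.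

Lemma phi_in q (q1 : 1 <= q) phi M g : cmeasurable phi -> bounded_by phi M ->
  g \in cLfun mu q -> (fun s => phi s * g s) \in cLfun mu q /\
  cnorm mu q (fun s => phi s * g s) <= M * cnorm mu q g.
Proof. by move=> mphi phiM gq; exact: cLfunMb. Qed.

Lemma twist_Cc y f : Cc f -> Cc (twist y f).
Proof.
move=> fc; have [ch _] := hc; have := CcMl (Cc_mulr y fc) ch.
by [].
Qed.

(** The purpose of h. A nonzero f has nonzero translates for every y, but h f_y vanishes as soon as
    y is outside the compact set supp(h)^-1 supp(f). *)
Lemma twist_support f : Cc f -> exists2 L : set G, compact L &
  forall y, ~ L y -> twist y f = 0.
Proof.
move=> [cf [K cK fK]]; have [_ [H cH hH]] := hc.
exists [set (a.1 * a.2)%g | a in [set (x^-1)%g | x in H] `*` K].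
  by apply: compact_mulg => //; exact: compact_invg.
move=> y Ly; apply/funext => z; rewrite /twist /rtrans.
have [Hz|/hH ->] := pselect (H z); last by rewrite mul0r.
have [Kz|/fK ->] := pselect (K (z * y)%g); last by rewrite mulr0.
exfalso; apply: Ly; exists ((z^-1)%g, (z * y)%g) => /=.
  by split => //=; exists z.
by rewrite mulgA mulVg mul1g.
Qed.

Lemma smooth_int0 S phi g f y : twist y f = 0 -> smooth_int S phi g f y = 0.
Proof. by move=> f0; rewrite /smooth_int f0 Lp_class0 linear0 (bilinear0r Lpb). Qed.

(** The neighbourhood of y0 is chosen before S, phi and M. Hence one Riemann sum serves all phi
    simultaneously, as the approximation by L_1 functionals demands. *)
Lemma smooth_int_near g f y0 (e : R) : Cc g -> Cc f -> 0 < e ->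
  \forall y \near y0, forall S phi M, cmeasurable phi -> bounded_by phi M ->
  rnorm (smooth_int S phi g f y - smooth_int S phi g f y0) <= e * M * opnorm S.
Proof.
move=> gc fc e0; have [H H0 hH] := Cc_bounded hc; have [ch _] := hc.
have mh := continuous_cmeasurable ch.
pose A := cnorm mu p (rtrans y0 f); pose B := cnorm mu p' (rtrans y0 g).
have A0 : 0 <= A by exact: cnorm_ge0.
have B0 : 0 <= B by exact: cnorm_ge0.
(* A + 1 bounds the norm of the translate of f at the neighbouring point y, because d is at most
   1. *)
pose C := H * (A + 1 + B); have C0 : 0 <= C by rewrite mulr_ge0// !addr_ge0.
pose d := Num.min 1 (e / (C + 1)).
have d0 : 0 < d by rewrite lt_min ltr01 divr_gt0// ltr_wpDl.
have d1 : d <= 1 by rewrite ge_min lexx.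
have dC : d * C <= e.
  have : d <= e / (C + 1) by rewrite ge_min lexx orbT.
  move=> /(ler_wpM2r C0)/le_trans; apply.
  by rewrite mulrAC ler_pdivrMr ?ltr_wpDl// ler_wpM2l ?(ltW e0)// lerDl.
apply: filterS2 (rtrans_cnorm_near mu_haar P y0 fc d0) (rtrans_cnorm_near mu_haar Q y0 gc d0).
move=> y fd gd S phi M mphi phiM; have M0 : 0 <= M by exact: le_trans (rnorm_ge0 _) (phiM point).
have fy := rtrans_in P y fc; have fy0 := rtrans_in P y0 fc.
have gy := rtrans_in Q y gc; have gy0 := rtrans_in Q y0 gc.
have phiq k := phi_in Q mphi phiM (g := k).
have hp k (kp : k \in cLfun mu p) : (fun z => (h z)%:C * k z) \in cLfun mu p /\
    cnorm mu p (fun z => (h z)%:C * k z) <= H * cnorm mu p k by exact: (phi_in P mh hH kp).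
rewrite /smooth_int; set u := clq (fun s => phi s * rtrans y g s).
set u0 := clq (fun s => phi s * rtrans y0 g s).
set v := clp (twist y f); set v0 := clp (twist y0 f).
have -> : pair u (S v) - pair u0 (S v0) = pair (u - u0) (S v) + pair u0 (S (v - v0)).
  by rewrite (bilinearBl Lpb) raddfB (bilinearBr Lpb) subrKA.
have uu : rnorm (u - u0) <= M * d.
  rewrite -Lp_classB; [|by case: (phiq _ gy)|by case: (phiq _ gy0)].
  have [pq1 pq2] := phiq _ (cLfun_sub Q gy gy0).
  rewrite (_ : _ - _ = (fun s => phi s * (rtrans y g - rtrans y0 g) s)); last first.
    by apply/funext => s; rewrite -[LHS]/(phi s * rtrans y g s - phi s * rtrans y0 g s) -mulrBr.
  by rewrite Lp_class_norm// (le_trans pq2)// ler_wpM2l// ltW.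
have vv : rnorm (v - v0) <= H * d.
  rewrite -Lp_classB; [|by case: (hp _ fy)|by case: (hp _ fy0)].
  have [pq1 pq2] := hp _ (cLfun_sub P fy fy0).
  rewrite (_ : _ - _ = (fun s => (h s)%:C * (rtrans y f - rtrans y0 f) s)); last first.
    by apply/funext => s; rewrite -[LHS]/((h s)%:C * rtrans y f s - (h s)%:C * rtrans y0 f s) -mulrBr.
  by rewrite Lp_class_norm// (le_trans pq2)// ler_wpM2l// ltW.
have u0n : rnorm u0 <= M * B.
  by have [pq1 pq2] := phiq _ gy0; rewrite Lp_class_norm.
have vn : rnorm v <= H * (A + 1).
  have [pq1 pq2] := hp _ fy; rewrite Lp_class_norm// (le_trans pq2)// ler_wpM2l//.
  rewrite -[rtrans y f](subrK (rtrans y0 f)) addrC.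
  rewrite (le_trans (cnormD P fy0 (cLfun_sub P fy fy0)))//.
  by rewrite lerD2l (le_trans (ltW fd)).
have S0 := opnorm_ge0 S.
rewrite (le_trans (ler_rnormD _ _))//.
apply: (@le_trans _ _ (M * d * (opnorm S * (H * (A + 1))) + M * B * (opnorm S * (H * d)))).
  apply: lerD.
    rewrite (le_trans (Lpair_bound pp' _ _))// ler_pM ?rnorm_ge0//.
    by rewrite (le_trans (opnormP _ _))// ler_wpM2l.
  rewrite (le_trans (Lpair_bound pp' _ _))// ler_pM ?rnorm_ge0//.
  by rewrite (le_trans (opnormP _ _))// ler_wpM2l.
rewrite [leLHS](_ : _ = d * C * M * opnorm S); last by rewrite /C; ring.
by rewrite !ler_wpM2r.
Qed.

Lemma smooth_int_Cc S phi M g f : cmeasurable phi -> bounded_by phi M -> Cc g -> Cc f ->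
  Cc (smooth_int S phi g f).
Proof.
move=> mphi phiM gc fc; have M0 : 0 <= M by exact: le_trans (rnorm_ge0 _) (phiM point).
have [L cL fL] := twist_support fc.
split; last by exists L => // y /fL; exact: smooth_int0.
move=> y0; apply/cvg_rnormP => e e0.
pose k := M * opnorm S; have k0 : 0 <= k by rewrite mulr_ge0// opnorm_ge0.
have d0 : 0 < e / (k + 1) by rewrite divr_gt0// ltr_wpDl.
have k1 : 0 < k + 1 by rewrite ltr_wpDl.
have hlt : e / (k + 1) * M * opnorm S < e.
  by rewrite -mulrA -/k mulrAC ltr_pdivrMr// ltr_pM2l// ltrDl.
have := smooth_int_near y0 gc fc d0; apply: filterS => y /(_ S phi M mphi phiM) le.
apply: le_lt_trans hlt; move: le.
by move: (smooth_int _ _ _ _ y) (smooth_int _ _ _ _ y0) => a b; rewrite (rnormBC a b).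
Qed.

Lemma smooth_int_in S phi M g f : cmeasurable phi -> bounded_by phi M -> Cc g -> Cc f ->
  (smooth_int S phi g f : borel G -> R[i]) \in cLfun mu 1.
Proof. by move=> *; apply: (Cc_cLfun mu_haar (lexx 1)); exact: smooth_int_Cc. Qed.

Lemma smooth_form_linear_phi S a phi psi M M' g f : cmeasurable phi -> bounded_by phi M ->
  cmeasurable psi -> bounded_by psi M' -> Cc g -> Cc f ->
  smooth_form S (a *: phi + psi) g f = a * smooth_form S phi g f + smooth_form S psi g f.
Proof.
move=> mphi phiM mpsi psiM gc fc.
have i1 := smooth_int_in S mphi phiM gc fc; have i2 := smooth_int_in S mpsi psiM gc fc.
rewrite /smooth_form -(cintegralZ a i1) -(cintegralD (cLfunZ (lexx 1) a i1) i2); congr cintegral.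
apply/funext => y; rewrite -[RHS]/(a * smooth_int S phi g f y + smooth_int S psi g f y).
rewrite /smooth_int -(bilinearZl Lpb) -(bilinearDl Lpb).
have gy := rtrans_in Q y gc.
have [h1 _] := phi_in Q mphi phiM gy; have [h2 _] := phi_in Q mpsi psiM gy.
congr (pair _ _); apply: etrans (Lp_class_linear Q a h1 h2); congr clq; apply/funext => s.
by rewrite -[RHS]/(a * (phi s * rtrans y g s) + psi s * rtrans y g s) mulrA -mulrDl.
Qed.

Lemma smooth_form_linear_g S phi M a g g' f : cmeasurable phi -> bounded_by phi M ->
  Cc g -> Cc g' -> Cc f ->
  smooth_form S phi (a *: g + g') f = a * smooth_form S phi g f + smooth_form S phi g' f.
Proof.
move=> mphi phiM gc gc' fc.
have i1 := smooth_int_in S mphi phiM gc fc; have i2 := smooth_int_in S mphi phiM gc' fc.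
rewrite /smooth_form -(cintegralZ a i1) -(cintegralD (cLfunZ (lexx 1) a i1) i2); congr cintegral.
apply/funext => y; rewrite -[RHS]/(a * smooth_int S phi g f y + smooth_int S phi g' f y).
rewrite /smooth_int -(bilinearZl Lpb) -(bilinearDl Lpb).
have [h1 _] := phi_in Q mphi phiM (rtrans_in Q y gc).
have [h2 _] := phi_in Q mphi phiM (rtrans_in Q y gc').
congr (pair _ _); apply: etrans (Lp_class_linear Q a h1 h2); congr clq; apply/funext => s.
rewrite -[RHS]/(a * (phi s * rtrans y g s) + phi s * rtrans y g' s).
by rewrite mulrCA -mulrDr.
Qed.

Lemma smooth_form_linear_f S phi M a g f f' : cmeasurable phi -> bounded_by phi M ->
  Cc g -> Cc f -> Cc f' ->
  smooth_form S phi g (a *: f + f') = a * smooth_form S phi g f + smooth_form S phi g f'.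
Proof.
move=> mphi phiM gc fc fc'.
have i1 := smooth_int_in S mphi phiM gc fc; have i2 := smooth_int_in S mphi phiM gc fc'.
rewrite /smooth_form -(cintegralZ a i1) -(cintegralD (cLfunZ (lexx 1) a i1) i2); congr cintegral.
apply/funext => y; rewrite -[RHS]/(a * smooth_int S phi g f y + smooth_int S phi g f' y).
rewrite /smooth_int -(bilinearZr Lpb) -(bilinearDr Lpb) -linearP; congr (pair _ (S _)).
apply: etrans (Lp_class_linear P a (Cp (twist_Cc y fc)) (Cp (twist_Cc y fc'))).
congr clp; apply/funext => s; rewrite -[RHS]/(a * ((h s)%:C * rtrans y f s) + (h s)%:C * rtrans y f' s).
by rewrite mulrCA -mulrDr.
Qed.

(** Pieces and sample points are again independent of S and phi. The parameter [N] lets a caller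
    impose a further smallness condition on the same partition. *)
Lemma smooth_form_riemann g f (L : set G) (N : G -> set G) (e : R) : Cc g -> Cc f ->
  compact L -> (forall y, ~ L y -> twist y f = 0) -> 0 < e ->
  (forall y, nbhs y (N y)) ->
  exists n (Y : 'I_n -> set (borel G)) (c : 'I_n -> G),
  [/\ partition_of L Y, forall i, Y i `<=` N (c i) &
      forall S phi M, cmeasurable phi -> bounded_by phi M ->
      rnorm (smooth_form S phi g f - \sum_i (fine (mu (Y i)))%:C * smooth_int S phi g f (c i))
        <= e * M * opnorm S].
Proof.
move=> gc fc cL fL e0 nN.
pose m := fine (mu L); have m0 : 0 <= m by exact: fine_ge0.
have d0 : 0 < e / (m + 1) by rewrite divr_gt0// ltr_wpDl.
have [n [Y [c [mY YL cL' YN hY]]]] := compact_partition cL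
  (fun y _ => filterI (nN y) (smooth_int_near y gc fc d0)).
have LY : partition_of L Y by split.
exists n, Y, c; split => // [i y /YN[]//|S phi M mphi phiM].
have M0 : 0 <= M by exact: le_trans (rnorm_ge0 _) (phiM point).
have MS0 : 0 <= M * opnorm S by rewrite mulr_ge0// opnorm_ge0.
have [cP _] := smooth_int_Cc S mphi phiM gc fc.
have le0 : 0 <= e / (m + 1) * M * opnorm S by rewrite -mulrA mulr_ge0// ltW.
have := riemann mu_haar cL LY le0 (continuous_cmeasurable cP)
  (fun y Ly => smooth_int0 S phi g (fL y Ly))
  (v := fun i => smooth_int S phi g f (c i)).
move=> /(_ (fun i y Yy => (YN i y Yy).2 S phi M mphi phiM))/le_trans; apply.
rewrite -/m [leLHS](_ : _ = e * (M * opnorm S) * (m / (m + 1))); last by ring.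
rewrite -[leRHS](mulrA e M).
have X0 : 0 <= e * (M * opnorm S) by rewrite mulr_ge0// ltW.
rewrite ler_piMr//.
by rewrite ler_pdivrMr ?ltr_wpDl// mul1r lerDl.
Qed.

End smoothed_form.

(** * The forms b_phi when T commutes with right translations *)

Section smoothed_form_CV.
Context (R : realType) (G : lcGroupType) (mu : {measure set (borel G) -> \bar R}).
Hypothesis mu_haar : left_haar mu.
Variables (Delta : G -> R) (hD : modular_function mu Delta).
Variables (p p' : R) (p1 : 1 < p) (pp' : p^-1 + p'^-1 = 1).
Local Notation P := (ltW p1).
Local Notation Q := (ltW (conj_gt1 p1 pp')).
Local Notation LpG := (Lp mu P).
Local Notation LqG := (Lp mu Q).
Local Notation clp := (Lp_class mu P).
Local Notation clq := (Lp_class mu Q).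
Local Notation pair := (@Lpair _ _ _ mu p p' P Q).
Local Notation Lpb := (@Lpair_bilinear _ _ _ mu p p' P Q pp').
Variables (h : G -> R) (hc : Cc (fun x => (h x)%:C)) (h0 : forall x, 0 <= h x).
Hypothesis h1 : forall z,
  cintegral mu (fun y => (Delta (y^-1)%g * h (z * y^-1)%g)%:C) = 1.
Variables (T : Bop LpG LpG) (hT : forall s (x : LpG), T (rtr s x) = rtr s (T x)).
Local Notation smooth_int := (smooth_int pp' h).
Local Notation smooth_form := (smooth_form pp' h).
Implicit Types (phi psi : borel G -> R[i]) (f g : G -> R[i]).

Let Cq g : Cc g -> g \in cLfun mu p'. Proof. exact: (Cc_cLfun mu_haar Q). Qed.
Let Cp f : Cc f -> f \in cLfun mu p. Proof. exact: (Cc_cLfun mu_haar P). Qed.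

Let ctrans y : Cc (fun z => (h (z * y^-1)%g)%:C : R[i]).
Proof. exact: (Cc_mulr (y^-1)%g hc). Qed.

(* As [T] commutes with right translations, the translation by [y] can be moved
   from [g] and [f] to [phi] and [h]. *)
Lemma smooth_int_CV phi M g f y : cmeasurable phi -> bounded_by phi M -> Cc g -> Cc f ->
  smooth_int T phi g f y = (Delta (y^-1)%g)%:C *
    pair (clq (fun t => rtrans (y^-1)%g phi t * g t))
         (T (clp (fun z => (h (z * y^-1)%g)%:C * f z))).
Proof.
move=> mphi phiM gc fc; pose F z := (h (z * y^-1)%g)%:C * f z.
have Fc : Cc F by have [ch _] := ctrans y; exact: CcMl.
have Fp := Cp Fc; rewrite -/F.
have tF : clp (twist h y f) = rtr y (clp F).
  rewrite (rtr_class hD P y Fp); congr clp; apply/funext => z.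
  by rewrite /twist /rtrans /F -mulgA mulgV mulg1.
have mphi' : cmeasurable (rtrans (y^-1)%g phi).
  exact: (cmeasurable_subst (measurable_mulr _)).
have gy := rtrans_in mu_haar Q y gc.
have [phig _] := phi_in Q mphi phiM gy.
have [phig' _] := phi_in Q mphi' (fun t => phiM (t * y^-1)%g) (Cq gc).
pose W t := (rtrans (y^-1)%g phi t * g t) * Lp_fun (T (clp F)) t.
have [W1 _] := cLfun_hoelder P Q pp' phig' (Lp_cLfun (T (clp F))).
rewrite /smooth_int tF hT (Lpair_classl Q pp' _ phig').
rewrite -(cintegral_rtrans hD y W1).
have [xin _] := cLfun_rtrans hD P y (Lp_cLfun (T (clp F))).
rewrite /rtr (Lpair_class P Q pp' phig xin); congr cintegral; apply/funext => t.
by rewrite /rtrans -mulgA mulgV mulg1.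
Qed.

(** With the translation moved onto phi and h, a Riemann sum in y yields nonnegative weights [w j]
    that approximate the constant 1, the integral of the moved h. The defect carries the factor
    |f(z)| because the partition covers only those y that occur for z in the support of f. *)
Lemma smooth_form_discretize g f (e : R) : Cc g -> Cc f -> 0 < e ->
  exists n (c : 'I_n -> G) (w : 'I_n -> G -> R),
  [/\ forall j, continuous (fun z => (w j z)%:C : R[i]), forall j z, 0 <= w j z,
      forall z, rnorm (f z) * `|\sum_j w j z - 1| <= e &
      forall phi M, cmeasurable phi -> bounded_by phi M ->
      rnorm (smooth_form T phi g f - \sum_j
        pair (clq (fun t => rtrans ((c j)^-1)%g phi t * g t))
             (T (clp (fun z => (w j z)%:C * f z)))) <= e * M * opnorm T].
Proof.
move=> gc fc e0; have [L cL fL] := twist_support hc fc.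
pose m := fine (mu L); have m0 : 0 <= m by exact: fine_ge0.
have d0 : 0 < e / (m + 1) by rewrite divr_gt0// ltr_wpDl.
pose k y z : R[i] := (Delta (y^-1)%g * h (z * y^-1)%g)%:C.
pose F y z := f z * k y z.
have [cf [K cK fK]] := fc; have [ch _] := hc.
have cD : continuous (fun x => (Delta x)%:C : R[i]).
  move=> x; apply/cvg_rnormP => d dd0.
  have : \forall t \near x, `|Delta x - Delta t| < d.
    by have /cvgrPdist_lt := modular_continuous mu_haar hD (x := x); apply.
  by apply: filterS => t; rewrite -rmorphB/= rnorm_real.
have ck : continuous (fun yz : G * G => k yz.1 yz.2).
  move=> yz; rewrite /k (_ : (fun _ => _) = (fun yz : G * G =>
      (Delta (yz.1^-1)%g)%:C * (h (yz.2 * yz.1^-1)%g)%:C)); last first.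
    by apply/funext => ?; rewrite rmorphM.
  apply: (@continuousM _ _ (fun yz : G * G => (Delta (yz.1^-1)%g)%:C : R[i])
    (fun yz : G * G => (h (yz.2 * yz.1^-1)%g)%:C)).
    apply: (@continuous_comp _ _ _ (fun z : G * G => (z.1^-1)%g) (fun x => (Delta x)%:C : R[i])).
      by apply: cvg_invg; exact: cvg_fst.
    exact: cD.
  apply: (@continuous_comp _ _ _ (fun z : G * G => (z.2 * z.1^-1)%g) (fun x => (h x)%:C : R[i])).
    by apply: cvg_mulg; [exact: cvg_snd|apply: cvg_invg; exact: cvg_fst].
  exact: ch.
have cF y0 z : {for (y0, z), continuous (fun yz => F yz.1 yz.2)}.
  apply: (@continuousM _ _ (fun yz : G * G => f yz.2) (fun yz : G * G => k yz.1 yz.2)).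
    apply: (@continuous_comp _ _ _ (fun z : G * G => z.2) f); last exact: cf.
    exact: cvg_snd.
  exact: ck.
(* The extra condition on the partition: the same sample points must also compute the integral of
   the weights, uniformly in z. *)
pose N y0 := [set y | forall z, rnorm (F y z - F y0 z) < e / (m + 1)].
have nN y : nbhs y (N y).
  apply: (kernel_unif cK _ (cF y) d0); apply: nearW => y' z Kz.
  by rewrite /F (fK _ Kz) mul0r.
have [n [Y [c [LY YN Sle]]]] := smooth_form_riemann mu_haar p1 pp' hc gc fc cL fL e0 nN.
(* The j-th term of the Riemann sum for the integral of Delta(y^-1) h(z y^-1). *)
pose w j z := fine (mu (Y j)) * (Delta ((c j)^-1)%g * h (z * (c j)^-1)%g).
have D0 s : 0 <= Delta s by apply: ltW; case: hD.
exists n, c, w; split.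
- move=> j z; have := CcZ (fine (mu (Y j)) * Delta ((c j)^-1)%g)%:C (ctrans (c j)).
  rewrite (_ : _ *: _ = (fun z => (w j z)%:C)); first by move=> [cw _]; exact: cw.
  apply/funext => t; rewrite /w mulrA [RHS]rmorphM.
  by [].
- by move=> j z; rewrite !mulr_ge0// fine_ge0.
- move=> z; have [_ [H cH hH]] := hc.
  have kc : Cc (k ^~ z).
    split.
      move=> y; apply: (@continuous_comp _ _ _ (fun y => (y, z)) (fun yz : G * G => k yz.1 yz.2)).
        by apply: cvg_pair; [exact: cvg_id|exact: cvg_cst].
      exact: ck.
    exists [set (a.1 * a.2)%g | a in [set (x^-1)%g | x in H] `*` [set z]].
      by apply: compact_mulg; [exact: compact_invg|exact: compact_set1].
    move=> y Hy; rewrite /k rmorphM/= [(h _)%:C]hH ?mulr0// => Hzy; apply: Hy.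
    exists (((z * y^-1)^-1)%g, z) => /=; last by rewrite invgM invgK -mulgA mulVg mulg1.
    by split => //; exists (z * y^-1)%g.
  have k1 := Cc_cLfun mu_haar (lexx 1) kc.
  have FzE : (F ^~ z) = f z *: (k ^~ z) by [].
  have F1 : cintegral mu (F ^~ z) = f z by rewrite FzE (cintegralZ (f z) k1) h1 mulr1.
  have Fz0 y : ~ L y -> F y z = 0.
    move=> /fL /(congr1 (fun u : borel G -> R[i] => u (z * y^-1)%g)).
    rewrite /twist /rtrans -mulgA mulVg mulg1 => hf.
    by rewrite /F /k rmorphM/= mulrCA [f z * _]mulrC hf mulr0.
  have mFz : cmeasurable (F ^~ z : borel G -> R[i]).
    by apply: continuous_cmeasurable; rewrite FzE; have [] := CcZ (f z) kc.
  have := riemann mu_haar cL LY (ltW d0) mFz Fz0 (v := fun i => F (c i) z).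
  move=> /(_ (fun i y Yy => ltW (YN i y Yy z))); rewrite F1 -/m => le.
  have Ew : \sum_i (fine (mu (Y i)))%:C * F (c i) z = f z * (\sum_i w i z)%:C.
    rewrite rmorph_sum mulr_sumr; apply: eq_bigr => i _.
    by rewrite /F /k /w [in RHS]rmorphM/= mulrCA.
  move: le; rewrite Ew -{1}[f z]mulr1 -mulrBr rnormM -[1 in X in X -> _]/(1%:C).
  rewrite -rmorphB rnorm_real distrC => /le_trans; apply.
  by rewrite mulrAC ler_pdivrMr ?ltr_wpDl// ler_wpM2l ?(ltW e0)// lerDl.
- move=> phi M mphi phiM; apply: le_trans (Sle T phi M mphi phiM).
  rewrite le_eqVlt; apply/orP; left; apply/eqP; congr (rnorm (_ - _)).
  apply: eq_bigr => j _; rewrite (smooth_int_CV _ mphi phiM gc fc) mulrA.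
  have Fc : Cc (fun z => (h (z * (c j)^-1)%g)%:C * f z).
    by have [cc _] := ctrans (c j); exact: CcMl.
  rewrite -(bilinearZr Lpb) -linearZ; congr (pair _ (T _)).
  rewrite -(Lp_classZ P _ (Cp Fc)); congr clp; apply/funext => z.
  rewrite -[RHS]/(_ * ((h (z * (c j)^-1)%g)%:C * f z)) /w !rmorphM/=.
  by rewrite !mulrA.
Unshelve. all: by end_near. Qed.

End smoothed_form_CV.

(** Dividing by C + 1 covers the case C = 0. *)
Lemma small_factor (R : realType) (C eta : R) : 0 <= C -> 0 < eta ->
  exists2 e : R, 0 < e & e * C < eta.
Proof.
move=> C0 eta0; have C1 : 0 < C + 1 by rewrite ltr_wpDl.
exists (eta / (C + 1)); first by rewrite divr_gt0.
by rewrite mulrAC ltr_pdivrMr// ltr_pM2l// ltrDl.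
Qed.

Section smoothed_form_bounds.
Context (R : realType) (G : lcGroupType) (mu : {measure set (borel G) -> \bar R}).
Hypothesis mu_haar : left_haar mu.
Variables (Delta : G -> R) (hD : modular_function mu Delta).
Variables (p p' : R) (p1 : 1 < p) (pp' : p^-1 + p'^-1 = 1).
Local Notation P := (ltW p1).
Local Notation Q := (ltW (conj_gt1 p1 pp')).
Local Notation LpG := (Lp mu P).
Local Notation LqG := (Lp mu Q).
Local Notation clp := (Lp_class mu P).
Local Notation clq := (Lp_class mu Q).
Local Notation pair := (@Lpair _ _ _ mu p p' P Q).
Local Notation Lpb := (@Lpair_bilinear _ _ _ mu p p' P Q pp').
Variables (h : G -> R) (hc : Cc (fun x => (h x)%:C)) (h0 : forall x, 0 <= h x).
Hypothesis h1 : forall z,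
  cintegral mu (fun y => (Delta (y^-1)%g * h (z * y^-1)%g)%:C) = 1.
Local Notation smooth_int := (smooth_int pp' h).
Local Notation smooth_form := (smooth_form pp' h).
Implicit Types (phi psi : borel G -> R[i]) (f g : G -> R[i]).

Let Cq g : Cc g -> g \in cLfun mu p'. Proof. exact: (Cc_cLfun mu_haar Q). Qed.
Let Cp f : Cc f -> f \in cLfun mu p. Proof. exact: (Cc_cLfun mu_haar P). Qed.

(** For fixed y the integrand pairs phi with the product of an L_p' function and an L_p function,
    which is in L_1. A Riemann sum in y is a finite combination of such functionals, with an error
    uniform in phi. *)
Lemma smooth_form_L1 (S : Bop LpG LpG) g f (e : R) : Cc g -> Cc f -> 0 < e ->
  exists N : Lp mu (lexx 1), forall phi M, cmeasurable phi -> bounded_by phi M ->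
  rnorm (smooth_form S phi g f - L1_functional N phi) <= e * M.
Proof.
move=> gc fc e0; have [L cL fL] := twist_support hc fc.
have S0 := opnorm_ge0 S.
have [d d0 dS] := small_factor S0 e0.
have [n [Y [c [LY _ Sle]]]] := smooth_form_riemann mu_haar p1 pp' hc gc fc cL fL d0
  (fun y => @filterT _ (nbhs y) _).
pose k i : borel G -> R[i] := fun s => rtrans (c i) g s * Lp_fun (S (clp (twist h (c i) f))) s.
have k1 i : k i \in cLfun mu 1.
  by have [] := cLfun_hoelder P Q pp' (rtrans_in mu_haar Q (c i) gc) (Lp_cLfun (S (clp (twist h (c i) f)))).
pose m i := (fine (mu (Y i)))%:C : R[i].
have mk1 i : m i *: k i \in cLfun mu 1 by exact: (cLfunZ (lexx 1) (m i) (k1 i)).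
have sk1 := cLfun_sum (lexx 1) (index_enum 'I_n) mk1.
exists (Lp_class mu (lexx 1) (\sum_i m i *: k i)) => phi M mphi phiM.
have M0 : 0 <= M by exact: le_trans (rnorm_ge0 _) (phiM point).
have E : L1_functional (Lp_class mu (lexx 1) (\sum_i m i *: k i)) phi =
    \sum_i m i * smooth_int S phi g f (c i).
  have phik i : (fun t => phi t * k i t) \in cLfun mu 1.
    by have [] := phi_in (lexx 1) mphi phiM (k1 i).
  transitivity (cintegral mu (\sum_i m i *: (fun t => phi t * k i t))).
    apply: ae_eq_cintegral.
    - by apply: cmeasurableM => //; exact: Lp_cmeasurable.
    - apply: cmeasurable_sum => i; apply: cmeasurableZ; exact: cLfun_meas (phik i).
    - apply: filterS (Lp_classP (lexx 1) sk1) => t ->.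
      rewrite !fct_sumE mulr_suml; apply: eq_bigr => i _.
      by rewrite -[RHS]/(m i * (phi t * k i t)) -[m i *: k i]/(m i *: k i) /GRing.scale/= -mulrA [k i t * _]mulrC.
  rewrite cintegral_sum => [|i]; last exact: (cLfunZ (lexx 1) (m i) (phik i)).
  apply: eq_bigr => i _; rewrite (cintegralZ (m i) (phik i)); congr (_ * _).
  rewrite /smooth_int (Lpair_classl Q pp'); last first.
    by have [] := phi_in Q mphi phiM (rtrans_in mu_haar Q (c i) gc).
  by congr cintegral; apply/funext => t; rewrite mulrA.
rewrite E; apply: le_trans (Sle S phi M mphi phiM) _.
by rewrite mulrAC ler_wpM2r// ltW.
Qed.

Variables (T : Bop LpG LpG) (hT : forall s (x : LpG), T (rtr s x) = rtr s (T x)).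
Local Notation discretize := (smooth_form_discretize mu_haar hD pp' hc h0 h1 hT).

(** For phi = 1 the discretised sum is <g, T (sum_j w_j f)>, and sum_j w_j f tends to f in norm. *)
Lemma smooth_form1 g f : Cc g -> Cc f ->
  smooth_form T (cst 1) g f = pair (clq g) (T (clp f)).
Proof.
move=> gc fc; have [cf [K cK fK]] := fc.
pose k := fine (mu K) `^ p^-1; have k0 : 0 <= k by exact: powR_ge0.
have T0 := opnorm_ge0 T.
pose C := opnorm T + rnorm (clq g) * (opnorm T * k).
have C0 : 0 <= C by rewrite addr_ge0// !mulr_ge0 ?rnorm_ge0.
apply/eqP; rewrite -subr_eq0; apply/eqP; apply: rnorm0_eq0; apply/eqP.
rewrite eq_le rnorm_ge0 andbT; apply/ler_addgt0Pr => eta eta0; rewrite add0r.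
have [e e0 /ltW eC] := small_factor C0 eta0; apply: le_trans eC.
have [n [c [w [cw w0 wf Sle]]]] := discretize gc fc e0.
have b1 : bounded_by (cst 1 : borel G -> R[i]) 1 by move=> s; rewrite rnorm1.
have := Sle _ _ (cmeasurable_cst _ 1) b1.
pose F j z := (w j z)%:C * f z.
have Fc j : Cc (F j) := CcMl fc (cw j).
have E j : pair (clq (fun t => rtrans ((c j)^-1)%g (cst 1) t * g t)) (T (clp (F j))) =
    pair (clq g) (T (clp (F j))).
  rewrite (_ : (fun t => rtrans ((c j)^-1)%g (cst 1) t * g t) = g); first by [].
  by apply/funext => t; exact: mul1r.
under eq_bigr do rewrite E.
rewrite -(bilinear_sumr Lpb) -raddf_sum -(Lp_class_sum P _ (fun j => Cp (Fc j))) mulr1 => le.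
have FE : rnorm (clp (\sum_j F j) - clp f) <= e * k.
  have Fp := cLfun_sum P (index_enum 'I_n) (fun j => Cp (Fc j)).
  rewrite -(Lp_classB P Fp (Cp fc)) (Lp_class_norm P); last exact: (cLfun_sub P Fp (Cp fc)).
  apply: (cnorm_sup P (compact_borel cK) (haar_compact mu_haar cK) _ (ltW e0) _ _).2.
  - exact: cLfun_meas (cLfun_sub P Fp (Cp fc)).
  - move=> x _; rewrite -[X in rnorm X]/((\sum_j F j) x - f x) fct_sumE.
    rewrite -mulr_suml -{2}[f x]mul1r -mulrBl rnormM -rmorph_sum -[1]/(1%:C) -rmorphB rnorm_real.
    by rewrite mulrC; exact: wf.
  - move=> x Kx; rewrite -[LHS]/((\sum_j F j) x - f x) fct_sumE fK// subr0.
    by rewrite big1// => j _; rewrite /F fK// mulr0.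
rewrite -(subrKA (pair (clq g) (T (clp (\sum_j F j))))) (le_trans (ler_rnormD _ _))//.
rewrite [leRHS](_ : _ = e * opnorm T + rnorm (clq g) * (opnorm T * (e * k))); last by rewrite /C; ring.
apply: lerD le _; rewrite -(bilinearBr Lpb) -raddfB (le_trans (Lpair_bound pp' _ _))//.
rewrite ler_wpM2l ?rnorm_ge0// (le_trans (opnormP _ _))// ler_wpM2l//.
Qed.

Section subquotient.
Context (E : normedModType R[i]) (hE : Lp_subquotient P E).
Variables (phi : borel G -> R[i]) (b : G -> E -> R[i]) (alpha : G -> E) (B A : R).
Hypotheses (mphi : cmeasurable phi) (B0 : 0 <= B)
  (phiE : forall s t : G, phi (s * t^-1)%g = b s (alpha t))
  (bl : forall s, scalar (b s)) (bB : forall s x, rnorm (b s x) <= B * rnorm x)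
  (alphaA : forall t, rnorm (alpha t) <= A).

Let A0 : 0 <= A. Proof. exact: le_trans (rnorm_ge0 _) (alphaA 1%g). Qed.

Lemma coefficient_bounded : bounded_by phi (B * A).
Proof.
move=> s; have := phiE s 1%g; rewrite invg1 mulg1 => ->.
by rewrite (le_trans (bB _ _))// ler_wpM2l.
Qed.

Let U := opnorm T.
Let U0 : 0 <= U. Proof. exact: opnorm_ge0. Qed.

(** In the discretised form phi(t c_j^-1) is b_t(alpha(c_j)), and the bound must not involve the
    number n of translates. Writing all w_j f as step functions over one partition and exchanging
    the sums gives sum_i <b_t(a_i) g, T 1_(Y_i)>, the shape that [subquotient_pairing] handles. *)
Let smooth_form_le g f (r eta : R) : Cc g -> Cc f -> A * U * rnorm (clp f) < r -> 0 < eta ->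
  rnorm (smooth_form T phi g f) <= 5 * (B * rnorm (clq g) * r) + eta.
Proof.
move=> gc fc Ar eta0; have [cf [K cK fK]] := fc.
have p0 : 0 < p by exact: lt_trans p1.
have r0 : 0 < r by rewrite (le_lt_trans _ Ar)// !mulr_ge0 ?rnorm_ge0.
pose k := fine (mu K) `^ p^-1; have k0 : 0 <= k by exact: powR_ge0.
(* [e1] pays for the discretisation in y. [e2] leaves room below r for two errors of size e in the
   values of f: their variation on a piece, and the defect of sum_j w_j = 1. *)
have [e [e0 e1 e2]] : exists e : R, [/\ 0 < e, e * (B * A * U) <= eta / 2 &
    A * U * (rnorm (clp f) + (e + e) * k) < r].
  pose C := B * A * U + 2 * (A * U * k).
  have C0 : 0 <= C by rewrite addr_ge0// !mulr_ge0.
  have m0 : 0 < Num.min (eta / 2) (r - A * U * rnorm (clp f)).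
    by rewrite lt_min divr_gt0// subr_gt0.
  have [e e0] := small_factor C0 m0; rewrite lt_min => /andP[h2 h3]; exists e; split => //.
    apply: le_trans (ltW h2); rewrite ler_wpM2l ?(ltW e0)// lerDl !mulr_ge0//.
  have : e * (2 * (A * U * k)) <= e * C.
    by rewrite ler_wpM2l ?(ltW e0)// lerDr !mulr_ge0.
  by move: h3; lra.
have [n [c [w [cw w0 wf Sle]]]] := discretize gc fc e0.
have := Sle _ _ mphi coefficient_bounded; rewrite -/U -mulrA => le1.
pose F j z := (w j z)%:C * f z.
have Fc j : Cc (F j) := CcMl fc (cw j).
(* The number n of translates is fixed by now, so the second partition can be made fine enough to
   absorb n errors. *)
pose C2 := n%:R * (B * A * rnorm (clq g) * (U * k)).
have C20 : 0 <= C2 by rewrite !mulr_ge0 ?rnorm_ge0.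
have eta2 : 0 < eta / 2 by rewrite divr_gt0.
have [d' d'0 d'C] := small_factor C20 eta2.
pose d := Num.min d' e; have d0 : 0 < d by rewrite lt_min d'0.
have de : d <= e by rewrite ge_min lexx orbT.
have dC : d * C2 <= eta / 2.
  by apply: le_trans (ltW d'C); rewrite ler_wpM2r// ge_min lexx.
(* f and all the w_j f in one family, so that one partition controls their variation. *)
pose fam (l : 'I_n.+1) : G -> R[i] := oapp F f (unlift ord0 l).
have cfam l : continuous (fam l).
  by rewrite /fam; case: unliftP => [j _|_] /=; [have [] := Fc j|].
have [m [Y [z [KY Yd]]]] := continuous_partition cK cfam d0.
have Yf i x : Y i x -> rnorm (f x - f (z i)) <= d.
  by have := Yd ord0 i x; rewrite /fam unlift_none.
have YF j i x : Y i x -> rnorm (F j x - F j (z i)) <= d.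
  by have := Yd (lift ord0 j) i x; rewrite /fam liftK.
have [mY YK _] := KY.
have Yin i : cindic R (Y i) \in cLfun mu p.
  by have [] := cnorm_cindic P (mY i) (partition_fin mu_haar cK KY i).
pose H i := T (clp (cindic R (Y i))).
have Tstep v : T (clp (step Y v)) = \sum_i v i *: H i.
  have vin i : v i *: cindic R (Y i) \in cLfun mu p by exact: (cLfunZ P (v i) (Yin i)).
  rewrite /step (Lp_class_sum P _ vin) raddf_sum; apply: eq_bigr => i _.
  by rewrite (Lp_classZ P _ (Yin i)); exact: linearZ.
pose q j := clq (fun t => b t (alpha (c j)) * g t).
have mb x : (exists j, x = alpha (c j)) -> cmeasurable (fun t : borel G => b t x).
  move=> [j ->]; rewrite (_ : (fun t => _) = rtrans ((c j)^-1)%g phi).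
    exact: (cmeasurable_subst (measurable_mulr _)).
  by apply/funext => t; rewrite /rtrans phiE.
have qin j : (fun t => b t (alpha (c j)) * g t) \in cLfun mu p' /\
    cnorm mu p' (fun t => b t (alpha (c j)) * g t) <= B * A * cnorm mu p' g.
  apply: (phi_in Q _ _ (Cq gc)); first by apply: mb; exists j.
  by move=> t; rewrite (le_trans (bB _ _))// ler_wpM2l.
have qn j : rnorm (q j) <= B * A * rnorm (clq g).
  by have [h2 h3] := qin j; rewrite /q (Lp_class_norm Q h2) (Lp_class_norm Q (Cq gc)).
pose v j i := F j (z i).
(* One vector per piece. Since the weights are nonnegative and nearly sum to 1, its norm is at most
   A (|f(z_i)| + e), whatever n is. *)
pose a i := \sum_j v j i *: alpha (c j).
have E1 : \sum_j pair (clq (fun t => rtrans ((c j)^-1)%g phi t * g t)) (T (clp (F j)))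
    = \sum_j pair (q j) (T (clp (F j))).
  apply: eq_bigr => j _.
  rewrite (_ : (fun t => rtrans ((c j)^-1)%g phi t * g t) = (fun t => b t (alpha (c j)) * g t)).
    by [].
  by apply/funext => t; rewrite /rtrans phiE.
have bsum t i : b t (a i) = \sum_j v j i * b t (alpha (c j)).
  rewrite /a; elim/big_rec2: _ => [|j y x _ IH].
    by have := bl t (-1) 0 0; rewrite scaler0 addr0 mulN1r addNr.
  by rewrite bl IH.
have E2 : \sum_j pair (q j) (T (clp (step Y (v j)))) =
    \sum_i pair (clq (fun t => b t (a i) * g t)) (H i).
  under eq_bigr do rewrite Tstep (bilinear_sumr Lpb).
  rewrite exchange_big/=; apply: eq_bigr => i _.
  under eq_bigr do rewrite (bilinearZr Lpb) -(bilinearZl Lpb).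
  rewrite -(bilinear_suml Lpb); congr (pair _ _).
  under eq_bigr do rewrite -(Lp_classZ Q _ (qin _).1).
  rewrite -(Lp_class_sum Q _ (fun j => cLfunZ Q (v j i) (qin j).1)).
  congr clq; apply/funext => t; rewrite fct_sumE bsum mulr_suml.
  by apply: eq_bigr => j _; rewrite -mulrA.
have le2 : rnorm (\sum_j pair (q j) (T (clp (F j))) - \sum_j pair (q j) (T (clp (step Y (v j)))))
    <= eta / 2.
  rewrite -sumrB (le_trans (rnorm_sum _ _ _))// (le_trans _ dC)//.
  apply: (@le_trans _ _ (\sum_(j < n) d * (B * A * rnorm (clq g) * (U * k)))); last first.
    by rewrite sumr_const card_ord -mulr_natl /C2 mulrCA.
  apply: ler_sum => j _; rewrite -(bilinearBr Lpb) -raddfB.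
  rewrite (le_trans (Lpair_bound pp' _ _))// [leRHS]mulrCA ler_pM ?rnorm_ge0//.
  rewrite (le_trans (opnormP _ _))// mulrCA ler_wpM2l//.
  have sp := step_cLfun mu_haar cK KY P (v j).
  rewrite -(Lp_classB P (Cp (Fc j)) sp) (Lp_class_norm P (cLfun_sub P (Cp (Fc j)) sp)).
  apply: (step_close mu_haar cK KY P (ltW d0) _ _ (YF j)).2.
    exact: cLfun_meas (Cp (Fc j)).
  by move=> x Kx; rewrite /F fK// mulr0.
have le3 : rnorm (\sum_i pair (clq (fun t => b t (a i) * g t)) (H i))
    <= 5 * (B * rnorm (clq g) * r).
  rewrite (Lp_class_norm Q (Cq gc)).
  (* These are the weights [m] of [subquotient_pairing]: T enters only through its norm U, applied
     to combinations of the indicators of the pieces. *)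
  have w0' i : 0 <= U `^ p * fine (mu (Y i)) by rewrite mulr_ge0 ?powR_ge0 ?fine_ge0.
  apply: (subquotient_pairing mu_haar Q pp' hE w0' _ B0 bl bB _ _ r0).
  - move=> x; rewrite -Tstep.
    have sp := step_cLfun mu_haar cK KY P x.
    apply: (@le_trans _ _ ((U * cnorm mu p (step Y x)) `^ p)).
      rewrite ge0_ler_powR ?nnegrE ?rnorm_ge0 ?(ltW p0) ?mulr_ge0 ?cnorm_ge0//.
      by rewrite -(Lp_class_norm P sp); exact: opnormP.
    rewrite powRM ?cnorm_ge0// (cnorm_step mu_haar cK KY P) mulr_sumr.
    by rewrite le_eqVlt; apply/orP; left; apply/eqP/eq_bigr => i _; rewrite mulrCA.
  - move=> i; rewrite (_ : (fun t => b t (a i)) = \sum_j v j i *: (fun t => b t (alpha (c j)))).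
      by apply: cmeasurable_sum => j; apply: cmeasurableZ; apply: mb; exists j.
    by apply/funext => t; rewrite fct_sumE bsum.
  - exact: Cq.
  - pose s := step Y (fun i => (rnorm (f (z i)) + e)%:C).
    have sp := step_cLfun mu_haar cK KY P (fun i => (rnorm (f (z i)) + e)%:C).
    have cs : cnorm mu p s <= cnorm mu p f + (e + e) * k.
      have [Kin Kn] := cnorm_cindic P (compact_borel cK) (haar_compact mu_haar cK).
      pose u1 : borel G -> R[i] := fun x => (rnorm (f x))%:C.
      have fp := Cp fc.
      have [u1p u1n] : u1 \in cLfun mu p /\ cnorm mu p u1 <= 1 * cnorm mu p f.
        apply: (cnorm_dom P ler01 _ fp).
          by apply: cmeasurable_real; apply: cmeasurable_rnorm; exact: cLfun_meas fp.
        by move=> x; rewrite mul1r rnorm_real ger0_norm ?rnorm_ge0.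
      have u2p := cLfunZ P (e + e)%:C Kin.
      have up := cLfunD P u1p u2p.
      have [_ sn] : s \in cLfun mu p /\ cnorm mu p s <= 1 * cnorm mu p (u1 + (e + e)%:C *: cindic R (K : set (borel G))).
        apply: (cnorm_dom P ler01 (cLfun_meas sp) up) => x; rewrite mul1r.
        have [Kx|Kx] := pselect (K x); last by rewrite /s (step_out KY)// rnorm0 rnorm_ge0.
        have [i [Yi si]] := partition_in R KY Kx; rewrite /s si.
        rewrite -[X in _ <= rnorm X]/((rnorm (f x))%:C + (e + e)%:C * cindic R (K : set (borel G)) x).
        rewrite cindicE asboolT// mulr1 -rmorphD !rnorm_real !ger0_norm ?addr_ge0 ?rnorm_ge0 ?(ltW e0)//.
        rewrite addrA lerD2r; have := Yf i x Yi; rewrite rnormBC => hd.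
        have := lerB_rnormD (f (z i)) (f x); rewrite ler_norml => /andP[_ hd2].
        by rewrite -lerBlDl; exact: le_trans hd2 (le_trans hd de).
      apply: le_trans sn _; rewrite mul1r (le_trans (cnormD P u1p u2p))//.
      rewrite (cnormZ P _ Kin) Kn rnorm_real ger0_norm ?addr_ge0 ?(ltW e0)//.
      by rewrite -/k lerD2r -[leRHS]mul1r.
    apply: (@le_lt_trans _ _ ((A * U * cnorm mu p s) `^ p)); last first.
      apply: gt0_ltr_powR => //; rewrite ?nnegrE ?(ltW r0) ?mulr_ge0 ?cnorm_ge0//.
      apply: le_lt_trans e2; rewrite ler_wpM2l ?mulr_ge0//.
      by rewrite (Lp_class_norm P (Cp fc)).
    rewrite !powRM ?mulr_ge0 ?cnorm_ge0// (cnorm_step mu_haar cK KY P) mulr_sumr.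
    apply: ler_sum => i _; rewrite [leRHS](_ : _ =
      (A `^ p * rnorm ((rnorm (f (z i)) + e)%:C : R[i]) `^ p) * (U `^ p * fine (mu (Y i)))); last by ring.
    rewrite ler_wpM2r// -powRM ?rnorm_ge0// ge0_ler_powR ?nnegrE ?(ltW p0) ?mulr_ge0 ?rnorm_ge0//.
    rewrite rnorm_real ger0_norm ?addr_ge0 ?rnorm_ge0 ?(ltW e0)//.
    rewrite /a (le_trans (rnorm_sum _ _ _))//.
    apply: (@le_trans _ _ (\sum_j w j (z i) * rnorm (f (z i)) * A)).
      apply: ler_sum => j _; rewrite rnormZ ler_pM ?rnorm_ge0//.
      by rewrite /v /F rnormM rnorm_real ger0_norm.
    rewrite -mulr_suml mulrC ler_wpM2l// -mulr_suml.
    have := wf (z i); set W := \sum_j _ => hW.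
    have hW' : rnorm (f (z i)) * (W - 1) <= e.
      by apply: le_trans hW; rewrite ler_wpM2l ?rnorm_ge0// ler_norm.
    by rewrite mulrC; move: hW'; rewrite mulrBr mulr1 lerBlDl.
rewrite E1 in le1; rewrite -E2 in le3.
rewrite -(subrK (\sum_j pair (q j) (T (clp (F j)))) (smooth_form T phi g f)).
apply: le_trans (ler_rnormD _ _) _; rewrite addrC [in leRHS](splitr eta) addrA.
apply: lerD; last first.
  by apply: le_trans le1 _; rewrite -mulrA in e1 *.
rewrite -[X in rnorm X](subrK (\sum_j pair (q j) (T (clp (step Y (v j)))))).
by rewrite (le_trans (ler_rnormD _ _))// addrC lerD.
Qed.

Lemma smooth_form_subquotient g f : Cc g -> Cc f ->
  rnorm (smooth_form T phi g f) <= 5 * (B * A * U) * (rnorm (clq g) * rnorm (clp f)).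
Proof.
move=> gc fc; apply/ler_addgt0Pr => eta eta0.
have eta2 : 0 < eta / 2 by rewrite divr_gt0.
have C0 : 0 <= 5 * (B * rnorm (clq g)) by rewrite !mulr_ge0 ?rnorm_ge0.
have [d d0 dC] := small_factor C0 eta2.
have := @smooth_form_le g f (A * U * rnorm (clp f) + d) (eta / 2) gc fc.
rewrite ltrDl => /(_ d0 eta2)/le_trans; apply.
by rewrite [in leRHS](splitr eta) addrA lerD2r; move: dC; lra.
Qed.

End subquotient.

End smoothed_form_bounds.

(** * Compactly supported multipliers *)

Section iterated_integrals.
Context (R : realType) (G : lcGroupType) (mu : {measure set (borel G) -> \bar R}).
Hypothesis mu_haar : left_haar mu.
Implicit Types (Phi : borel G -> R[i]) (k : G -> R[i]).

Let one1 : 1 <= 1 :> R := lexx 1.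

Lemma rnorm_cintegralM Phi (q : borel G -> R[i]) (M : R) : 0 <= M ->
  Phi \in cLfun mu 1 -> cmeasurable q ->
  (forall s, Phi s != 0 -> rnorm (q s) <= M) ->
  (fun s => Phi s * q s) \in cLfun mu 1 /\
  rnorm (cintegral mu (fun s => Phi s * q s)) <= cnorm mu 1 Phi * M.
Proof.
move=> M0 Phi1 mq qM.
have [i1 n1] : (fun s => Phi s * q s) \in cLfun mu 1 /\
    cnorm mu 1 (fun s => Phi s * q s) <= M * cnorm mu 1 Phi.
  apply: (cnorm_dom one1 M0 _ Phi1).
    by apply: cmeasurableM => //; exact: cLfun_meas Phi1.
  move=> s; rewrite rnormM mulrC; have [->|Ps] := eqVneq (Phi s) 0.
    by rewrite rnorm0 !mulr0.
  by rewrite ler_wpM2r ?rnorm_ge0//; exact: qM.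
by split => //; apply: le_trans (rnorm_cintegral i1) _; rewrite mulrC.
Qed.

(* [mu] need not be sigma-finite, so Fubini's theorem does not apply: the
   integrals over [y] below are handled through Riemann sums. *)
Definition corr Phi k (y : G) : R[i] := cintegral mu (fun s => Phi s * rtrans y k s).

Section corr.
Variables (Phi : borel G -> R[i]) (K : set G).
Hypotheses (Phi1 : Phi \in cLfun mu 1) (cK : compact K) (PhiK : forall s, ~ K s -> Phi s = 0).

Let Kin s : Phi s != 0 -> K s.
Proof. by apply: contra_neqP => /PhiK. Qed.

Lemma corr_in k y : Cc k -> (fun s => Phi s * rtrans y k s) \in cLfun mu 1.
Proof.
move=> kc; have [M M0 kM] := Cc_bounded kc.
by have [] := rnorm_cintegralM M0 Phi1 (continuous_cmeasurable (Cc_mulr y kc).1) (fun s _ => kM (s * y)%g).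
Qed.

Lemma corr_osc k y y0 (e : R) : Cc k -> 0 <= e ->
  (forall s, rnorm (rtrans y k s - rtrans y0 k s) <= e) ->
  rnorm (corr Phi k y - corr Phi k y0) <= cnorm mu 1 Phi * e.
Proof.
move=> kc e0 he; rewrite /corr -(cintegralB (corr_in y kc) (corr_in y0 kc)).
have mD := cmeasurableB (continuous_cmeasurable (Cc_mulr y kc).1)
  (continuous_cmeasurable (Cc_mulr y0 kc).1).
have [_] := rnorm_cintegralM e0 Phi1 mD (fun s _ => he s); apply: le_trans.
rewrite le_eqVlt; apply/orP; left; apply/eqP; congr (rnorm (cintegral _ _)).
by apply/funext => s; rewrite [RHS]mulrBr.
Qed.

Lemma corr_support k (L : set G) : (forall x, ~ L x -> k x = 0) ->
  forall y, ~ [set (a.1 * a.2)%g | a in [set (x^-1)%g | x in K] `*` L] y ->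
  (forall s, K s -> k (s * y)%g = 0) /\ corr Phi k y = 0.
Proof.
move=> kL y Ly; have k0 s : K s -> k (s * y)%g = 0.
  move=> Ks; apply: kL => Lsy; apply: Ly; exists ((s^-1)%g, (s * y)%g) => /=.
    by split => //=; exists s.
  by rewrite mulgA mulVg mul1g.
split => //; rewrite /corr (_ : (fun s => _) = 0) ?cintegral0//.
apply/funext => s; have [Ks|Ks] := pselect (K s); last by rewrite PhiK ?mul0r.
by rewrite /rtrans k0// mulr0.
Qed.

Lemma corr_Cc k : Cc k -> Cc (corr Phi k).
Proof.
move=> kc; have [_ [L cL kL]] := kc; split; last first.
  exists [set (a.1 * a.2)%g | a in [set (x^-1)%g | x in K] `*` L].
    by apply: compact_mulg => //; exact: compact_invg.
  by move=> y /(corr_support kL)[].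
move=> y0; apply/cvg_rnormP => e e0.
have [d d0 dP] := small_factor (cnorm_ge0 mu 1 Phi) e0.
apply: filterS (rtrans_unif y0 kc d0) => y hy.
rewrite rnormBC; apply: le_lt_trans dP; rewrite mulrC.
by apply: (corr_osc kc (ltW d0)) => s; exact: ltW.
Qed.

(** Fubini's theorem by hand. A Riemann sum in y commutes with the integral over s; by left
    invariance the Riemann sum of y |-> k(s y) is close to the integral of k, uniformly for s in the
    compact set K that carries Phi. *)
Lemma corr_integral k : Cc k ->
  cintegral mu (corr Phi k) = cintegral mu Phi * cintegral mu k.
Proof.
move=> kc; have [_ [L0 cL0 kL0]] := kc.
set L := [set (a.1 * a.2)%g | a in [set (x^-1)%g | x in K] `*` L0].
have cL : compact L by apply: compact_mulg => //; exact: compact_invg.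
have out := corr_support kL0; rewrite -/L in out.
pose m := fine (mu L); have m0 : 0 <= m by exact: fine_ge0.
pose A := cnorm mu 1 Phi; have A0 : 0 <= A by exact: cnorm_ge0.
have C0 : 0 <= 2 * (A * m) by rewrite !mulr_ge0.
apply/eqP; rewrite -subr_eq0; apply/eqP; apply: rnorm0_eq0; apply/eqP.
rewrite eq_le rnorm_ge0 andbT; apply/ler_addgt0Pr => eta eta0; rewrite add0r.
have [d d0 /ltW dC] := small_factor C0 eta0; apply: le_trans dC.
have [n [Y [c [mY YL _ YN hY]]]] := compact_partition cL (fun y _ => rtrans_unif y kc d0).
have LY : partition_of L Y by split.
have k1 := Cc_cLfun mu_haar one1 kc.
pose mj j := (fine (mu (Y j)))%:C : R[i].
(* The Riemann sum of y |-> k(s y), with the same pieces and points for every s. *)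
pose D s := \sum_j mj j * rtrans (c j) k s.
have Ad0 : 0 <= A * d by rewrite mulr_ge0// ltW.
have le1 := riemann mu_haar cL LY Ad0 (continuous_cmeasurable (corr_Cc kc).1)
  (fun y Ly => (out y Ly).2) (v := fun j => corr Phi k (c j))
  (fun j y Yy => corr_osc kc (ltW d0) (fun s => ltW (YN j y Yy s))).
have Ds s : K s -> rnorm (D s - cintegral mu k) <= d * m.
  move=> Ks; rewrite -(cintegral_ltrans mu_haar s k1) rnormBC.
  have [cl _] : continuous (ltrans s k) /\ True.
    by split => // t; apply: continuous_comp; [exact: mulgl_continuous|exact: kc.1].
  apply: (riemann mu_haar cL LY (ltW d0) (continuous_cmeasurable cl)).
    by move=> y Ly; exact: (out y Ly).1.
  by move=> j y Yy; apply: ltW; exact: YN.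
have mD : cmeasurable D.
  rewrite (_ : D = \sum_j mj j *: rtrans (c j) k).
    apply: cmeasurable_sum => j; apply: cmeasurableZ.
    exact: (continuous_cmeasurable (Cc_mulr (c j) kc).1).
  by apply/funext => s; rewrite fct_sumE.
have mE : cmeasurable (fun s => D s - cintegral mu k).
  exact: (cmeasurableB mD (cmeasurable_cst _ (cintegral mu k))).
have dm0 : 0 <= d * m by rewrite mulr_ge0// ltW.
have [DE1 le2] := rnorm_cintegralM dm0 Phi1 mE (fun s Ps => Ds s (Kin Ps)).
have E : \sum_j mj j * corr Phi k (c j) - cintegral mu Phi * cintegral mu k =
    cintegral mu (fun s => Phi s * (D s - cintegral mu k)).
  have i1 j := cLfunZ one1 (mj j) (corr_in (c j) kc).
  have i2 := cLfunZ one1 (cintegral mu k) Phi1.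
  rewrite [cintegral mu Phi * _]mulrC -(cintegralZ _ Phi1).
  under eq_bigr do rewrite -(cintegralZ _ (corr_in _ kc)).
  rewrite -(cintegral_sum _ i1) -(cintegralB (cLfun_sum one1 _ i1) i2).
  congr cintegral; apply/funext => s.
  rewrite -[LHS]/((\sum_j mj j *: (fun s => Phi s * rtrans (c j) k s)) s - cintegral mu k * Phi s).
  rewrite fct_sumE mulrBr [Phi s * cintegral _ _]mulrC; congr (_ - _).
  by rewrite mulr_sumr; apply: eq_bigr => j _; rewrite [RHS]mulrCA.
rewrite -(subrKA (\sum_j mj j * corr Phi k (c j))) (le_trans (ler_rnormD _ _))// E.
rewrite [leRHS](_ : _ = A * d * m + A * (d * m)); last by ring.
by rewrite lerD.
Qed.

End corr.

(** Formally the left side is the integral of G0(s) H0(z) sum_m int g_m(s y) f_m(z y) dy over s and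
    z, and the hypothesis bounds the inner sum as a whole. As in [corr_integral], the exchange is
    carried out on Riemann sums in y. *)
Lemma corr_pair_bound (G0 H0 : borel G -> R[i]) (K1 K2 : set G) N (g f : 'I_N -> G -> R[i]) (M : R) :
  G0 \in cLfun mu 1 -> H0 \in cLfun mu 1 -> compact K1 -> compact K2 ->
  (forall s, ~ K1 s -> G0 s = 0) -> (forall s, ~ K2 s -> H0 s = 0) ->
  (forall m, Cc (g m)) -> (forall m, Cc (f m)) -> 0 <= M ->
  (forall s z, K1 s -> K2 z ->
    rnorm (\sum_m cintegral mu (fun y => g m (s * y)%g * f m (z * y)%g)) <= M) ->
  rnorm (cintegral mu (fun y => \sum_m corr G0 (g m) y * corr H0 (f m) y))
    <= cnorm mu 1 G0 * (cnorm mu 1 H0 * M).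
Proof.
move=> G1 H1 cK1 cK2 GK HK gc fc M0 gfM.
have [L0 cL0 fL0] := Cc_common_support fc.
set L := [set (a.1 * a.2)%g | a in [set (x^-1)%g | x in K2] `*` L0].
have cL : compact L by apply: compact_mulg => //; exact: compact_invg.
have out m := corr_support HK (fL0 m); rewrite -/L in out.
have /choice[b hb] m : exists b : R, 0 <= b /\ (forall x, rnorm (g m x) <= b) /\
    (forall x, rnorm (f m x) <= b).
  have [b1 b10 hb1] := Cc_bounded (gc m); have [b2 b20 hb2] := Cc_bounded (fc m).
  exists (b1 + b2); split; first exact: addr_ge0.
  by split=> x; [apply: le_trans (hb1 x) _; rewrite lerDl|apply: le_trans (hb2 x) _; rewrite lerDr].
(* The product rule: if both factors move by at most d, each product g_m f_m moves by at most 2 d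
   b_m. *)
pose b0 := \sum_m 2 * b m; have b00 : 0 <= b0.
  by apply: sumr_ge0 => m _; rewrite mulr_ge0//; case: (hb m).
pose m := fine (mu L); have m0 : 0 <= m by exact: fine_ge0.
pose A := cnorm mu 1 G0; have A0 : 0 <= A by exact: cnorm_ge0.
pose B := cnorm mu 1 H0; have B0 : 0 <= B by exact: cnorm_ge0.
have C0 : 0 <= m + A * (B * (b0 * m)) by rewrite addr_ge0// !mulr_ge0.
apply/ler_addgt0Pr => eta eta0.
have [d d0 dC] := small_factor C0 eta0.
pose W y := \sum_m corr G0 (g m) y * corr H0 (f m) y.
have Wc : Cc W.
  have mc m' : Cc (fun y => corr G0 (g m') y * corr H0 (f m') y).
    by have [cg _] := corr_Cc G1 cK1 GK (gc m'); exact: (CcMl (corr_Cc H1 cK2 HK (fc m')) cg).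
  rewrite (_ : W = \sum_m (fun y => corr G0 (g m) y * corr H0 (f m) y)).
    elim/big_ind: _ => [|u v uc vc|i _]; [exact: Cc0| |exact: mc].
    by rewrite -[u]scale1r; exact: Cc_linear.
  by apply/funext => y; rewrite fct_sumE.
pose Nb y0 := [set y | rnorm (W y - W y0) <= d /\ forall m,
  (forall s, rnorm (rtrans y (g m) s - rtrans y0 (g m) s) < d) /\
  (forall s, rnorm (rtrans y (f m) s - rtrans y0 (f m) s) < d)].
have nN y : L y -> nbhs y (Nb y).
  move=> _; apply: filterI.
    have /cvg_rnormP/(_ _ d0) := Wc.1 y; apply: filterS => t /ltW.
    by rewrite rnormBC.
  by apply: filter_forall => i; apply: filterI; exact: rtrans_unif.
have [n [Y [c [mY YL _ YN hY]]]] := compact_partition cL nN.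
have LY : partition_of L Y by split.
pose mj j := (fine (mu (Y j)))%:C : R[i].
have W0 y : ~ L y -> W y = 0.
  by move=> Ly; rewrite /W big1// => i _; rewrite (out i y Ly).2 mulr0.
have le1 := riemann mu_haar cL LY (ltW d0) (continuous_cmeasurable Wc.1) W0
  (v := fun j => W (c j)) (fun j y Yy => (YN j y Yy).1).
(* The Riemann sum of the inner integral; bounding it by M up to an error brings in the cancellation
   between different m. *)
pose D s z := \sum_j mj j * \sum_m g m (s * c j)%g * f m (z * c j)%g.
have DM s z : K1 s -> K2 z -> rnorm (D s z) <= M + d * b0 * m.
  move=> Ks Kz; pose V y := \sum_m g m (s * y)%g * f m (z * y)%g.
  have lc (u : G -> R[i]) x : Cc u -> continuous (ltrans x u).
    by move=> uc t; apply: continuous_comp; [exact: mulgl_continuous|exact: uc.1].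
  have ic i : (fun y => g i (s * y)%g * f i (z * y)%g : R[i]) \in cLfun mu 1.
    have [] // := cLfunMb one1 (continuous_cmeasurable (lc _ s (gc i)))
      (fun x => (hb i).2.1 (s * x)%g) (cLfun_ltrans mu_haar one1 z (Cc_cLfun mu_haar one1 (fc i))).1.
  have VE : V = \sum_m (fun y => g m (s * y)%g * f m (z * y)%g).
    by apply/funext => y; rewrite fct_sumE.
  have mV : cmeasurable (V : borel G -> R[i]).
    rewrite VE; apply: cmeasurable_sum => i; apply: cmeasurableM.
      exact: (continuous_cmeasurable (lc _ s (gc i))).
    exact: (continuous_cmeasurable (lc _ z (fc i))).
  have V0 y : ~ L y -> V y = 0.
    by move=> Ly; rewrite /V big1// => i _; rewrite ((out i y Ly).1 z Kz) mulr0.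
  have db0 : 0 <= d * b0 by rewrite mulr_ge0// ltW.
  have Vosc j y : Y j y -> rnorm (V y - V (c j)) <= d * b0.
    move=> /(YN j)[_ hy]; rewrite /V -sumrB (le_trans (rnorm_sum _ _ _))//.
    rewrite /b0 mulr_sumr; apply: ler_sum => i _; have [bi0 [gb fb]] := hb i.
    have [hg hf] := hy i.
    rewrite (_ : _ - _ = (g i (s * y)%g - g i (s * c j)%g) * f i (z * y)%g +
      g i (s * c j)%g * (f i (z * y)%g - f i (z * c j)%g)); last by rewrite mulrBl mulrBr subrKA.
    rewrite (le_trans (ler_rnormD _ _))// !rnormM mulr_natl mulrnAr mulr2n lerD//.
      by rewrite ler_pM ?rnorm_ge0//; exact: ltW (hg s).
    by rewrite [leRHS]mulrC ler_pM ?rnorm_ge0//; exact: ltW (hf z).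
  have := riemann mu_haar cL LY db0 mV V0 (v := fun j => V (c j)) Vosc.
  rewrite rnormBC -/(D s z) => leD.
  have VM : rnorm (cintegral mu V) <= M.
    by rewrite VE (cintegral_sum _ ic); exact: gfM.
  rewrite -[D s z](subrK (cintegral mu V)) addrC (le_trans (ler_rnormD _ _))//.
  by rewrite lerD.
(* What remains after integrating H0(z) D(s, z) over z; integrating against G0(s) then gives the
   Riemann sum of the product of correlations. *)
pose q s := \sum_j mj j * \sum_m g m (s * c j)%g * corr H0 (f m) (c j).
have qE s : q s = cintegral mu (fun z => H0 z * D s z).
  pose u j i : borel G -> R[i] := fun z => H0 z * rtrans (c j) (f i) z.
  have u1 j i : u j i \in cLfun mu 1 by exact: (corr_in H1 (c j) (fc i)).
  have v1 j : mj j *: \sum_i g i (s * c j)%g *: u j i \in cLfun mu 1.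
    apply: (cLfunZ one1); apply: (cLfun_sum one1) => i.
    exact: (cLfunZ one1 _ (u1 j i)).
  rewrite (_ : (fun z => _) = \sum_j mj j *: \sum_i g i (s * c j)%g *: u j i).
    rewrite (cintegral_sum _ v1); apply: eq_bigr => j _.
    rewrite (cintegralZ _ (cLfun_sum one1 _ (fun i => cLfunZ one1 _ (u1 j i)))).
    rewrite (cintegral_sum _ (fun i => cLfunZ one1 _ (u1 j i))); congr (_ * _).
    by apply: eq_bigr => i _; rewrite (cintegralZ _ (u1 j i)).
  apply/funext => z; rewrite fct_sumE /D mulr_sumr; apply: eq_bigr => j _.
  rewrite -[RHS]/(mj j * (\sum_i g i (s * c j)%g *: u j i) z) mulrCA; congr (_ * _).
  rewrite fct_sumE mulr_sumr; apply: eq_bigr => i _.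
  by rewrite -[RHS]/(g i (s * c j)%g * (H0 z * f i (z * c j)%g)) mulrCA.
have Mb0 : 0 <= M + d * b0 * m by rewrite addr_ge0// !mulr_ge0// ltW.
have mD s : cmeasurable (D s : borel G -> R[i]).
  rewrite (_ : D s = \sum_j mj j *: \sum_i g i (s * c j)%g *: rtrans (c j) (f i)).
    apply: cmeasurable_sum => j; apply: cmeasurableZ; apply: cmeasurable_sum => i.
    by apply: cmeasurableZ; exact: (continuous_cmeasurable (Cc_mulr (c j) (fc i)).1).
  apply/funext => z; rewrite fct_sumE; apply: eq_bigr => j _.
  by rewrite -[RHS]/(mj j * (\sum_i g i (s * c j)%g *: rtrans (c j) (f i)) z) fct_sumE.
have mq : cmeasurable (q : borel G -> R[i]).
  rewrite (_ : q = \sum_j mj j *: \sum_i corr H0 (f i) (c j) *: rtrans (c j) (g i)).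
    apply: cmeasurable_sum => j; apply: cmeasurableZ; apply: cmeasurable_sum => i.
    by apply: cmeasurableZ; exact: (continuous_cmeasurable (Cc_mulr (c j) (gc i)).1).
  apply/funext => z; rewrite fct_sumE; apply: eq_bigr => j _.
  rewrite -[RHS]/(mj j * (\sum_i corr H0 (f i) (c j) *: rtrans (c j) (g i)) z) fct_sumE.
  by congr (_ * _); apply: eq_bigr => i _; rewrite mulrC.
have qM s : G0 s != 0 -> rnorm (q s) <= B * (M + d * b0 * m).
  move=> Gs; have Ks : K1 s by move: Gs; apply: contra_neqP => /GK.
  have HD z : H0 z != 0 -> rnorm (D s z) <= M + d * b0 * m.
    by move=> Hz; apply: DM => //; move: Hz; apply: contra_neqP => /HK.
  by rewrite qE; have [_] := rnorm_cintegralM Mb0 H1 (mD s) HD.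
have BM0 : 0 <= B * (M + d * b0 * m) by rewrite mulr_ge0.
have [Gq1 le2] := rnorm_cintegralM BM0 G1 mq qM.
have E : \sum_j mj j * W (c j) = cintegral mu (fun s => G0 s * q s).
  pose u j i : borel G -> R[i] := fun z => G0 z * rtrans (c j) (g i) z.
  have u1 j i : u j i \in cLfun mu 1 by exact: (corr_in G1 (c j) (gc i)).
  have v1 j : mj j *: \sum_i corr H0 (f i) (c j) *: u j i \in cLfun mu 1.
    apply: (cLfunZ one1); apply: (cLfun_sum one1) => i.
    exact: (cLfunZ one1 _ (u1 j i)).
  rewrite (_ : (fun z => _) = \sum_j mj j *: \sum_i corr H0 (f i) (c j) *: u j i).
    rewrite (cintegral_sum _ v1); apply: eq_bigr => j _.
    rewrite (cintegralZ _ (cLfun_sum one1 _ (fun i => cLfunZ one1 _ (u1 j i)))).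
    rewrite (cintegral_sum _ (fun i => cLfunZ one1 _ (u1 j i))); congr (_ * _).
    by apply: eq_bigr => i _; rewrite (cintegralZ _ (u1 j i)) mulrC.
  apply/funext => z; rewrite fct_sumE /q mulr_sumr; apply: eq_bigr => j _.
  rewrite -[RHS]/(mj j * (\sum_i corr H0 (f i) (c j) *: u j i) z) mulrCA; congr (_ * _).
  rewrite fct_sumE mulr_sumr; apply: eq_bigr => i _.
  by rewrite -[RHS]/(corr H0 (f i) (c j) * (G0 z * g i (z * c j)%g)) [LHS]mulrA [LHS]mulrC.
rewrite -/W -[cintegral mu W](subrK (\sum_j mj j * W (c j))) addrC.
rewrite (le_trans (ler_rnormD _ _))//.
apply: (@le_trans _ _ (A * (B * (M + d * b0 * m)) + d * m)).
  by apply: lerD => //; rewrite E.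
by move: dC; rewrite /A /B; nra.
Qed.

End iterated_integrals.

(** At x = 0 the formula by [expR] and [ln] fails; there t ^ r <= t for t <= 1 replaces it. *)
Lemma powR_continuous_ge0 (R : realType) (r x : R) : 1 <= r -> 0 <= x ->
  forall e : R, 0 < e -> \forall t \near x, 0 <= t -> `|x `^ r - t `^ r| < e.
Proof.
move=> r1; have r0 : r != 0 by rewrite gt_eqF// (lt_le_trans _ r1).
rewrite le_eqVlt => /predU1P[<-|x0] e e0.
  have m0 : 0 < Num.min 1 e by rewrite lt_min ltr01.
  have /cvgrPdist_lt /(_ _ m0) := @cvg_id _ (nbhs (0 : R)).
  apply: filterS => t /= + t0; rewrite !sub0r normrN (ger0_norm t0) lt_min => /andP[t1 te].
  rewrite powR0// sub0r normrN ger0_norm ?powR_ge0//; apply: le_lt_trans te.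
  have [->|tn0] := eqVneq t 0; first by rewrite powR0.
  rewrite -[leRHS]powRr1//; have tt : 0 < t by rewrite lt_neqAle eq_sym tn0.
  by rewrite ger_powR// tt ltW.
have c : expR (r * ln t) @[t --> x] --> expR (r * ln x).
  apply: continuous_cvg; first exact: continuous_expR.
  by apply: cvgM; [exact: cvg_cst|exact: continuous_ln].
have /cvgrPdist_lt /(_ _ e0) h := c.
have hx : \forall t \near x, 0 < t.
  have /cvgrPdist_lt/(_ _ x0) := @cvg_id _ (nbhs x).
  by apply: filterS => t /=; rewrite ltr_distlC subrr => /andP[].
apply: filterS2 h hx => t h tt _; move: h; rewrite /powR !gt_eqF//.
Qed.

Section correlation_norm.
Context (R : realType) (G : lcGroupType) (mu : {measure set (borel G) -> \bar R}).
Hypothesis mu_haar : left_haar mu.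
Variables (r : R) (r1 : 1 <= r).

Let r0 : 0 < r. Proof. exact: lt_le_trans r1. Qed.

Definition rpow (f : borel G -> R[i]) (s : borel G) : R[i] := (rnorm (f s) `^ r)%:C.

Lemma rpowM f g : rpow (fun s => f s * g s) = (fun s => rpow f s * rpow g s).
Proof. by apply/funext => s; rewrite /rpow rnormM powRM ?rnorm_ge0// rmorphM. Qed.

Lemma rpow_integral f : f \in cLfun mu r ->
  rpow f \in cLfun mu 1 /\ cintegral mu (rpow f) = (cnorm mu r f `^ r)%:C.
Proof.
move=> fr; have mf := cLfun_meas fr; have X := cnormX r1 fr.
have mr : measurable_fun setT (fun x => rnorm (f x) `^ r).
  by apply/measurable_EFinP; exact: measurable_rnorm_powR.
have E : (\int[mu]_x (rnorm (rpow f x))%:E = (cnorm mu r f `^ r)%:E)%E.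
  rewrite X; apply: eq_integral => x _; rewrite /rpow rnorm_real ger0_norm ?powR_ge0//.
split; first by apply/cL1P; split; [exact: cmeasurable_real|rewrite E ltry].
rewrite /cintegral/rpow/=; apply/eqP; rewrite eq_complex/=; apply/andP; split; apply/eqP.
  by rewrite /Rintegral -X.
by rewrite /Rintegral integral0.
Qed.

Lemma rpow_Cc f : Cc f -> Cc (rpow f).
Proof.
move=> [cf [K cK fK]]; split; last first.
  by exists K => // x Kx; rewrite /rpow fK// rnorm0 powR0 ?gt_eqF.
move=> x; apply/cvg_rnormP => e e0.
have h := powR_continuous_ge0 r1 (rnorm_ge0 (f x)) e0.
have c : rnorm (f t) @[t --> x] --> rnorm (f x).
  apply/cvgrPdist_lt => d d0; have /cvg_rnormP/(_ _ d0) := cf x.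
  by apply: filterS => t; exact: le_lt_trans (lerB_rnormD _ _).
have h2 : \forall t \near x, 0 <= rnorm (f t) -> `|rnorm (f x) `^ r - rnorm (f t) `^ r| < e.
  exact: (c _ h).
apply: filterS h2 => t /(_ (rnorm_ge0 _)).
by rewrite -[X in _ -> rnorm X < _]rmorphB rnorm_real.
Qed.

(** The r-th power of the statement is [corr_integral] for |Phi| ^ r and |k| ^ r. *)
Lemma cnorm_corr Phi k : Cc Phi -> Cc k ->
  Cc (fun y => (cnorm mu r (fun s => Phi s * rtrans y k s))%:C) /\
  cnorm mu r (fun y : borel G => (cnorm mu r (fun s => Phi s * rtrans y k s))%:C)
    = cnorm mu r Phi * cnorm mu r k.
Proof.
move=> Pc kc; have [M M0 PM] := Cc_bounded Pc.
pose u y (s : borel G) := Phi s * rtrans y k s.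
have uc y : Cc (u y) by have [cP _] := Pc; exact: (CcMl (Cc_mulr y kc) cP).
have ur y := Cc_cLfun mu_haar r1 (uc y).
have ky y := Cc_cLfun mu_haar r1 (Cc_mulr y kc).
pose A (y : borel G) := cnorm mu r (u y).
have A0 y : 0 <= A y by exact: cnorm_ge0.
have [[cP [K cK PK]] [ck [L cL kL]]] := (Pc, kc).
have le_diff y z d : 0 <= d -> (forall s, rnorm (rtrans y k s - rtrans z k s) <= d) ->
    A y <= A z + d * cnorm mu r Phi.
  move=> d0 hd; have [||Dr Dn] := cnorm_dom r1 d0 (f := u y - u z) _ (Cc_cLfun mu_haar r1 Pc).
  - by apply: cmeasurableB; [exact: cLfun_meas (ur y)|exact: cLfun_meas (ur z)].
  - move=> s; rewrite -[X in rnorm X]/(Phi s * rtrans y k s - Phi s * rtrans z k s) -mulrBr.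
    by rewrite rnormM mulrC ler_wpM2r ?rnorm_ge0.
  rewrite /A -{1}[u y](subrK (u z)) addrC (le_trans (cnormD r1 (ur z) Dr))//.
  by rewrite lerD2l.
have Ac : Cc (fun y => (A y)%:C).
  split; last first.
    exists [set (a.1 * a.2)%g | a in [set (x^-1)%g | x in K] `*` L].
      by apply: compact_mulg => //; exact: compact_invg.
    move=> y Ly; have [||_] := cnorm_dom r1 (lexx 0) (f := u y) _ (ur y).
    - exact: cLfun_meas (ur y).
    - move=> s; rewrite mul0r /u; have [Ks|Ks] := pselect (K s); last by rewrite PK ?mul0r ?rnorm0.
      rewrite /rtrans kL ?mulr0 ?rnorm0// => Lsy; apply: Ly.
      exists ((s^-1)%g, (s * y)%g) => /=; last by rewrite mulgA mulVg mul1g.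
      by split => //=; exists s.
    by rewrite mul0r => Ay; congr (_%:C); apply/eqP; rewrite eq_le A0 andbT.
  move=> y0; apply/cvg_rnormP => e e0.
  have [d d0 dP] := small_factor (cnorm_ge0 mu r Phi) e0.
  apply: filterS (rtrans_unif y0 kc d0) => y hy.
  rewrite -[X in rnorm X]rmorphB rnorm_real; apply: le_lt_trans dP.
  rewrite ler_distl lerBlDr; apply/andP; split; apply: (le_diff _ _ _ (ltW d0)) => s.
    exact: ltW (hy s).
  by rewrite rnormBC; exact: ltW (hy s).
split; first exact: Ac.
have Ar := Cc_cLfun mu_haar r1 Ac.
have [Ar1 AE] := rpow_integral Ar.
have [P1 PE] := rpow_integral (Cc_cLfun mu_haar r1 Pc).
have [_ kE] := rpow_integral (Cc_cLfun mu_haar r1 kc).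
have PK' s : ~ K s -> rpow Phi s = 0.
  by move=> Ks; rewrite /rpow PK// rnorm0 powR0 ?gt_eqF.
have := corr_integral mu_haar P1 cK PK' (rpow_Cc kc).
rewrite PE kE (_ : corr _ _ _ = rpow (fun y => (A y)%:C)); last first.
  apply/funext => y; have [_ E] := rpow_integral (ur y).
  rewrite /corr; transitivity (cintegral mu (rpow (u y))); first by rewrite rpowM.
  by rewrite E /rpow rnorm_real ger0_norm.
rewrite AE -rmorphM => /complexI; rewrite -powRM ?cnorm_ge0//.
by move=> /(powR_injective r0); apply; rewrite nnegrE ?mulr_ge0 ?cnorm_ge0.
Qed.
End correlation_norm.

Section compact_multiplier.
Context (R : realType) (G : lcGroupType) (mu : {measure set (borel G) -> \bar R}).
Hypothesis mu_haar : left_haar mu.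
Variables (p p' : R) (p1 : 1 < p) (pp' : p^-1 + p'^-1 = 1).
Local Notation P := (ltW p1).
Local Notation Q := (ltW (conj_gt1 p1 pp')).
Local Notation LpG := (Lp mu P).
Local Notation LqG := (Lp mu Q).
Local Notation clp := (Lp_class mu P).
Local Notation clq := (Lp_class mu Q).
Local Notation pair := (@Lpair _ _ _ mu p p' P Q).
Local Notation Lpb := (@Lpair_bilinear _ _ _ mu p p' P Q pp').
Variables (h : G -> R) (hc : Cc (fun x => (h x)%:C)).
Local Notation smooth_int := (smooth_int pp' h).
Local Notation smooth_form := (smooth_form pp' h).
Implicit Types (phi psi : borel G -> R[i]) (f g : G -> R[i]).

Let Cq g : Cc g -> g \in cLfun mu p'. Proof. exact: (Cc_cLfun mu_haar Q). Qed.
Let Cp f : Cc f -> f \in cLfun mu p. Proof. exact: (Cc_cLfun mu_haar P). Qed.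

(** Hoelder's inequality is applied for each y and then in y; [cnorm_corr] evaluates both resulting
    norms exactly. The compact support of phi plays for g the part that h plays for f. *)
Lemma smooth_form_Cc_bound phi (S : Bop LpG LpG) g f : Cc phi -> Cc g -> Cc f ->
  rnorm (smooth_form S phi g f) <=
  cnorm mu p' phi * cnorm mu p (fun x => (h x)%:C) * opnorm S * (rnorm (clq g) * rnorm (clp f)).
Proof.
move=> phic gc fc; have [M M0 phiM] := Cc_bounded phic.
have S0 := opnorm_ge0 S.
have [ac an] := cnorm_corr mu_haar Q phic gc.
have [bc bn] := cnorm_corr mu_haar P hc fc.
have mphi := continuous_cmeasurable phic.1.
pose a (y : borel G) : R[i] := (cnorm mu p' (fun s => phi s * rtrans y g s))%:C.
pose b (y : borel G) : R[i] := (cnorm mu p (twist h y f))%:C.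
have [ab1 abn] := cLfun_hoelder P Q pp' (Cq ac : a \in _) (Cp bc : b \in _).
have si := smooth_int_in mu_haar pp' hc S mphi phiM gc fc.
have dom y : rnorm (smooth_int S phi g f y) <= opnorm S * rnorm (a y * b y).
  rewrite rnormM !rnorm_real !ger0_norm ?cnorm_ge0//.
  rewrite (le_trans (Lpair_bound pp' _ _))//.
  have [pg _] := phi_in Q mphi phiM (rtrans_in mu_haar Q y gc).
  rewrite (Lp_class_norm Q pg) mulrCA ler_wpM2l ?cnorm_ge0// (le_trans (opnormP _ _))//.
  by rewrite (Lp_class_norm P (Cp (twist_Cc hc y fc))).
have [_ n1] := cnorm_dom (lexx 1) S0 (cLfun_meas si) ab1 dom.
rewrite (le_trans (rnorm_cintegral si))// (le_trans n1)//.
rewrite (Lp_class_norm Q (Cq gc)) (Lp_class_norm P (Cp fc)).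
rewrite [leRHS](_ : _ = opnorm S * (cnorm mu p' phi * cnorm mu p' g *
  (cnorm mu p (fun x => (h x)%:C) * cnorm mu p f))); last by ring.
by rewrite ler_wpM2l// -an -bn.
Qed.

(** * Averaging operators of finite rank *)

Section averaging.
Variables (K : set G) (cK : compact K) (n : nat) (Y : 'I_n -> set (borel G)).
Hypothesis KY : partition_of K Y.
Let m l := fine (mu (Y l)).
Let m0 l : 0 <= m l. Proof. exact: fine_ge0. Qed.

(** The mean of x over the l-th piece, so that [avg_fun] is a conditional expectation cut off
    outside K. On a null piece the mean is 0, as the inverse of 0 is 0. *)
Let mean l (x : LpG) : R[i] := ((m l)^-1)%:C * pair (clq (cindic R (Y l))) x.

Definition avg_fun (x : LpG) : LpG := clp (step Y (mean^~ x)).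

Let mean_linear l : scalar (mean l).
Proof. by move=> a x y; rewrite /mean (Lpb.2 _ a x y) mulrDr mulrCA. Qed.

Lemma avg_linear : linear avg_fun.
Proof.
move=> a x y; have st := step_cLfun mu_haar cK KY P.
rewrite /avg_fun -(Lp_class_linear P a (st _) (st _)); congr clp; apply/funext => s.
rewrite -[RHS]/(a * step Y (mean^~ x) s + step Y (mean^~ y) s) /step !fct_sumE mulr_sumr -big_split.
apply: eq_bigr => l _; rewrite mean_linear.
by rewrite -[LHS]/((a * mean l x + mean l y) * cindic R (Y l) s) mulrDl -mulrA.
Qed.

Let Yq l : cindic R (Y l) \in cLfun mu p'.
Proof.
by have [mY _ _] := KY; have [] := cnorm_cindic Q (mY l) (partition_fin mu_haar cK KY l).
Qed.

(** Jensen's inequality on one piece, obtained from Hoelder's; it makes [avg_fun] a contraction. *)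
Let mean_le l (x : LpG) :
  rnorm (mean l x) `^ p * m l <= cnorm mu p (fun s => cindic R (Y l) s * Lp_fun x s) `^ p.
Proof.
have [mY _ _] := KY; have fY := partition_fin mu_haar cK KY l.
have [_ nY] := cnorm_cindic Q (mY l) fY.
have i1 s : rnorm (cindic R (Y l) s) <= 1.
  by rewrite /cindic rnorm_real ger0_norm// indicE lern1 leq_b1.
have [xin _] := cLfunMb P (cLfun_meas (Yq l)) i1 (Lp_cLfun x).
set b := cnorm mu p _; have b0 : 0 <= b by exact: cnorm_ge0.
have [ml0|ml0] := eqVneq (m l) 0; first by rewrite ml0 mulr0 powR_ge0.
have ml : 0 < m l by rewrite lt_neqAle eq_sym ml0 m0.
have p0 : 0 < p by exact: lt_trans p1.
have le1 : rnorm (pair (clq (cindic R (Y l))) x) <= m l `^ p'^-1 * b.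
  have [j1 j2] := cLfun_hoelder P Q pp' (Yq l) xin.
  rewrite (Lpair_classl Q pp' x (Yq l)).
  (* The indicator is its own square, so that after Hoelder's inequality the norm of x is still
     restricted to the piece. *)
  rewrite (_ : (fun t => _) = (fun t => cindic R (Y l) t * (cindic R (Y l) t * Lp_fun x t))).
    by rewrite (le_trans (rnorm_cintegral j1))// (le_trans j2)// nY.
  apply/funext => t; rewrite mulrA; congr (_ * _).
  by rewrite /cindic -rmorphM -expr2 indicE; case: (_ \in _); rewrite ?expr1n ?expr0n.
have le2 : rnorm (mean l x) <= m l `^ (- p^-1) * b.
  rewrite /mean rnormM rnorm_real ger0_norm ?invr_ge0 ?m0//.
  (* The exponent -1 comes from the division by the measure, 1 / p' from the norm of the
     indicator. *)
  have -> : - p^-1 = -1 + p'^-1 by rewrite -pp'; ring.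
  rewrite powRD; last by rewrite ml0 implybT.
  by rewrite powR_inv1// -mulrA ler_wpM2l// invr_ge0.
apply: (@le_trans _ _ ((m l `^ (- p^-1) * b) `^ p * m l)).
  rewrite ler_wpM2r// ge0_ler_powR ?nnegrE ?rnorm_ge0 ?(ltW p0)//.
  by rewrite mulr_ge0 ?powR_ge0.
rewrite powRM ?powR_ge0// -powRrM mulNr mulVf ?gt_eqF// powR_inv1//.
by rewrite mulrAC mulVf// mul1r.
Qed.

Lemma avg_norm x : rnorm (avg_fun x) <= rnorm x.
Proof.
have p0 : 0 < p by exact: lt_trans p1.
have st := step_cLfun mu_haar cK KY P (mean^~ x).
rewrite (Lp_class_norm P st) Lp_normE.
have xp := Lp_cLfun x; have [mY YK _] := KY.
suff le : (\int[mu]_s (rnorm (step Y (mean^~ x) s) `^ p)%:E <= (cnorm mu p (Lp_fun x) `^ p)%:E)%E.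
  by have [_] := cnorm_powR_le P (cnorm_ge0 mu p (Lp_fun x)) (cLfun_meas st) le.
rewrite -(cnormX P st) (cnorm_step mu_haar cK KY P) (cnormX P xp).
apply: (@le_trans _ _ (\sum_l (cnorm mu p (fun s => cindic R (Y l) s * Lp_fun x s) `^ p)%:E)%E).
  by rewrite sumEFin lee_fin; apply: ler_sum => l _; exact: mean_le.
have Yx l : (fun s => cindic R (Y l) s * Lp_fun x s) \in cLfun mu p.
  have i1 s : rnorm (cindic R (Y l) s) <= 1.
    by rewrite /cindic rnorm_real ger0_norm// indicE lern1 leq_b1.
  by have [] := cLfunMb P (cLfun_meas (Yq l)) i1 xp.
under eq_bigr do rewrite (cnormX P (Yx _)).
have mYx l : measurable_fun setT (fun s => (rnorm (cindic R (Y l) s * Lp_fun x s) `^ p)%:E).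
  by apply: measurable_rnorm_powR; exact: cLfun_meas (Yx l).
rewrite -(ge0_integral_sum _ measurableT mYx); last by move=> l s _; rewrite lee_fin powR_ge0.
apply: ge0_le_integral => //.
- by move=> s _; apply: sume_ge0 => l _; rewrite lee_fin powR_ge0.
- by apply: emeasurable_sum => l; exact: mYx.
- by apply: measurable_rnorm_powR; exact: cLfun_meas xp.
move=> s _; rewrite sumEFin lee_fin.
have [Ks|Ks] := pselect (K s); last first.
  rewrite big1 ?powR_ge0// => l _; rewrite cindicE asboolF ?mul0r ?rnorm0 ?powR0 ?gt_eqF//.
  by move/YK.
have [_ _ hY] := KY; have [l hl] := hY s Ks.
rewrite (bigD1 l)//= big1 ?addr0; last first.
  move=> j jl; rewrite cindicE asboolF ?mul0r ?rnorm0 ?powR0 ?gt_eqF//.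
  by move=> /hl jE; rewrite jE eqxx in jl.
by rewrite cindicE asboolT ?mul1r//; apply/hl.
Qed.

Lemma avg_in : avg_fun \in @bounded_linear R LpG LpG.
Proof.
rewrite inE; split; first exact: avg_linear.
by exists 1 => x; rewrite mul1r; exact: avg_norm.
Qed.

Definition avg : Bop LpG LpG := exist _ avg_fun avg_in.

Lemma step_null (u : 'I_n -> R[i]) : (forall l, m l != 0 -> u l = 0) -> clp (step Y u) = 0.
Proof.
move=> u0; have p0 : 0 < p by exact: lt_trans p1.
have st := step_cLfun mu_haar cK KY P u.
apply: rnorm0_eq0; rewrite (Lp_class_norm P st).
have := cnorm_step mu_haar cK KY P u; rewrite big1 => [|l _].
  by move=> /eqP; rewrite powR_eq0 => /andP[/eqP].
rewrite -/(m l); have [->|/u0 ->] := eqVneq (m l) 0; first by rewrite mulr0.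
by rewrite rnorm0 powR0 ?mul0r// gt_eqF.
Qed.

Lemma step_mul l (w : 'I_n -> R[i]) s : cindic R (Y l) s * step Y w s = w l * cindic R (Y l) s.
Proof.
rewrite cindicE; case: asboolP => Ys; last by rewrite mul0r mulr0.
have [_ YK hY] := KY; have [i hi] := hY s (YK l s Ys).
have [j [Yj ->]] := partition_in R KY (YK l s Ys).
by rewrite mul1r mulr1; congr w; transitivity i; [apply/hi|apply/esym/hi].
Qed.

(** The mean over a piece returns the coefficient [w l], except on null pieces, which do not change
    the class. *)
Lemma avg_step w : avg (clp (step Y w)) = clp (step Y w).
Proof.
have st := step_cLfun mu_haar cK KY P.
apply/eqP; rewrite -subr_eq0; apply/eqP.
rewrite -[avg _]/(clp (step Y (mean^~ (clp (step Y w))))) -(Lp_classB P (st _) (st w)).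
rewrite (_ : _ - _ = step Y (fun l => mean l (clp (step Y w)) - w l)); last first.
  apply/funext => s; rewrite -[LHS]/(step Y _ s - step Y w s) /step !fct_sumE -sumrB.
  by apply: eq_bigr => l _; exact: esym (mulrBl _ _ _).
apply: step_null => l ml; rewrite /mean (Lpair_class P Q pp' (Yq l) (st w)).
rewrite (_ : (fun t => _) = w l *: cindic R (Y l)); last first.
  by apply/funext => s; exact: step_mul.
have [mY _ _] := KY; have fY := partition_fin mu_haar cK KY l.
have [Y1 _] := cnorm_cindic (lexx 1) (mY l) fY.
rewrite (cintegralZ _ Y1) (cintegral_cindic (mY l) fY) -/(m l) mulrCA -rmorphM mulVf//.
by rewrite mulr1 subrr.
Qed.

(** Averages fix step functions and are contractions, so f and its average are both close to the
    same step function. *)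
Lemma avg_close (f : borel G -> R[i]) w (e : R) : 0 <= e -> cmeasurable f ->
  (forall x, ~ K x -> f x = 0) -> (forall l x, Y l x -> rnorm (f x - w l) <= e) ->
  rnorm (avg (clp f) - clp f) <= 2 * e * fine (mu K) `^ p^-1.
Proof.
move=> e0 mf fK fw; have [fp fn] := step_close mu_haar cK KY P e0 mf fK fw.
have st := step_cLfun mu_haar cK KY P w.
have n1 : rnorm (clp f - clp (step Y w)) <= e * fine (mu K) `^ p^-1.
  by rewrite -(Lp_classB P fp st) (Lp_class_norm P (cLfun_sub P fp st)).
rewrite (_ : _ - _ = avg (clp f - clp (step Y w)) - (clp f - clp (step Y w))); last first.
  have -> : avg (clp f - clp (step Y w)) = avg (clp f) - avg (clp (step Y w)) by exact: raddfB.
  by rewrite avg_step opprB addrA subrK.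
rewrite (le_trans (ler_rnormD _ _))// rnormN -mulrA mulr_natl mulr2n lerD//.
exact: le_trans (avg_norm _) n1.
Qed.

Variable S : Bop LpG LpG.

Lemma comp_avg_in : (fun x => S (avg x)) \in @bounded_linear R LpG LpG.
Proof.
rewrite inE; split; first by move=> a x y; rewrite !linearP.
exists (opnorm S) => x; rewrite (le_trans (opnormP _ _))//.
by rewrite ler_wpM2l ?opnorm_ge0//; exact: avg_norm.
Qed.

Definition comp_avg : Bop LpG LpG := exist _ (fun x => S (avg x)) comp_avg_in.

Lemma comp_avg_norm : opnorm comp_avg <= opnorm S.
Proof.
apply: ge_sup; first by exists (rnorm (comp_avg 0)), 0 => //=; rewrite rnorm0.
move=> _ [x /= x1 <-]; apply: (le_trans (opnormP S (avg x))).
by rewrite ler_piMr ?opnorm_ge0//; apply: le_trans (avg_norm x) x1.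
Qed.

Variable phi : borel G -> R[i].
Hypothesis phic : Cc phi.

Let GS l : borel G -> R[i] := fun s => phi s * Lp_fun (S (clp (cindic R (Y l)))) s.
Let HS l : borel G -> R[i] := fun s => cindic R (Y l) s * (h s)%:C.

Let GS1 l : GS l \in cLfun mu 1.
Proof.
by have [] := cLfun_hoelder P Q pp' (Cq phic) (Lp_cLfun (S (clp (cindic R (Y l))))).
Qed.

Let HS1 l : HS l \in cLfun mu 1.
Proof. by have [] := cLfun_hoelder P Q pp' (Yq l) (Cp hc). Qed.

(** The gain from finite rank: f is seen only through its means, and g is paired only with the
    finitely many functions S 1_(Y_l). Each term is thus a correlation with g times a correlation
    with f. *)
Lemma smooth_int_avg g f y : Cc g -> Cc f ->
  smooth_int comp_avg phi g f y =
    \sum_l (((m l)^-1)%:C : R[i]) * (corr mu (GS l) g y * corr mu (HS l) f y).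
Proof.
move=> gc fc; have [M M0 phiM] := Cc_bounded phic.
have [pg _] := phi_in Q (continuous_cmeasurable phic.1) phiM (rtrans_in mu_haar Q y gc).
have [mY _ _] := KY.
have Yp l : cindic R (Y l) \in cLfun mu p.
  by have [] := cnorm_cindic P (mY l) (partition_fin mu_haar cK KY l).
pose w := mean^~ (clp (twist h y f)).
have vin l : w l *: cindic R (Y l) \in cLfun mu p by exact: (cLfunZ P (w l) (Yp l)).
have E : comp_avg (clp (twist h y f)) = \sum_l w l *: S (clp (cindic R (Y l))).
  transitivity (S (clp (step Y w))); first by [].
  rewrite /step (Lp_class_sum P _ vin) raddf_sum; apply: eq_bigr => l _.
  by rewrite (Lp_classZ P _ (Yp l)); exact: linearZ.
rewrite /smooth_int E (bilinear_sumr Lpb); apply: eq_bigr => l _.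
rewrite (bilinearZr Lpb) /w /mean (Lpair_class P Q pp' (Yq l) (Cp (twist_Cc hc y fc))).
rewrite (Lpair_classl Q pp' _ pg) -mulrA mulrC -[RHS]mulrC; congr (_ * _).
rewrite [LHS]mulrC /corr; congr (_ * _); congr cintegral; apply/funext => s.
  by rewrite mulrAC.
by rewrite /HS -[RHS]mulrA.
Qed.

(** C depends on the partition, S, phi and h but not on the tensor. Hence the form of the averaged
    operator sees a tensor only through its coefficient function, which M bounds. *)
Lemma smooth_form_avg_bound : exists2 C : R, 0 <= C &
  forall N (g f : 'I_N -> G -> R[i]) (M : R), 0 <= M ->
  (forall j, Cc (g j)) -> (forall j, Cc (f j)) ->
  (forall s, rnorm (\sum_j pair (clq (g j)) (ltr s (clp (f j)))) <= M) ->
  rnorm (\sum_j smooth_form comp_avg phi (g j) (f j)) <= C * M.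
Proof.
have [cphi [K1 cK1 phiK]] := phic.
have GK l s : ~ K1 s -> GS l s = 0 by move=> /phiK Ks; rewrite /GS Ks mul0r.
have HK l s : ~ K s -> HS l s = 0.
  move=> Ks; rewrite /HS cindicE asboolF ?mul0r//.
  by have [_ YK _] := KY; move/YK.
exists (\sum_l (m l)^-1 * (cnorm mu 1 (GS l) * cnorm mu 1 (HS l))).
  by apply: sumr_ge0 => l _; rewrite !mulr_ge0 ?invr_ge0 ?cnorm_ge0.
move=> N g f M M0 gc fc gfM.
have kM s z : rnorm (\sum_j cintegral mu (fun y => g j (s * y)%g * f j (z * y)%g)) <= M.
  (* The substitution of s^-1 y for y makes the integral a pairing of g_j with the left translate of
     f_j by z s^-1. *)
  apply: le_trans (gfM (z * s^-1)%g); rewrite le_eqVlt; apply/orP; left; apply/eqP.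
  congr rnorm; apply: eq_bigr => j _.
  have [fz _] := cLfun_ltrans mu_haar P (z * s^-1)%g (Cp (fc j)).
  rewrite (ltr_class mu_haar P _ (Cp (fc j))) (Lpair_class P Q pp' (Cq (gc j)) fz).
  have [gf1 _] := cLfun_hoelder P Q pp' (Cq (gc j)) fz.
  rewrite -(cintegral_ltrans mu_haar s gf1); congr cintegral; apply/funext => y.
  by rewrite /ltrans mulgA -(mulgA z) mulVg mulg1.
have cc l j : Cc (fun y => corr mu (GS l) (g j) y * corr mu (HS l) (f j) y).
  have [cg _] := corr_Cc (GS1 l) cK1 (GK l) (gc j).
  exact: (CcMl (corr_Cc (HS1 l) cK (HK l) (fc j)) cg).
have cc1 l j := Cc_cLfun mu_haar (lexx 1) (cc l j).
have cc2 l := cLfun_sum (lexx 1) (index_enum 'I_N) (cc1 l).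
have E : \sum_j smooth_form comp_avg phi (g j) (f j) = \sum_l (((m l)^-1)%:C : R[i]) *
    cintegral mu (fun y => \sum_j corr mu (GS l) (g j) y * corr mu (HS l) (f j) y).
  transitivity (\sum_j \sum_l (((m l)^-1)%:C : R[i]) *
      cintegral mu (fun y => corr mu (GS l) (g j) y * corr mu (HS l) (f j) y)).
    apply: eq_bigr => j _.
    rewrite /smooth_form (_ : (smooth_int _ _ _ _ : _ -> _) = \sum_l (((m l)^-1)%:C : R[i]) *:
      (fun y => corr mu (GS l) (g j) y * corr mu (HS l) (f j) y)); last first.
      by apply/funext => y; rewrite (smooth_int_avg y (gc j) (fc j)) fct_sumE.
    rewrite (cintegral_sum _ (fun l => cLfunZ (lexx 1) _ (cc1 l j))).
    by apply: eq_bigr => l _; rewrite (cintegralZ _ (cc1 l j)).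
  rewrite exchange_big/=; apply: eq_bigr => l _; rewrite -mulr_sumr; congr (_ * _).
  rewrite -(cintegral_sum _ (cc1 l)); congr cintegral; apply/funext => y.
  by rewrite fct_sumE.
rewrite E (le_trans (rnorm_sum _ _ _))// mulr_suml; apply: ler_sum => l _.
rewrite rnormM rnorm_real ger0_norm ?invr_ge0// -!mulrA ler_wpM2l ?invr_ge0//.
exact: (corr_pair_bound mu_haar (GS1 l) (HS1 l) cK1 cK (GK l) (HK l) gc fc M0 (fun s z _ _ => kM s z)).
Qed.

End averaging.

End compact_multiplier.

Lemma ltrans_unif (R : realType) (G : lcGroupType) (f : G -> R[i]) (s0 : G) (e : R) :
  Cc f -> 0 < e -> \forall s \near s0, forall t, rnorm (f (s * t)%g - f (s0 * t)%g) < e.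
Proof.
move=> [cf [K cK fK]] e0; have [W Wy cW] := @lc_nbhs G s0.
pose K' := [set (a.1 * a.2)%g | a in [set (w^-1)%g | w in W] `*` K].
have cK' : compact K' by apply: compact_mulg => //; exact: compact_invg.
have fK' : \forall s \near s0, forall t, ~ K' t -> f (s * t)%g = 0.
  apply: filterS Wy => s Ws t nt; apply: fK => Kst; apply: nt.
  exists ((s^-1)%g, (s * t)%g) => /=; last by rewrite mulgA mulVg mul1g.
  by split => //=; exists s.
apply: (@kernel_unif R G (fun s t => f (s * t)%g) s0 K' cK' fK' _ e e0) => t.
apply: (@continuous_comp _ _ _ (fun z : G * G => (z.1 * z.2)%g) f); last exact: cf.
by apply: cvg_mulg; [exact: cvg_fst|exact: cvg_snd].
Qed.

Section averaging_approximation.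
Context (R : realType) (G : lcGroupType) (mu : {measure set (borel G) -> \bar R}).
Hypothesis mu_haar : left_haar mu.
Variables (p p' : R) (p1 : 1 < p) (pp' : p^-1 + p'^-1 = 1).
Local Notation P := (ltW p1).
Local Notation Q := (ltW (conj_gt1 p1 pp')).
Local Notation LpG := (Lp mu P).
Local Notation LqG := (Lp mu Q).
Local Notation clp := (Lp_class mu P).
Local Notation clq := (Lp_class mu Q).
Local Notation pair := (@Lpair _ _ _ mu p p' P Q).
Local Notation Lpb := (@Lpair_bilinear _ _ _ mu p p' P Q pp').
Variables (h : G -> R) (hc : Cc (fun x => (h x)%:C)).
Local Notation smooth_int := (smooth_int pp' h).
Local Notation smooth_form := (smooth_form pp' h).
Variables (phi : borel G -> R[i]) (phic : Cc phi) (S : Bop LpG LpG).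
Implicit Types (f g : G -> R[i]).

Let Cq g : Cc g -> g \in cLfun mu p'. Proof. exact: (Cc_cLfun mu_haar Q). Qed.
Let Cp f : Cc f -> f \in cLfun mu p. Proof. exact: (Cc_cLfun mu_haar P). Qed.

Lemma smooth_form_close g f : Cc g -> Cc f -> exists2 C : R, 0 <= C &
  forall (S' : Bop LpG LpG) (d : R), 0 <= d ->
  (forall y, rnorm (S' (clp (twist h y f)) - S (clp (twist h y f))) <= d) ->
  rnorm (smooth_form S' phi g f - smooth_form S phi g f) <= d * C.
Proof.
move=> gc fc; have [M M0 phiM] := Cc_bounded phic.
have [B B0 gB] := Cc_bounded gc.
have mphi := continuous_cmeasurable phic.1.
have [L cL fL] := twist_support hc fc.
exists (B * cnorm mu p' phi * fine (mu L)).
  by rewrite !mulr_ge0 ?cnorm_ge0// fine_ge0.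
move=> S' d d0 hd.
have i1 := smooth_int_in mu_haar pp' hc S' mphi phiM gc fc.
have i2 := smooth_int_in mu_haar pp' hc S mphi phiM gc fc.
have Bd0 : 0 <= d * (B * cnorm mu p' phi) by rewrite !mulr_ge0 ?cnorm_ge0.
rewrite /smooth_form -(cintegralB i1 i2) (le_trans (rnorm_cintegral (cLfun_sub (lexx 1) i1 i2)))//.
have lD y : L y -> rnorm (smooth_int S' phi g f y - smooth_int S phi g f y) <=
    d * (B * cnorm mu p' phi).
  move=> _; rewrite /smooth_int -(bilinearBr Lpb) (le_trans (Lpair_bound pp' _ _))//.
  have [pg pn] := cLfunMb Q (cLfun_meas (rtrans_in mu_haar Q y gc))
    (fun s => gB (s * y)%g) (Cq phic).
  rewrite [leRHS]mulrC ler_pM ?rnorm_ge0//; last exact: hd.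
  rewrite (_ : (fun s => _) = (fun s => rtrans y g s * phi s)).
    by rewrite (Lp_class_norm Q pg).
  by apply/funext => s; rewrite mulrC.
have lD0 y : ~ L y -> smooth_int S' phi g f y - smooth_int S phi g f y = 0.
  by move=> Ly; rewrite !(smooth_int0 _ _ _ _ (fL y Ly)) subrr.
have [_] := cnorm_sup (lexx 1) (compact_borel cL) (haar_compact mu_haar cL)
  (cLfun_meas (cLfun_sub (lexx 1) i1 i2)) Bd0 lD lD0.
by rewrite invr1 powRr1 ?fine_ge0// -[leRHS]mulrA.
Qed.

(** The averages must be close on all functions h f_y at once. On a piece near s0 the function h(s)
    f(s y) is nearly constant uniformly in y, by uniform continuity of left translations, so one
    partition of the support of h serves every y. *)
Lemma averaging_exists N (g f : 'I_N -> G -> R[i]) (eta : R) :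
  (forall j, Cc (g j)) -> (forall j, Cc (f j)) -> 0 < eta ->
  exists S' : Bop LpG LpG, [/\ opnorm S' <= opnorm S,
    forall j, rnorm (smooth_form S' phi (g j) (f j) - smooth_form S phi (g j) (f j)) <= eta &
    exists2 C : R, 0 <= C & forall N' (g' f' : 'I_N' -> G -> R[i]) (M : R), 0 <= M ->
      (forall j, Cc (g' j)) -> (forall j, Cc (f' j)) ->
      (forall s, rnorm (\sum_j pair (clq (g' j)) (ltr s (clp (f' j)))) <= M) ->
      rnorm (\sum_j smooth_form S' phi (g' j) (f' j)) <= C * M].
Proof.
move=> gc fc eta0.
have /choice[c hcl] j : exists c : R, 0 <= c /\ forall (S' : Bop LpG LpG) (d : R), 0 <= d ->
    (forall y, rnorm (S' (clp (twist h y (f j))) - S (clp (twist h y (f j)))) <= d) ->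
    rnorm (smooth_form S' phi (g j) (f j) - smooth_form S phi (g j) (f j)) <= d * c.
  by have [c c0 hcl] := smooth_form_close (gc j) (fc j); exists c.
have [ch [K cK hK]] := hc.
pose k := fine (mu K) `^ p^-1; have k0 : 0 <= k by exact: powR_ge0.
have S0 := opnorm_ge0 S.
have c0 : 0 <= opnorm S * (2 * k) * \sum_j c j.
  by rewrite !mulr_ge0// sumr_ge0// => j _; case: (hcl j).
have [d d0 /ltW dC] := small_factor c0 eta0.
have /choice[B hB] j : exists B : R, 0 <= B /\ forall x, rnorm (f j x) <= B.
  by have [B B0 fB] := Cc_bounded (fc j); exists B.
have [Mh Mh0 hM] := Cc_bounded hc.
have nN s0 : K s0 -> nbhs s0 [set s | forall j y,
    rnorm (twist h y (f j) s - twist h y (f j) s0) <= d].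
  move=> _; apply: (@filter_forall _ 'I_N (fun j s => forall y,
    rnorm (twist h y (f j) s - twist h y (f j) s0) <= d)) => j.
  have [B0 fB] := hB j.
  have [d1 d10 d1B] := small_factor (addr_ge0 Mh0 B0) d0.
  have /cvg_rnormP/(_ _ d10) h1 := ch s0.
  apply: filterS2 h1 (ltrans_unif s0 (fc j) d10) => s h1 h2 y.
  rewrite (_ : _ - _ = (h s)%:C * (f j (s * y)%g - f j (s0 * y)%g) +
    ((h s)%:C - (h s0)%:C) * f j (s0 * y)%g); last by rewrite mulrBr mulrBl subrKA.
  apply: (le_trans (ler_rnormD _ _)); rewrite !rnormM.
  apply: le_trans (ltW d1B); rewrite mulrDr; apply: lerD.
    by rewrite [leRHS]mulrC ler_pM ?rnorm_ge0//; exact: ltW.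
  by rewrite ler_pM ?rnorm_ge0// rnormBC ltW.
have [n [Y [z [mY YK _ YN hY]]]] := compact_partition cK nN.
have KY : partition_of K Y by split.
exists (comp_avg mu_haar pp' cK KY S); split.
- exact: comp_avg_norm.
- move=> j; have d2 : 0 <= opnorm S * (2 * d * k) by rewrite !mulr_ge0// ltW.
  apply: le_trans ((hcl j).2 _ _ d2 _) _ => [y|].
    rewrite -[Bop_fun (comp_avg _ _ _ _ _) _]/(S (avg mu_haar p1 pp' cK KY _)) -raddfB.
    rewrite (le_trans (opnormP _ _))// ler_wpM2l//.
    apply: (avg_close mu_haar p1 pp' cK KY (w := fun l => twist h y (f j) (z l)) (ltW d0)).
    + exact: continuous_cmeasurable (twist_Cc hc y (fc j)).1.
    + by move=> x Kx; rewrite /twist hK// mul0r.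
    + by move=> l x Yx; exact: YN.
  apply: le_trans dC.
  rewrite [leRHS](_ : _ = opnorm S * (2 * d * k) * \sum_j c j); last by ring.
  rewrite ler_wpM2l// (bigD1 j)//= lerDl sumr_ge0// => i _.
  by case: (hcl i).
- exact: smooth_form_avg_bound.
Qed.

End averaging_approximation.

(** * The functional q *)

Lemma complex_cauchy (R : realType) (u : nat -> R[i]) :
  (forall e : R, 0 < e -> exists N, forall m n, (N <= m)%N -> (N <= n)%N ->
    rnorm (u m - u n) < e) ->
  exists l : R[i], u @ \oo --> l.
Proof.
move=> uc.
have real_cauchy (r : R[i] -> R) : (forall a b, `|r a - r b| <= rnorm (a - b)) ->
    exists l : R, forall e : R, 0 < e -> \forall n \near \oo, `|l - r (u n)| < e.
  move=> hr; have : cvg (r (u n) @[n --> \oo]).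
    apply: cauchy_cvg; apply: cauchy_exP => e e0.
    have [N hN] := uc _ e0; exists (r (u N)); exists N => // n /= Nn.
    by rewrite /ball/=; apply: le_lt_trans (hr _ _) _; exact: hN.
  move=> ru; exists (lim (r (u n) @[n --> \oo])) => e e0.
  by have /cvgrPdist_lt/(_ _ e0) := ru.
have [a ha] := real_cauchy (@complex.Re R) (fun z w => ltac:(rewrite -raddfB; exact: ler_Re_rnorm)).
have [b hb] := real_cauchy (@complex.Im R) (fun z w => ltac:(rewrite -raddfB; exact: ler_Im_rnorm)).
exists (a +i* b); apply/cvg_rnormP => e e0.
have e2 : 0 < e / 2 by rewrite divr_gt0.
apply: filterS2 (ha _ e2) (hb _ e2) => n h1 h2.
rewrite (le_lt_trans (rnorm_le_ReIm _))// !raddfB/= [ltRHS]splitr.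
by rewrite ltrD.
Qed.

Lemma ge0_small_le0 (R : realType) (x C : R) : 0 <= C ->
  (forall e : R, 0 < e -> x <= C * e) -> x <= 0.
Proof.
move=> C0 h; apply/ler_addgt0Pr => eta eta0; rewrite add0r.
have [e e0 /ltW eC] := small_factor C0 eta0; apply: le_trans (h e e0) _.
by rewrite mulrC.
Qed.

Definition bounded_bilinear (R : realType) (X Y : normedModType R[i])
    (B : X -> Y -> R[i]) (C : R) :=
  [/\ 0 <= C, bilinear_form B & forall x y, rnorm (B x y) <= C * (rnorm x * rnorm y)].

(** * Bilinear forms given on dense subspaces *)

Section bilinear_extension.
Context (R : realType) (X Y : normedModType R[i]) (V W : lmodType R[i]).
Variables (D : set V) (E : set W) (i : V -> X) (j : W -> Y) (b : V -> W -> R[i]).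
Hypotheses (DL : forall a v v', D v -> D v' -> D (a *: v + v'))
  (EL : forall a w w', E w -> E w' -> E (a *: w + w'))
  (iL : forall a v v', D v -> D v' -> i (a *: v + v') = a *: i v + i v')
  (jL : forall a w w', E w -> E w' -> j (a *: w + w') = a *: j w + j w')
  (iD : forall x (e : R), 0 < e -> exists2 v, D v & rnorm (x - i v) < e)
  (jD : forall y (e : R), 0 < e -> exists2 w, E w & rnorm (y - j w) < e)
  (bl : forall a v v' w, D v -> D v' -> E w -> b (a *: v + v') w = a * b v w + b v' w)
  (br : forall a v w w', D v -> E w -> E w' -> b v (a *: w + w') = a * b v w + b v w').
Variables (C : R) (C0 : 0 <= C).
Hypothesis bC : forall v w, D v -> E w -> rnorm (b v w) <= C * (rnorm (i v) * rnorm (j w)).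

Let b_diff v w v' w' : D v -> E w -> D v' -> E w' -> rnorm (b v w - b v' w') <=
  C * (rnorm (i v - i v') * rnorm (j w) + rnorm (i v') * rnorm (j w - j w')).
Proof.
move=> Dv Ew Dv' Ew'.
have -> : b v w - b v' w' = b (-1 *: v' + v) w + b v' (-1 *: w' + w).
  by rewrite bl// br//; ring.
rewrite (le_trans (ler_rnormD _ _))// mulrDr lerD//.
  by rewrite (le_trans (bC (DL _ Dv' Dv) Ew))// iL// scaleN1r addrC.
by rewrite (le_trans (bC Dv' (EL _ Ew' Ew)))// jL// scaleN1r addrC.
Qed.

Let near_unif x y (e : R) : 0 < e -> exists2 d : R, 0 < d &
  forall v w v' w', D v -> E w -> D v' -> E w' ->
    rnorm (x - i v) < d -> rnorm (y - j w) < d ->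
    rnorm (x - i v') < d -> rnorm (y - j w') < d -> rnorm (b v w - b v' w') < e.
Proof.
move=> e0; pose A := 2 * C * (rnorm x + rnorm y + 2).
have A0 : 0 <= A by rewrite !mulr_ge0// !addr_ge0 ?rnorm_ge0.
have [d d0 dA] := small_factor A0 e0.
exists (Num.min d 1) => [|v w v' w' Dv Ew Dv' Ew']; first by rewrite lt_min d0 ltr01.
rewrite !lt_min => /andP[h1 _] /andP[h2 h2'] /andP[h3 h3'] /andP[h4 _].
apply: le_lt_trans dA; apply: le_trans (b_diff Dv Ew Dv' Ew') _.
have n1 : rnorm (i v - i v') <= 2 * d.
  rewrite (_ : i v - i v' = (x - i v') - (x - i v)); last by rewrite opprB [RHS]addrC addrA subrK.
  by rewrite (le_trans (ler_rnormD _ _))// rnormN mulr_natl mulr2n lerD// ltW.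
have n2 : rnorm (j w - j w') <= 2 * d.
  rewrite (_ : j w - j w' = (y - j w') - (y - j w)); last by rewrite opprB [RHS]addrC addrA subrK.
  by rewrite (le_trans (ler_rnormD _ _))// rnormN mulr_natl mulr2n lerD// ltW.
have n3 : rnorm (j w) <= rnorm y + 1.
  rewrite (_ : j w = y - (y - j w)); last by rewrite opprB addrC subrK.
  by rewrite (le_trans (ler_rnormD _ _))// rnormN lerD2l ltW.
have n4 : rnorm (i v') <= rnorm x + 1.
  rewrite (_ : i v' = x - (x - i v')); last by rewrite opprB addrC subrK.
  by rewrite (le_trans (ler_rnormD _ _))// rnormN lerD2l ltW.
rewrite (_ : d * A = C * (2 * d * (rnorm y + 1) + (rnorm x + 1) * (2 * d))); last by rewrite /A; ring.
by rewrite ler_wpM2l// lerD// ler_pM ?rnorm_ge0.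
Qed.

(** The limit is over all approximants of (x, y), not along one sequence; bilinearity and the bounds
    then follow by comparing any suitable approximants. *)
Let limit_exists x y : exists z, forall e : R, 0 < e -> exists2 d : R, 0 < d &
  forall v w, D v -> E w -> rnorm (x - i v) < d -> rnorm (y - j w) < d ->
  rnorm (z - b v w) < e.
Proof.
have eps n : 0 < n.+1%:R^-1 :> R by rewrite invr_gt0 ltr0n.
have /choice[v hv] n : exists v, D v /\ rnorm (x - i v) < n.+1%:R^-1.
  by have [v] := iD x (eps n); exists v.
have /choice[w hw] n : exists w, E w /\ rnorm (y - j w) < n.+1%:R^-1.
  by have [w] := jD y (eps n); exists w.
have small (d : R) : 0 < d -> \forall n \near \oo,
    rnorm (x - i (v n)) < d /\ rnorm (y - j (w n)) < d.
  move=> d0; apply: filterS (near_infty_natSinv_lt (PosNum d0)) => n /= nd.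
  by split; [apply: lt_trans nd; case: (hv n)|apply: lt_trans nd; case: (hw n)].
have [z zP] : exists z : R[i], b (v n) (w n) @[n --> \oo] --> z.
  apply: complex_cauchy => e e0; have [d d0 hd] := near_unif x y e0.
  have [N _ hN] := small d d0; exists N => m n /hN[m1 m2] /hN[n1 n2].
  by have [[? _] [? _] [? _] [? _]] := And4 (hv m) (hw m) (hv n) (hw n); exact: hd.
exists z => e e0; have e2 : 0 < e / 2 by rewrite divr_gt0.
have [d d0 hd] := near_unif x y e2; exists d => // v' w' Dv' Ew' h1 h2.
have /cvg_rnormP/(_ _ e2) hz := zP.
have [n [h3 [h4 h5]]] := filter_ex (filterI hz (small d d0)).
rewrite (_ : z - _ = (z - b (v n) (w n)) + (b (v n) (w n) - b v' w')); last by rewrite addrA subrK.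
rewrite (le_lt_trans (ler_rnormD _ _))// [ltRHS]splitr ltrD//.
by have [[? _] [? _]] := (hv n, hw n); exact: hd.
Qed.

(** One extension inherits every bound c that holds on the dense subspaces, not merely the constant
    C used to build it. Later the same form is estimated with several constants. *)
Lemma bilinear_extension : exists B : X -> Y -> R[i], [/\ bilinear_form B,
  forall v w, D v -> E w -> B (i v) (j w) = b v w &
  forall c, 0 <= c ->
    (forall v w, D v -> E w -> rnorm (b v w) <= c * (rnorm (i v) * rnorm (j w))) ->
    forall x y, rnorm (B x y) <= c * (rnorm x * rnorm y)].
Proof.
pose B x y := sval (cid (limit_exists x y)).
have hB x y := svalP (cid (limit_exists x y)); rewrite -/(B _ _) in hB.
exists B; split.
- split=> [y a x x'|x a y y'].
  + apply/eqP; rewrite -subr_eq0; apply/eqP/rnorm0_eq0/eqP; rewrite eq_le rnorm_ge0 andbT.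
    have a0 : 0 <= rnorm a + 2 by rewrite addr_ge0 ?rnorm_ge0.
    apply: (ge0_small_le0 a0) => e e0.
    have [d1 d10 h1] := hB x y e e0; have [d2 d20 h2] := hB x' y e e0.
    have [d3 d30 h3] := hB (a *: x + x') y e e0.
    have [k k0 ka] := small_factor (addr_ge0 (rnorm_ge0 a) ler01) d30.
    have [v Dv] := iD x (e := Num.min d1 k) ltac:(by rewrite lt_min d10).
    rewrite lt_min => /andP[v1 v2].
    have [v' Dv'] := iD x' (e := Num.min d2 k) ltac:(by rewrite lt_min d20).
    rewrite lt_min => /andP[v1' v2'].
    have [w Ew] := jD y (e := Num.min d1 (Num.min d2 d3)) ltac:(by rewrite !lt_min d10 d20).
    rewrite !lt_min => /and3P[w1 w2 w3].
    have n3 : rnorm (a *: x + x' - i (a *: v + v')) < d3.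
      rewrite iL// opprD addrACA -scalerBr; apply: le_lt_trans (ler_rnormD _ _) _.
      apply: le_lt_trans ka; rewrite rnormZ mulrDr mulr1 lerD//; last exact: ltW.
      by rewrite mulrC ler_wpM2r ?rnorm_ge0// ltW.
    have := h3 _ _ (DL a Dv Dv') Ew n3 w3; rewrite bl// => h3'.
    rewrite (_ : _ - _ = (B (a *: x + x') y - (a * b v w + b v' w)) -
      (a * (B x y - b v w) + (B x' y - b v' w))); last by rewrite mulrBr; ring.
    rewrite (le_trans (ler_rnormD _ _))// rnormN.
    rewrite [leRHS](_ : _ = e + (rnorm a * e + e)); last by ring.
    rewrite lerD//; first exact: ltW.
    rewrite (le_trans (ler_rnormD _ _))// rnormM lerD//; last by apply: ltW; exact: h2.
    by rewrite ler_wpM2l ?rnorm_ge0// ltW//; exact: h1.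
  + apply/eqP; rewrite -subr_eq0; apply/eqP/rnorm0_eq0/eqP; rewrite eq_le rnorm_ge0 andbT.
    have a0 : 0 <= rnorm a + 2 by rewrite addr_ge0 ?rnorm_ge0.
    apply: (ge0_small_le0 a0) => e e0.
    have [d1 d10 h1] := hB x y e e0; have [d2 d20 h2] := hB x y' e e0.
    have [d3 d30 h3] := hB x (a *: y + y') e e0.
    have [k k0 ka] := small_factor (addr_ge0 (rnorm_ge0 a) ler01) d30.
    have [w Ew] := jD y (e := Num.min d1 k) ltac:(by rewrite lt_min d10).
    rewrite lt_min => /andP[w1 w2].
    have [w' Ew'] := jD y' (e := Num.min d2 k) ltac:(by rewrite lt_min d20).
    rewrite lt_min => /andP[w1' w2'].
    have [v Dv] := iD x (e := Num.min d1 (Num.min d2 d3)) ltac:(by rewrite !lt_min d10 d20).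
    rewrite !lt_min => /and3P[v1 v2 v3].
    have n3 : rnorm (a *: y + y' - j (a *: w + w')) < d3.
      rewrite jL// opprD addrACA -scalerBr; apply: le_lt_trans (ler_rnormD _ _) _.
      apply: le_lt_trans ka; rewrite rnormZ mulrDr mulr1 lerD//; last exact: ltW.
      by rewrite mulrC ler_wpM2r ?rnorm_ge0// ltW.
    have := h3 _ _ Dv (EL a Ew Ew') v3 n3; rewrite br// => h3'.
    rewrite (_ : _ - _ = (B x (a *: y + y') - (a * b v w + b v w')) -
      (a * (B x y - b v w) + (B x y' - b v w'))); last by rewrite mulrBr; ring.
    rewrite (le_trans (ler_rnormD _ _))// rnormN.
    rewrite [leRHS](_ : _ = e + (rnorm a * e + e)); last by ring.
    rewrite lerD//; first exact: ltW.
    rewrite (le_trans (ler_rnormD _ _))// rnormM lerD//; last by apply: ltW; exact: h2.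
    by rewrite ler_wpM2l ?rnorm_ge0// ltW//; exact: h1.
- move=> v w Dv Ew; apply/eqP; rewrite -subr_eq0; apply/eqP/rnorm0_eq0/eqP.
  rewrite eq_le rnorm_ge0 andbT; apply: (ge0_small_le0 ler01) => e e0; rewrite mul1r ltW//.
  by have [d d0] := hB (i v) (j w) e e0; apply=> //; rewrite subrr rnorm0.
- move=> c c0 bc x y; rewrite -subr_le0.
  have A0 : 0 <= 1 + c * (rnorm x + rnorm y + 1) by rewrite addr_ge0 ?mulr_ge0 ?addr_ge0 ?rnorm_ge0.
  apply: (ge0_small_le0 A0) => e e0.
  have [d d0 hd] := hB x y e e0; pose k := Num.min d (Num.min e 1).
  have k0 : 0 < k by rewrite !lt_min d0 e0 ltr01.
  have [v Dv vk] := iD x k0; have [w Ew wk] := jD y k0.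
  have := hd v w Dv Ew; move: (vk) (wk); rewrite !lt_min => /andP[vd _] /andP[wd _].
  move=> /(_ vd wd)/ltW hle.
  have kd : k <= e /\ k <= 1 by rewrite /k !ge_min !lexx !orbT.
  have nv : rnorm (i v) <= rnorm x + k.
    rewrite (_ : i v = x - (x - i v)); last by rewrite opprB addrC subrK.
    by rewrite (le_trans (ler_rnormD _ _))// rnormN lerD2l ltW.
  have nw : rnorm (j w) <= rnorm y + k.
    rewrite (_ : j w = y - (y - j w)); last by rewrite opprB addrC subrK.
    by rewrite (le_trans (ler_rnormD _ _))// rnormN lerD2l ltW.
  have le1 : rnorm (B x y) <= e + c * ((rnorm x + k) * (rnorm y + k)).
    rewrite -[B x y](subrK (b v w)) (le_trans (ler_rnormD _ _))// lerD//.
    by rewrite (le_trans (bc _ _ Dv Ew))// ler_wpM2l// ler_pM ?rnorm_ge0.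
  rewrite lerBlDr (le_trans le1)//.
  have le2 : (rnorm x + k) * (rnorm y + k) <= rnorm x * rnorm y + (rnorm x + rnorm y + 1) * e.
    have := rnorm_ge0 x; have := rnorm_ge0 y; move: kd.
    by move: (rnorm x) (rnorm y) (ltW k0) => s t k0' [? ?] ? ?; nra.
  rewrite [leRHS](_ : _ = e + c * (rnorm x * rnorm y + (rnorm x + rnorm y + 1) * e)); last by ring.
  by rewrite lerD2l ler_wpM2l.
Qed.

End bilinear_extension.

(** * Elements of the projective tensor product as functionals on forms *)

Section tensors.
Context (R : realType) (X Y : normedModType R[i]).
Implicit Types (B : X -> Y -> R[i]) (u v : seq (X * Y)).

Lemma tensor_eval_sub B u v : bilinear_form B ->
  tensor_eval B (tensor_sub u v) = tensor_eval B u - tensor_eval B v.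
Proof.
move=> Bb; rewrite /tensor_eval /tensor_sub big_cat big_map/= -sumrN; congr (_ + _).
by apply: eq_bigr => z _; rewrite -scaleN1r (bilinearZl Bb) mulN1r.
Qed.

Lemma tensor_eval_bound B C u : bounded_bilinear B C ->
  rnorm (tensor_eval B u) <= C * \sum_(z <- u) rnorm z.1 * rnorm z.2.
Proof.
by move=> [_ _ BC]; rewrite (le_trans (rnorm_sum _ _ _))// mulr_sumr; apply: ler_sum.
Qed.

Lemma proj_norm_approx u (e : R) : 0 < e -> exists v, tensor_eq u v /\
  \sum_(z <- v) rnorm z.1 * rnorm z.2 < proj_norm u + e.
Proof.
move=> e0; pose A := [set \sum_(z <- v) rnorm z.1 * rnorm z.2 | v in [set v | tensor_eq u v]].
have hA : has_inf A.
  split; first by exists (\sum_(z <- u) rnorm z.1 * rnorm z.2), u.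
  by exists 0 => _ [v _ <-]; apply: sumr_ge0 => z _; rewrite mulr_ge0 ?rnorm_ge0.
by have [_ [v /= uv <-] lt] := inf_adherent e0 hA; exists v.
Qed.

Lemma tensor_eval_proj_norm B C u : bounded_bilinear B C ->
  rnorm (tensor_eval B u) <= C * proj_norm u.
Proof.
move=> BC; have [C0 Bb _] := BC; rewrite -subr_le0.
apply: (ge0_small_le0 C0) => e e0; rewrite lerBlDl -mulrDr.
have [v [uv vn]] := proj_norm_approx u e0.
rewrite (uv B Bb) (le_trans (tensor_eval_bound v BC))// ler_wpM2l//.
exact: ltW.
Qed.

(** N does not depend on B: the projective norm controls all forms with the same bound
    simultaneously. This uniformity is the source of all later estimates uniform in phi. *)
Lemma ptensor_eval_approx (u : ptensor X Y) (e : R) : 0 < e ->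
  exists N, forall n, (N <= n)%N -> forall B C, bounded_bilinear B C ->
  rnorm (ptensor_eval B u - tensor_eval B (sval u n)) <= C * e.
Proof.
move=> e0; have uc := svalP u; have [N hN] := uc e e0; exists N => n Nn B C BC.
have [C0 Bb _] := BC.
have diff a b : rnorm (tensor_eval B (sval u a) - tensor_eval B (sval u b)) <=
    C * proj_norm (tensor_sub (sval u a) (sval u b)).
  by rewrite -(tensor_eval_sub _ _ Bb); exact: tensor_eval_proj_norm.
have [l ul] : exists l : R[i], tensor_eval B (sval u n) @[n --> \oo] --> l.
  apply: complex_cauchy => d d0; have [k k0 kC] := small_factor C0 d0.
  have [M hM] := uc k k0; exists M => a b Ma Mb; apply: le_lt_trans kC.
  by rewrite mulrC (le_trans (diff a b))// ler_wpM2l// ltW// hM.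
have -> : ptensor_eval B u = l by exact: cvg_lim.
apply/ler_addgt0Pr => eta eta0.
have /cvg_rnormP/(_ _ eta0)[M _ hM] := ul.
pose k := maxn M N; pose t n := tensor_eval B (sval u n).
have le1 : rnorm (l - t k) <= eta by apply: ltW; apply: hM; exact: leq_maxl.
have le2 : rnorm (t k - t n) <= C * e.
  by apply: le_trans (diff k n) _; rewrite ler_wpM2l// ltW// hN// leq_maxr.
rewrite -/(t n) (_ : l - t n = (t k - t n) + (l - t k)); last by ring.
by rewrite (le_trans (ler_rnormD _ _))// lerD.
Qed.

End tensors.

Section approximable.
Context (R : realType) (G : lcGroupType) (mu : {measure set (borel G) -> \bar R}).
Hypothesis mu_haar : left_haar mu.
Variables (p q : R) (p1 : 1 <= p) (q1 : 1 <= q).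
Local Notation clp := (Lp_class mu p1).
Local Notation clq := (Lp_class mu q1).
Local Notation CcT := {g : G -> R[i] | Cc g}.
Implicit Types (B : Lp mu q1 -> Lp mu p1 -> R[i]).

Definition Cc_eval (b : (G -> R[i]) -> (G -> R[i]) -> R[i]) (v : seq (CcT * CcT)) : R[i] :=
  \sum_(z <- v) b (sval z.1) (sval z.2).

Definition on_Cc B g f := B (clq g) (clp f).

(* Elements of the projective tensor product, seen as functionals on bounded
   bilinear forms, up to their norm. *)
Definition approximable (e : (Lp mu q1 -> Lp mu p1 -> R[i]) -> R[i]) : Prop :=
  forall eps : R, 0 < eps -> exists v, forall B C, bounded_bilinear B C ->
    rnorm (e B - Cc_eval (on_Cc B) v) <= C * eps.

Lemma approximable_tensor_eval u : approximable (fun B => tensor_eval B u).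
Proof.
elim: u => [|[x y] u IH] eps eps0.
  exists [::] => B C [C0 _ _]; rewrite /tensor_eval /Cc_eval !big_nil subrr rnorm0.
  by rewrite mulr_ge0// ltW.
have e2 : 0 < eps / 2 by rewrite divr_gt0.
have [v hv] := IH _ e2.
have k0 : 0 <= rnorm x + 1 + rnorm y by rewrite !addr_ge0 ?rnorm_ge0.
have [d d0 dk] := small_factor k0 e2.
have d10 : 0 < Num.min d 1 by rewrite lt_min d0 ltr01.
have [g gc] := Lp_dense mu_haar x d10; rewrite lt_min => /andP[gd g1].
have [f fc] := Lp_dense mu_haar y d0 => fd.
exists ((exist _ g gc, exist _ f fc) :: v) => B C BC.
have [C0 Bb Bn] := BC; rewrite /tensor_eval /Cc_eval !big_cons/= /on_Cc.
rewrite opprD addrACA (le_trans (ler_rnormD _ _))// [eps]splitr mulrDr lerD//; last exact: hv.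
rewrite (_ : _ - _ = B (x - clq g) y + B (clq g) (y - clp f)); last first.
  by rewrite (bilinearBl Bb) (bilinearBr Bb) addrA subrK.
rewrite (le_trans (ler_rnormD _ _))// (le_trans (lerD (Bn _ _) (Bn _ _)))// -mulrDr ler_wpM2l//.
apply: le_trans (ltW dk).
have ng : rnorm (clq g) <= rnorm x + 1.
  rewrite (_ : clq g = x - (x - clq g)); last by rewrite opprB addrC subrK.
  by rewrite (le_trans (ler_rnormD _ _))// rnormN lerD2l ltW.
rewrite mulrDr addrC lerD//.
  by rewrite mulrC ler_pM ?rnorm_ge0// ltW.
by rewrite ler_wpM2r ?rnorm_ge0// ltW.
Qed.

Lemma approximable_ptensor u : approximable (fun B => ptensor_eval B u).
Proof.
move=> eps eps0; have e2 : 0 < eps / 2 by rewrite divr_gt0.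
have [N hN] := ptensor_eval_approx u e2.
have [v hv] := approximable_tensor_eval (sval u N) e2.
exists v => B C BC; rewrite -[ptensor_eval B u](subrK (tensor_eval B (sval u N))) -addrA.
rewrite (le_trans (ler_rnormD _ _))// [eps]splitr mulrDr lerD//; first exact: hN.
exact: hv.
Qed.

Lemma approximable_linear a e1 e2 : approximable e1 -> approximable e2 ->
  approximable (fun B => a * e1 B + e2 B).
Proof.
move=> h1 h2 eps eps0; have [d d0 da] := small_factor (addr_ge0 (rnorm_ge0 a) ler01) eps0.
have [v1 hv1] := h1 d d0; have [v2 hv2] := h2 d d0.
pose Z (z : CcT * CcT) : CcT * CcT := (exist _ (a *: sval z.1) (CcZ a (svalP z.1)), z.2).
exists (map Z v1 ++ v2) => B C BC; have [C0 Bb _] := BC.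
rewrite /Cc_eval big_cat big_map/=.
rewrite (_ : \sum_(z <- v1) _ = a * Cc_eval (on_Cc B) v1); last first.
  rewrite mulr_sumr; apply: eq_bigr => z _; rewrite /on_Cc/=.
  rewrite (Lp_classZ q1 a (Cc_cLfun mu_haar q1 (svalP z.1))).
  exact: bilinearZl.
rewrite opprD addrACA -mulrBr (le_trans (ler_rnormD _ _))// rnormM.
apply: (@le_trans _ _ (C * (d * (rnorm a + 1)))); last by rewrite ler_wpM2l// ltW.
rewrite [leRHS](_ : _ = rnorm a * (C * d) + C * d); last by ring.
rewrite lerD//; last exact: hv2.
by rewrite ler_wpM2l ?rnorm_ge0//; exact: hv1.
Qed.

Lemma approximable0 : approximable (fun=> 0).
Proof.
move=> eps eps0; exists [::] => B C [C0 _ _].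
by rewrite /Cc_eval big_nil subrr rnorm0 mulr_ge0// ltW.
Qed.

Lemma approximable_sum n (c : 'I_n -> R[i]) e : (forall i, approximable (e i)) ->
  approximable (fun B => \sum_i c i * e i B).
Proof.
elim: n c e => [|n IH] c e he.
  rewrite (_ : (fun B => _) = fun=> 0); first exact: approximable0.
  by apply/funext => B; rewrite big_ord0.
rewrite (_ : (fun B => _) = fun B => c ord0 * e ord0 B +
    \sum_i c (lift ord0 i) * e (lift ord0 i) B).
  by apply: approximable_linear => //; exact: IH.
by apply/funext => B; rewrite big_ord_recl.
Qed.

End approximable.

Lemma rnorm_linear_defect (R : realType) (a x y z u v : R[i]) (c1 c2 c3 : R) :
  rnorm (x - (a * u + v)) <= c1 -> rnorm (y - u) <= c2 -> rnorm (z - v) <= c3 ->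
  rnorm (x - (a * y + z)) <= c1 + (rnorm a * c2 + c3).
Proof.
move=> l1 l2 l3.
rewrite (_ : _ - _ = (x - (a * u + v)) - (a * (y - u) + (z - v))); last by ring.
rewrite (le_trans (ler_rnormD _ _))// rnormN lerD// (le_trans (ler_rnormD _ _))// rnormM lerD//.
by rewrite ler_wpM2l ?rnorm_ge0.
Qed.

Lemma rnorm_chain (R : realType) (V : normedModType R[i]) (x y z : V) (a b c : R) :
  rnorm (x - y) <= a -> rnorm (y - z) <= b -> rnorm z <= c -> rnorm x <= a + b + c.
Proof.
move=> l1 l2 l3.
have E : x = (x - y) + (y - z) + z.
  by rewrite addrA !subrK.
rewrite E.
apply: le_trans (ler_rnormD _ _) _; apply: lerD l3.
by apply: le_trans (ler_rnormD _ _) (lerD l1 l2).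
Qed.

Lemma Cc_eval_dist (R : realType) (G : lcGroupType) (b b' : (G -> R[i]) -> (G -> R[i]) -> R[i])
    (v : seq ({g : G -> R[i] | Cc g} * {g : G -> R[i] | Cc g})) (d : R) :
  (forall j, rnorm (b (sval (tnth (in_tuple v) j).1) (sval (tnth (in_tuple v) j).2) -
    b' (sval (tnth (in_tuple v) j).1) (sval (tnth (in_tuple v) j).2)) <= d) ->
  rnorm (Cc_eval b v - Cc_eval b' v) <= d * (size v)%:R.
Proof.
move=> bb'; rewrite /Cc_eval -sumrB big_tnth; apply: le_trans (rnorm_sum _ _ _) _.
apply: (@le_trans _ _ (\sum_(j < size v) d)); first by apply: ler_sum => j _; exact: bb'.
by rewrite sumr_const card_ord mulr_natr.
Qed.

Section smoothed_functional.
Context (R : realType) (G : lcGroupType) (mu : {measure set (borel G) -> \bar R}).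
Hypothesis mu_haar : left_haar mu.
Variables (Delta : G -> R) (hD : modular_function mu Delta).
Variables (p p' : R) (p1 : 1 < p) (pp' : p^-1 + p'^-1 = 1).
Local Notation P := (ltW p1).
Local Notation Q := (ltW (conj_gt1 p1 pp')).
Local Notation LpG := (Lp mu P).
Local Notation LqG := (Lp mu Q).
Local Notation clp := (Lp_class mu P).
Local Notation clq := (Lp_class mu Q).
Local Notation pair := (@Lpair _ _ _ mu p p' P Q).
Local Notation Lpb := (@Lpair_bilinear _ _ _ mu p p' P Q pp').
Variables (h : G -> R) (hc : Cc (fun x => (h x)%:C)) (h0 : forall x, 0 <= h x).
Hypothesis h1 : forall z,
  cintegral mu (fun y => (Delta (y^-1)%g * h (z * y^-1)%g)%:C) = 1.
Local Notation smooth_int := (smooth_int pp' h).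
Local Notation smooth_form := (smooth_form pp' h).
Implicit Types (phi psi : borel G -> R[i]) (f g : G -> R[i]) (S : Bop LpG LpG).
Implicit Types (B : LqG -> LpG -> R[i]).

Let Cq g : Cc g -> g \in cLfun mu p'. Proof. exact: (Cc_cLfun mu_haar Q). Qed.
Let Cp f : Cc f -> f \in cLfun mu p. Proof. exact: (Cc_cLfun mu_haar P). Qed.

(** The phi for which b_phi extends to a bounded form on L_p' and L_p, to which a tensor can be
    applied. C bounds the form; the bound on phi itself stays existential because it only guarantees
    that b_phi is well behaved. *)
Definition formed S phi (C : R) := [/\ cmeasurable phi, exists M, bounded_by phi M, 0 <= C &
  forall g f, Cc g -> Cc f ->
    rnorm (smooth_form S phi g f) <= C * (rnorm (clq g) * rnorm (clp f))].

Definition extends S phi B := forall g f, Cc g -> Cc f ->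
  B (clq g) (clp f) = smooth_form S phi g f.

Lemma formed_extension S phi C : formed S phi C ->
  exists B, extends S phi B /\ forall C', formed S phi C' -> bounded_bilinear B C'.
Proof.
move=> [mphi [M phiM] C0 hC].
have [B [Bb Be BC]] := @bilinear_extension R LqG LpG (G -> R[i]) (G -> R[i])
  (@Cc R G) (@Cc R G) clq clp (smooth_form S phi)
  (fun a _ _ gc gc' => Cc_linear a gc gc') (fun a _ _ fc fc' => Cc_linear a fc fc')
  (fun a _ _ gc gc' => Lp_class_linear Q a (Cq gc) (Cq gc'))
  (fun a _ _ fc fc' => Lp_class_linear P a (Cp fc) (Cp fc'))
  (fun x => Lp_dense mu_haar x) (fun x => Lp_dense mu_haar x)
  (fun a _ _ _ gc gc' fc => smooth_form_linear_g mu_haar pp' hc S a mphi phiM gc gc' fc)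
  (fun a _ _ _ gc fc fc' => smooth_form_linear_f mu_haar pp' hc S a mphi phiM gc fc fc')
  C C0 hC.
exists B; split; first exact: Be.
by move=> C' [_ _ C'0 hC']; split; [exact: C'0|exact: Bb|exact: BC].
Qed.

Lemma formed_linear S a phi psi C C' : formed S phi C -> formed S psi C' ->
  formed S (a *: phi + psi) (rnorm a * C + C').
Proof.
move=> [mphi [M phiM] C0 hC] [mpsi [M' psiM] C'0 hC']; split.
- by apply: cmeasurableD => //; exact: cmeasurableZ.
- exists (rnorm a * M + M') => s; rewrite -[X in rnorm X]/(a * phi s + psi s).
  by rewrite (le_trans (ler_rnormD _ _))// rnormM lerD// ler_wpM2l ?rnorm_ge0.
- by rewrite addr_ge0// mulr_ge0 ?rnorm_ge0.
- move=> g f gc fc.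
  rewrite (smooth_form_linear_phi mu_haar pp' hc S a mphi phiM mpsi psiM gc fc).
  rewrite (le_trans (ler_rnormD _ _))// rnormM mulrDl lerD//; last exact: hC'.
  by rewrite -mulrA ler_wpM2l ?rnorm_ge0//; exact: hC.
Qed.

Lemma pairing_bilinear (F : LpG -> LpG) (C : R) : 0 <= C -> linear F ->
  (forall x, rnorm (F x) <= C * rnorm x) -> bounded_bilinear (fun (x : LqG) (y : LpG) => pair x (F y)) C.
Proof.
move=> C0 lF FC; split => //.
- split=> [y a x x'|x a y y']; first exact: (Lpb.1 (F y) a x x').
  by rewrite lF; exact: (Lpb.2 x a _ _).
- move=> x y; rewrite (le_trans (Lpair_bound pp' _ _))// mulrCA.
  by rewrite ler_wpM2l ?rnorm_ge0.
Qed.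

Lemma formed_Cc S phi : Cc phi ->
  formed S phi (cnorm mu p' phi * cnorm mu p (fun x => (h x)%:C) * opnorm S).
Proof.
move=> phic; have [M M0 phiM] := Cc_bounded phic; split.
- exact: continuous_cmeasurable phic.1.
- by exists M.
- by rewrite !mulr_ge0 ?cnorm_ge0// opnorm_ge0.
- by move=> g f gc fc; exact: smooth_form_Cc_bound.
Qed.

Variable e : (LqG -> LpG -> R[i]) -> R[i].
Hypothesis eA : approximable e.

Lemma extends_approx (eps : R) : 0 < eps -> exists v, forall S phi B C,
  extends S phi B -> bounded_bilinear B C ->
  rnorm (e B - Cc_eval (smooth_form S phi) v) <= C * eps.
Proof.
move=> eps0; have [v hv] := eA eps0; exists v => S phi B C BE BC.
rewrite (_ : Cc_eval _ v = Cc_eval (on_Cc B) v); first exact: hv.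
by apply: eq_bigr => z _; rewrite /on_Cc (BE _ _ (svalP z.1) (svalP z.2)).
Qed.

Section functional.
Variable T : Bop LpG LpG.

(** An extension bounded by every admissible constant is selected once, so that [smooth_functional]
    is a function of phi alone. The default 0 is taken if no extension exists. *)
Definition smooth_ext phi : LqG -> LpG -> R[i] :=
  xget (fun _ _ => 0) [set B | extends T phi B /\ forall C, formed T phi C -> bounded_bilinear B C].

Definition smooth_functional phi : R[i] := e (smooth_ext phi).
Local Notation qf := smooth_functional.

Lemma smooth_extP phi C : formed T phi C ->
  extends T phi (smooth_ext phi) /\ bounded_bilinear (smooth_ext phi) C.
Proof.
move=> fC; have [B hB] := formed_extension fC.
have [h2 h3] : extends T phi (smooth_ext phi) /\
    forall C, formed T phi C -> bounded_bilinear (smooth_ext phi) C.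
  by rewrite /smooth_ext; case: xgetP => [_ -> []//|/(_ B)].
by split; [exact: h2|exact: h3].
Qed.

Lemma functional_approx (eps : R) : 0 < eps -> exists v, forall phi C, formed T phi C ->
  rnorm (qf phi - Cc_eval (smooth_form T phi) v) <= C * eps.
Proof.
move=> eps0; have [v hv] := extends_approx eps0; exists v => phi C fC.
by have [h2 h3] := smooth_extP fC; exact: hv.
Qed.

(** Neither e nor the choice of extensions is assumed linear. Linearity is read off the finite sums
    [Cc_eval], in which b_phi is linear in phi, with arbitrarily small error. *)
Lemma functional_linear a phi psi C C' : formed T phi C -> formed T psi C' ->
  qf (a *: phi + psi) = a * qf phi + qf psi.
Proof.
move=> f1 f2; have f3 := formed_linear a f1 f2.
have [m1 [M1 b1] c1 _] := f1; have [m2 [M2 b2] c2 _] := f2.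
apply/eqP; rewrite -subr_eq0; apply/eqP/rnorm0_eq0/eqP; rewrite eq_le rnorm_ge0 andbT.
have K0 : 0 <= 2 * (rnorm a * C + C') by rewrite mulr_ge0// addr_ge0// mulr_ge0 ?rnorm_ge0.
apply: (ge0_small_le0 K0) => eps eps0; have [v hv] := functional_approx eps0.
have E : Cc_eval (smooth_form T (a *: phi + psi)) v =
    a * Cc_eval (smooth_form T phi) v + Cc_eval (smooth_form T psi) v.
  rewrite /Cc_eval mulr_sumr -big_split; apply: eq_bigr => z _ /=.
  exact: (smooth_form_linear_phi mu_haar pp' hc T a m1 b1 m2 b2 (svalP z.1) (svalP z.2)).
have := hv _ _ f3; rewrite E => l3.
rewrite [leRHS](_ : _ = (rnorm a * C + C') * eps + (rnorm a * (C * eps) + C' * eps)); last by ring.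
exact: rnorm_linear_defect l3 (hv _ _ f1) (hv _ _ f2).
Qed.

Lemma functional_bound : exists2 K : R, 0 <= K & forall phi C, formed T phi C ->
  rnorm (qf phi) <= C * K.
Proof.
have [v hv] := functional_approx ltr01.
exists (1 + \sum_(z <- v) rnorm (clq (sval z.1)) * rnorm (clp (sval z.2))).
  by rewrite addr_ge0// sumr_ge0// => z _; rewrite mulr_ge0 ?rnorm_ge0.
move=> phi C fC; have [_ _ C0 hC] := fC.
rewrite -[qf phi](subrK (Cc_eval (smooth_form T phi) v)) (le_trans (ler_rnormD _ _))//.
rewrite mulrDr lerD//; first exact: hv.
rewrite (le_trans (rnorm_sum _ _ _))// mulr_sumr; apply: ler_sum => z _.
exact: hC (svalP z.1) (svalP z.2).
Qed.

Hypothesis e0 : forall s, e (fun (x : LqG) (y : LpG) => pair x (ltr s y)) = 0.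

(* Order of the choices: [v] approximates [e] within [eps], then the finite rank
   perturbation [S'] of [T] depends on [v], then the finer approximation [w] of
   [e] depends on the constant [C2] of [S']. *)
Lemma functional_Cc phi : Cc phi -> qf phi = 0.
Proof.
move=> phic; pose C0 := cnorm mu p' phi * cnorm mu p (fun x => (h x)%:C).
have C00 : 0 <= C0 by rewrite mulr_ge0 ?cnorm_ge0.
have C10 : 0 <= C0 * opnorm T by rewrite mulr_ge0// opnorm_ge0.
apply: rnorm0_eq0; apply/eqP; rewrite eq_le rnorm_ge0 andbT.
have K0 : 0 <= C0 * opnorm T + 1 + C0 * opnorm T by rewrite !addr_ge0.
apply: (ge0_small_le0 K0) => eps eps0; have [v hv] := extends_approx eps0.
have [eta eta0 etaN] := small_factor (ler0n R (size v)) eps0.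
have [S' [S'T close [C2 C20 hC2]]] := averaging_exists mu_haar pp' hc phic T
  (fun j => svalP (tnth (in_tuple v) j).1) (fun j => svalP (tnth (in_tuple v) j).2) eta0.
have [B [BE BC]] := formed_extension (formed_Cc S' phic).
have {}BC := BC _ (formed_Cc S' phic); rewrite -/C0 in BC.
have [BE' BC'] := smooth_extP (formed_Cc T phic); rewrite -/C0 in BC'.
(* Contractivity of the averages keeps the constant fixed although S' varies with eps. *)
have S'C : C0 * opnorm S' <= C0 * opnorm T by rewrite ler_wpM2l.
(* By [e0] the coefficient function of an approximant w of e within d is at most d everywhere; as C2
   does not depend on w, d can tend to 0. *)
have eB : e B = 0.
  apply: rnorm0_eq0; apply/eqP; rewrite eq_le rnorm_ge0 andbT.
  apply: (@ge0_small_le0 _ _ (C0 * opnorm S' + C2)) => [|d d0].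
    by rewrite addr_ge0// mulr_ge0// opnorm_ge0.
  have [w hw] := eA d0.
  have wE b : Cc_eval b w = \sum_(j < size w) b (sval (tnth (in_tuple w) j).1)
    (sval (tnth (in_tuple w) j).2) by rewrite /Cc_eval big_tnth.
  have le1 := hw _ _ BC.
  rewrite (_ : Cc_eval (on_Cc B) w = Cc_eval (smooth_form S' phi) w) in le1; last first.
    by apply: eq_bigr => z _; exact: BE (svalP z.1) (svalP z.2).
  have le2 s : rnorm (Cc_eval (on_Cc (fun (x : LqG) (y : LpG) => pair x (ltr s y))) w) <= d.
    have := hw _ _ (pairing_bilinear ler01 (ltr_linear mu_haar s)
      (fun x => ltac:(by rewrite mul1r (ltr_norm mu_haar)))).
    by rewrite e0 sub0r rnormN mul1r.
  have := hC2 _ (fun j => sval (tnth (in_tuple w) j).1) (fun j => sval (tnth (in_tuple w) j).2)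
    d (ltW d0) (fun j => svalP _) (fun j => svalP _).
  rewrite -wE => le3.
  rewrite -[e B](subrK (Cc_eval (smooth_form S' phi) w)) (le_trans (ler_rnormD _ _))//.
  rewrite mulrDl lerD//; apply: le3 => s; have := le2 s; rewrite wE.
  by [].
have le1 := hv _ _ _ _ BE' BC'; have le2 := hv _ _ _ _ BE BC; rewrite eB sub0r rnormN in le2.
have le3 : rnorm (Cc_eval (smooth_form S' phi) v - Cc_eval (smooth_form T phi) v) <= eps.
  exact: le_trans (Cc_eval_dist close) (ltW etaN).
rewrite rnormBC in le3; rewrite !mulrDl mul1r.
apply: rnorm_chain le1 le3 (le_trans le2 _).
by apply: ler_wpM2r S'C; exact: ltW.
Qed.

End functional.

End smoothed_functional.

(** * Vanishing on A_p(G) *)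

Lemma cmeasurable_unif_limit d (T : measurableType d) (R : realType) (phi : T -> R[i]) :
  (forall e : R, 0 < e -> exists2 u, cmeasurable u & forall x, rnorm (phi x - u x) <= e) ->
  cmeasurable phi.
Proof.
move=> h; have /choice[u hu] n : exists u : T -> R[i], cmeasurable u /\
    forall x, rnorm (phi x - u x) <= n.+1%:R^-1.
  have e0 : 0 < n.+1%:R^-1 :> R by rewrite invr_gt0 ltr0n.
  by have [u mu uphi] := h _ e0; exists u.
have lim (r : R[i] -> R) : (forall a b, `|r a - r b| <= rnorm (a - b)) -> forall x,
    (r (u n x)) @[n --> \oo] --> r (phi x).
  move=> hr x; apply/cvgrPdist_lt => e e0.
  apply: filterS (near_infty_natSinv_lt (PosNum e0)) => n /= ne.
  by apply: le_lt_trans (hr _ _) (le_lt_trans _ ne); case: (hu n).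
split.
- apply: (@measurable_fun_cvg _ _ _ setT (fun n => @complex.Re R \o u n)) => [n|x _].
    by have [[]] := hu n.
  by apply: lim => a b; rewrite -raddfB; exact: ler_Re_rnorm.
- apply: (@measurable_fun_cvg _ _ _ setT (fun n => @complex.Im R \o u n)) => [n|x _].
    by have [[]] := hu n.
  by apply: lim => a b; rewrite -raddfB; exact: ler_Im_rnorm.
Qed.

Section coefficients.
Context (R : realType) (G : lcGroupType) (mu : {measure set (borel G) -> \bar R}).
Hypothesis mu_haar : left_haar mu.
Variables (p p' : R) (p1 : 1 < p) (pp' : p^-1 + p'^-1 = 1).
Local Notation P := (ltW p1).
Local Notation Q := (ltW (conj_gt1 p1 pp')).
Local Notation LpG := (Lp mu P).
Local Notation LqG := (Lp mu Q).
Local Notation clp := (Lp_class mu P).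
Local Notation clq := (Lp_class mu Q).
Local Notation pair := (@Lpair _ _ _ mu p p' P Q).
Local Notation Lpb := (@Lpair_bilinear _ _ _ mu p p' P Q pp').

Let Cq g : Cc g -> g \in cLfun mu p'. Proof. exact: (Cc_cLfun mu_haar Q). Qed.
Let Cp f : Cc f -> f \in cLfun mu p. Proof. exact: (Cc_cLfun mu_haar P). Qed.

(** The value of [Lambda_p] on the elementary tensor of a and b. *)
Definition coef (a : LqG) (b : LpG) : borel G -> R[i] := fun s => pair a (ltr (s^-1)%g b).

Lemma coef_bound a b s : rnorm (coef a b s) <= rnorm a * rnorm b.
Proof. by rewrite (le_trans (Lpair_bound pp' _ _))// (ltr_norm mu_haar). Qed.

Lemma coefBl a a' b : coef (a - a') b = coef a b - coef a' b.
Proof. by apply/funext => s; exact: (bilinearBl Lpb). Qed.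

Lemma coefBr a b b' : coef a (b - b') = coef a b - coef a b'.
Proof.
apply/funext => s; rewrite /coef -[RHS]/(pair a (ltr _ b) - pair a (ltr _ b')).
rewrite -(bilinearBr Lpb); congr (pair a _).
by rewrite [b - b']addrC -scaleN1r (ltr_linear mu_haar) scaleN1r addrC.
Qed.

(** Left invariance moves the translation from f to g; s then occurs only in a uniformly continuous
    function. *)
Lemma coefE g f s : Cc g -> Cc f -> coef (clq g) (clp f) s =
  cintegral mu (fun t => f t * g (s * t)%g).
Proof.
move=> gc fc; have [fs _] := cLfun_ltrans mu_haar P (s^-1)%g (Cp fc).
rewrite /coef (ltr_class mu_haar P _ (Cp fc)) (Lpair_class P Q pp' (Cq gc) fs).
have [gf1 _] := cLfun_hoelder P Q pp' (Cq gc) fs.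
rewrite -(cintegral_ltrans mu_haar s gf1); congr cintegral; apply/funext => t.
by rewrite /ltrans mulgA mulVg mul1g mulrC.
Qed.

Lemma coef_Cc g f : Cc g -> Cc f -> Cc (coef (clq g) (clp f)).
Proof.
move=> gc fc; have f1 := Cc_cLfun mu_haar (lexx 1) fc.
have [cg [K cK gK]] := gc; have [cf [L cL fL]] := fc.
have [M M0 gM] := Cc_bounded gc.
have ms s : cmeasurable (fun t : borel G => g (s * t)%g).
  apply: continuous_cmeasurable => t; apply: continuous_comp; last exact: cg.
  exact: mulgl_continuous.
have i1 s : (fun t => f t * g (s * t)%g) \in cLfun mu 1.
  by have [] := rnorm_cintegralM M0 f1 (ms s) (fun t _ => gM (s * t)%g).
split; last first.
  exists [set (a.1 * a.2)%g | a in K `*` [set (x^-1)%g | x in L]].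
    by apply: compact_mulg => //; exact: compact_invg.
  move=> s Ks; rewrite (coefE s gc fc) (_ : (fun t => _) = 0) ?cintegral0//.
  apply/funext => t; have [Lt|Lt] := pselect (L t); last by rewrite fL ?mul0r.
  rewrite gK ?mulr0// => Kst; apply: Ks; exists ((s * t)%g, (t^-1)%g) => /=.
    by split => //=; exists t.
  by rewrite -mulgA mulgV mulg1.
move=> s0; apply/cvg_rnormP => e e0.
have [d d0 dP] := small_factor (cnorm_ge0 mu 1 f) e0.
apply: filterS (ltrans_unif s0 gc d0) => s hs.
rewrite (coefE s gc fc) (coefE s0 gc fc) -(cintegralB (i1 s0) (i1 s)).
rewrite (_ : _ - _ = (fun t => f t * (g (s0 * t)%g - g (s * t)%g))); last first.
  by apply/funext => t; rewrite mulrBr.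
have mD := cmeasurableB (ms s0) (ms s).
have hs' t : f t != 0 -> rnorm (g (s0 * t)%g - g (s * t)%g) <= d.
  by move=> _; rewrite rnormBC ltW.
have [_ le] := rnorm_cintegralM (ltW d0) f1 mD hs'.
by apply: le_lt_trans le _; rewrite mulrC.
Qed.

Lemma Lp_approx_pair (a : LqG) (b : LpG) (e : R) : 0 < e -> exists g f, [/\ Cc g, Cc f &
  rnorm (a - clq g) * rnorm b + rnorm (clq g) * rnorm (b - clp f) <= e].
Proof.
move=> e0; have k0 : 0 <= rnorm a + 1 + rnorm b by rewrite !addr_ge0 ?rnorm_ge0.
have [d d0 dk] := small_factor k0 e0.
have d10 : 0 < Num.min d 1 by rewrite lt_min d0 ltr01.
have [g gc] := Lp_dense mu_haar a d10; rewrite lt_min => /andP[gd g1].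
have [f fc] := Lp_dense mu_haar b d0 => fd.
exists g, f; split=> //; apply: le_trans (ltW dk).
have ng : rnorm (clq g) <= rnorm a + 1.
  rewrite (_ : clq g = a - (a - clq g)); last by rewrite opprB addrC subrK.
  by rewrite (le_trans (ler_rnormD _ _))// rnormN lerD2l ltW.
rewrite mulrDr addrC lerD//.
  by rewrite mulrC ler_pM ?rnorm_ge0// ltW.
by rewrite ler_wpM2r ?rnorm_ge0// ltW.
Qed.

(** The scalar 1 gives the difference the shape required by [formed_linear]. *)
Lemma coef_sub a b a' b' : coef a b - coef a' b' = 1 *: coef (a - a') b + coef a' (b - b').
Proof. by rewrite scale1r coefBl coefBr addrA subrK. Qed.

Lemma coef_measurable a b : cmeasurable (coef a b).
Proof.
apply: cmeasurable_unif_limit => e e0.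
have [g [f [gc fc le]]] := Lp_approx_pair a b e0.
exists (coef (clq g) (clp f)) => [|s].
  exact: continuous_cmeasurable (coef_Cc gc fc).1.
rewrite -[X in rnorm X]/((coef a b - coef (clq g) (clp f)) s) coef_sub scale1r.
rewrite -[X in rnorm X]/(coef (a - clq g) b s + coef (clq g) (b - clp f) s).
apply: le_trans (ler_rnormD _ _) (le_trans _ le).
by apply: lerD; exact: coef_bound.
Qed.

Variables (Delta : G -> R) (hD : modular_function mu Delta).
Variables (h : G -> R) (hc : Cc (fun x => (h x)%:C)) (h0 : forall x, 0 <= h x).
Hypothesis h1 : forall z,
  cintegral mu (fun y => (Delta (y^-1)%g * h (z * y^-1)%g)%:C) = 1.
Variables (T : Bop LpG LpG) (hT : forall s (x : LpG), T (rtr s x) = rtr s (T x)).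
Local Notation smooth_form := (smooth_form pp' h).
Local Notation formed := (formed pp' h).

Lemma formed_subquotient (E : normedModType R[i]) (hE : Lp_subquotient P E)
    (phi : borel G -> R[i]) (b : G -> E -> R[i]) (alpha : G -> E) (B A : R) :
  cmeasurable phi -> 0 <= B ->
  (forall s t : G, phi (s * t^-1)%g = b s (alpha t)) ->
  (forall s, scalar (b s)) -> (forall s x, rnorm (b s x) <= B * rnorm x) ->
  (forall t, rnorm (alpha t) <= A) -> formed T phi (5 * (B * A * opnorm T)).
Proof.
move=> mphi B0 phiE bl bB aA; split=> //.
- by exists (B * A); exact: coefficient_bounded phiE bB aA.
- have A0 : 0 <= A by exact: le_trans (rnorm_ge0 _) (aA 1%g).
  by rewrite !mulr_ge0// opnorm_ge0.
- move=> g f gc fc.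
  exact: (smooth_form_subquotient mu_haar hD pp' hc h0 h1 hT hE mphi B0 phiE bl bB aA gc fc).
Qed.

(** The coefficient at s t^-1 factors through L_p itself: alpha(t) is the translate of b by t, and
    the functional at s is pairing with a after translation by s^-1. The bound is bilinear in the
    norms, hence extends to the projective norm. *)
Lemma formed_coef a b : formed T (coef a b) (5 * (rnorm a * rnorm b * opnorm T)).
Proof.
apply: (formed_subquotient (Lp_self_subquotient P mu) (coef_measurable a b) (rnorm_ge0 a)
  (b := fun s x => pair a (ltr (s^-1)%g x)) (alpha := fun t => ltr t b)).
- move=> s t; rewrite /coef; congr (pair a _).
  have [bt _] := cLfun_ltrans mu_haar P t (Lp_cLfun b).
  rewrite [ltr t b]/ltr (ltr_class mu_haar P _ bt) /ltr; congr clp; apply/funext => u.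
  by rewrite /ltrans invgM invgK mulgA.
- by move=> s c x y; rewrite (ltr_linear mu_haar); exact: (Lpb.2 a c (ltr _ x) (ltr _ y)).
- by move=> s x; rewrite (le_trans (Lpair_bound pp' _ _))// (ltr_norm mu_haar).
- by move=> t; rewrite (ltr_norm mu_haar).
Qed.

End coefficients.

Section L1_functionals.
Context (R : realType) (G : lcGroupType) (mu : {measure set (borel G) -> \bar R}).
Implicit Types (N : Lp mu (lexx 1)) (phi : borel G -> R[i]).

Lemma L1_functional_in N phi M : cmeasurable phi -> bounded_by phi M ->
  (fun t => Lp_fun N t * phi t) \in cLfun mu 1 /\
  cnorm mu 1 (fun t => Lp_fun N t * phi t) <= M * rnorm N.
Proof.
move=> mphi phiM; have := phi_in (lexx 1) mphi phiM (Lp_cLfun N).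
rewrite Lp_normE (_ : (fun s => _) = (fun t => Lp_fun N t * phi t))//.
by apply/funext => t; rewrite mulrC.
Qed.

Lemma L1_functional_bound N phi M : cmeasurable phi -> bounded_by phi M ->
  rnorm (L1_functional N phi) <= M * rnorm N.
Proof.
move=> mphi phiM; have [i1 n1] := L1_functional_in N mphi phiM.
exact: le_trans (rnorm_cintegral i1) n1.
Qed.

Lemma L1_functional_linear a N N' phi M : cmeasurable phi -> bounded_by phi M ->
  L1_functional (a *: N + N') phi = a * L1_functional N phi + L1_functional N' phi.
Proof.
move=> mphi phiM; have [i1 _] := L1_functional_in N mphi phiM.
have [i2 _] := L1_functional_in N' mphi phiM; have [i3 _] := L1_functional_in (a *: N + N') mphi phiM.
have i4 := cLfunZ (lexx 1) a i1.
rewrite /L1_functional -(cintegralZ a i1) -(cintegralD i4 i2).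
apply: ae_eq_cintegral.
- exact: cLfun_meas i3.
- exact: cLfun_meas (cLfunD (lexx 1) i4 i2).
- apply: filterS (Lp_fun_linear a N N') => t ->.
  rewrite -[RHS]/(a * (Lp_fun N t * phi t) + Lp_fun N' t * phi t).
  by rewrite mulrDl mulrA.
Qed.

End L1_functionals.

Section vanishing.
Context (R : realType) (G : lcGroupType) (mu : {measure set (borel G) -> \bar R}).
Hypothesis mu_haar : left_haar mu.
Variables (p p' : R) (p1 : 1 < p) (pp' : p^-1 + p'^-1 = 1).
Local Notation P := (ltW p1).
Local Notation Q := (ltW (conj_gt1 p1 pp')).
Local Notation LpG := (Lp mu P).
Local Notation LqG := (Lp mu Q).
Local Notation clp := (Lp_class mu P).
Local Notation clq := (Lp_class mu Q).
Local Notation pair := (@Lpair _ _ _ mu p p' P Q).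
Local Notation Lpb := (@Lpair_bilinear _ _ _ mu p p' P Q pp').
Variables (Delta : G -> R) (hD : modular_function mu Delta).
Variables (h : G -> R) (hc : Cc (fun x => (h x)%:C)) (h0 : forall x, 0 <= h x).
Hypothesis h1 : forall z,
  cintegral mu (fun y => (Delta (y^-1)%g * h (z * y^-1)%g)%:C) = 1.
Variables (T : Bop LpG LpG) (hT : forall s (x : LpG), T (rtr s x) = rtr s (T x)).
Local Notation smooth_form := (smooth_form pp' h).
Local Notation formed := (formed pp' h T).
Implicit Types (phi psi : borel G -> R[i]) (w : ptensor LqG LpG).

Lemma formed_le phi C C' : formed phi C -> C <= C' -> formed phi C'.
Proof.
move=> [m b C0 hC] CC'; split=> //; first exact: le_trans C0 CC'.
move=> g f gc fc; rewrite (le_trans (hC g f gc fc))// ler_wpM2r//.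
by rewrite mulr_ge0 ?rnorm_ge0.
Qed.

Lemma formed_const : formed (cst 1) (opnorm T).
Proof.
split; [exact: cmeasurable_cst|by exists 1 => s; rewrite rnorm1|exact: opnorm_ge0|].
move=> g f gc fc; rewrite (smooth_form1 mu_haar hD pp' hc h0 h1 hT gc fc).
by rewrite (le_trans (Lpair_bound pp' _ _))// mulrCA ler_wpM2l ?rnorm_ge0// opnormP.
Qed.

(** K may depend on g and f beyond their norms, so this does not make phi [formed]; it serves to
    pass to uniform limits of phi for fixed g and f. *)
Lemma smooth_form_sup_bound g f : Cc g -> Cc f -> exists2 K : R, 0 <= K &
  forall phi M, cmeasurable phi -> bounded_by phi M ->
  rnorm (smooth_form T phi g f) <= M * K.
Proof.
move=> gc fc; have [N hN] := smooth_form_L1 mu_haar pp' hc T gc fc ltr01.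
exists (1 + rnorm N); first by rewrite addr_ge0 ?rnorm_ge0.
move=> phi M mphi phiM; rewrite -[smooth_form T phi g f](subrK (L1_functional N phi)).
rewrite (le_trans (ler_rnormD _ _))// mulrDr mulr1 lerD//.
  by have := hN phi M mphi phiM; rewrite mul1r.
exact: L1_functional_bound.
Qed.

Definition tcoef (u : seq (LqG * LpG)) : borel G -> R[i] :=
  fun s => tensor_eval (fun x y => pair x (ltr (s^-1)%g y)) u.

Let pairing_s s : bounded_bilinear (fun (x : LqG) (y : LpG) => pair x (ltr s y)) 1.
Proof.
apply: (pairing_bilinear pp' ler01 (ltr_linear mu_haar s)) => x.
by rewrite mul1r (ltr_norm mu_haar).
Qed.

Lemma tcoef_cons x y u : tcoef ((x, y) :: u) = 1 *: coef x y + tcoef u.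
Proof. by apply/funext => s; rewrite scale1r /tcoef /tensor_eval big_cons. Qed.

Lemma tcoef_sub u v : tcoef (tensor_sub u v) = tcoef u - tcoef v.
Proof.
by apply/funext => s; apply: tensor_eval_sub; case: (pairing_s (s^-1)%g).
Qed.

Lemma formed0 : formed 0 0.
Proof.
have b0 : bounded_by (0 : borel G -> R[i]) 0 by move=> s; rewrite rnorm0.
split; [exact: cmeasurable_cst|by exists 0|by []|] => g f gc fc.
have [K _ hK] := smooth_form_sup_bound gc fc.
by have := hK _ _ (cmeasurable_cst _ 0) b0; rewrite !mul0r.
Qed.

Lemma formed_tcoef u :
  formed (tcoef u) (5 * opnorm T * \sum_(z <- u) rnorm z.1 * rnorm z.2).
Proof.
elim: u => [|[x y] u IH].
  rewrite big_nil mulr0 (_ : tcoef _ = 0); first exact: formed0.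
  by apply/funext => s; rewrite /tcoef /tensor_eval big_nil.
rewrite tcoef_cons big_cons mulrDr.
have := formed_linear mu_haar hc 1 (formed_coef mu_haar hD hc h0 h1 hT x y) IH.
move=> /formed_le; apply; rewrite rnorm1 mul1r lerD// le_eqVlt; apply/orP; left.
by apply/eqP => /=; ring.
Qed.

(** [tcoef] depends only on the tensor, so u may be replaced by a nearly optimal representative. *)
Lemma formed_tcoef_proj u (e : R) : 0 < e ->
  formed (tcoef u) (5 * opnorm T * (proj_norm u + e)).
Proof.
move=> e0; have [v [uv vn]] := proj_norm_approx u e0.
rewrite (_ : tcoef u = tcoef v).
  apply: formed_le (formed_tcoef v) _; rewrite ler_wpM2l ?(ltW vn)//.
  by rewrite mulr_ge0// opnorm_ge0.
by apply/funext => s; apply: uv; case: (pairing_s (s^-1)%g).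
Qed.

Lemma tcoef_Cc_approx u (e : R) : 0 < e ->
  exists2 psi : borel G -> R[i], Cc psi & formed (tcoef u - psi) e.
Proof.
elim: u e => [|[x y] u IH] e e0.
  exists 0; first exact: Cc0.
  rewrite subr0 (_ : tcoef _ = 0); first exact: formed_le formed0 (ltW e0).
  by apply/funext => s; rewrite /tcoef /tensor_eval big_nil.
have e2 : 0 < e / 2 by rewrite divr_gt0.
have [psi psic le1] := IH _ e2.
have T0 : 0 <= 5 * opnorm T by rewrite mulr_ge0// opnorm_ge0.
have [d d0 dT] := small_factor T0 e2.
have [g [f [gc fc le]]] := Lp_approx_pair mu_haar x y d0.
exists (coef (clq g) (clp f) + psi).
  by rewrite -[coef (clq g) _]scale1r; apply: Cc_linear => //; exact: coef_Cc.
rewrite tcoef_cons scale1r opprD addrACA -[coef x y - _]scale1r (coef_sub mu_haar).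
have fcoef (a : LqG) (b : LpG) := formed_coef mu_haar hD hc h0 h1 hT a b.
have F := formed_linear mu_haar hc 1 (fcoef (x - clq g) y) (fcoef (clq g) (y - clp f)).
apply: formed_le (formed_linear mu_haar hc 1 F le1) _.
rewrite !rnorm1 !mul1r [leRHS]splitr lerD//; apply: le_trans (ltW dT).
rewrite [leLHS](_ : _ = (rnorm (x - clq g) * rnorm y + rnorm (clq g) * rnorm (y - clp f)) *
  (5 * opnorm T)); last by ring.
by rewrite ler_wpM2r.
Qed.

Lemma Lambda_approx w (e : R) : 0 < e -> exists N, forall n, (N <= n)%N -> forall s,
  rnorm (Lambda_p w s - tcoef (sval w n) s) <= e.
Proof.
move=> e0; have [N hN] := ptensor_eval_approx w e0; exists N => n Nn s.
by have := hN n Nn _ _ (pairing_s (s^-1)%g); rewrite mul1r.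
Qed.

(** For a Cauchy sequence of tensors the differences of coefficient functions have small forms.
    Their uniform limit inherits the bound for each g and f by [smooth_form_sup_bound]. *)
Lemma formed_Lambda_sub w (e : R) : 0 < e ->
  exists n, formed (Lambda_p w - tcoef (sval w n) : borel G -> R[i]) e.
Proof.
(* The factor 2 leaves one d for the projective norm of the difference and one for the slack in
   [formed_tcoef_proj]. *)
move=> e0; have T0 : 0 <= 5 * opnorm T * 2 by rewrite !mulr_ge0// opnorm_ge0.
have [d d0 /ltW dT] := small_factor T0 e0.
have [N hN] := svalP w d d0; exists N.
have mL : cmeasurable (Lambda_p w : borel G -> R[i]).
  apply: cmeasurable_unif_limit => r r0; have [n hn] := Lambda_approx w r0.
  exists (tcoef (sval w n)); last exact: hn n (leqnn n).
  by have [] := formed_tcoef (sval w n).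
have [mt [Mt bt] _ _] := formed_tcoef (sval w N).
split; [exact: cmeasurableB| |exact: ltW|].
  have [n hn] := Lambda_approx w ltr01.
  have [_ [Mn bn] _ _] := formed_tcoef (sval w n).
  exists (1 + Mn + Mt) => s; rewrite -[X in rnorm X]/(Lambda_p w s - tcoef (sval w N) s).
  rewrite (le_trans (ler_rnormD _ _))// rnormN lerD//.
  rewrite -[Lambda_p w s](subrK (tcoef (sval w n) s)) (le_trans (ler_rnormD _ _))//.
  by apply: lerD; [exact: hn|exact: bn].
move=> g f gc fc; have [K K0 hK] := smooth_form_sup_bound gc fc.
rewrite -subr_le0; apply: (ge0_small_le0 K0) => r r0; rewrite lerBlDr.
have [n0 hn] := Lambda_approx w r0; pose n := maxn n0 N.
have b1 : bounded_by (Lambda_p w - tcoef (sval w n) : borel G -> R[i]) r.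
  by move=> s; apply: hn; exact: leq_maxl.
have [mn _ _ _] := formed_tcoef (sval w n).
have m1 : cmeasurable (Lambda_p w - tcoef (sval w n) : borel G -> R[i]).
  exact: cmeasurableB.
have := formed_tcoef_proj (tensor_sub (sval w n) (sval w N)) d0.
rewrite tcoef_sub => -[m2 [M2 b2] _ hF].
have E : Lambda_p w - tcoef (sval w N) =
    1 *: (Lambda_p w - tcoef (sval w n)) + (tcoef (sval w n) - tcoef (sval w N)).
  by rewrite scale1r addrA subrK.
rewrite E (smooth_form_linear_phi mu_haar pp' hc T 1 m1 b1 m2 b2 gc fc) mul1r.
rewrite (le_trans (ler_rnormD _ _))// lerD//; first by rewrite mulrC; exact: hK.
apply: le_trans (hF g f gc fc) _; rewrite ler_wpM2r ?mulr_ge0 ?rnorm_ge0//.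
apply: le_trans dT; rewrite [leRHS](_ : _ = 5 * opnorm T * (d + d)); last by ring.
rewrite ler_wpM2l ?mulr_ge0 ?opnorm_ge0// lerD2r ltW//.
by apply: hN => //; exact: leq_maxr.
Qed.

Lemma Lambda_Cc_approx w (e : R) : 0 < e -> exists2 psi : borel G -> R[i], Cc psi &
  formed (Lambda_p w - psi : borel G -> R[i]) e.
Proof.
move=> e0; have e2 : 0 < e / 2 by rewrite divr_gt0.
have [n F1] := formed_Lambda_sub w e2; have [psi psic F2] := tcoef_Cc_approx (sval w n) e2.
exists psi => //; have := formed_linear mu_haar hc 1 F1 F2.
by rewrite scale1r addrA subrK rnorm1 mul1r -splitr.
Qed.

Variable e : (LqG -> LpG -> R[i]) -> R[i].
Hypothesis eA : approximable e.
Local Notation qf := (smooth_functional h e T).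

(** The selected extension of b_1 and the pairing with T agree on C_c(G), which is all that an
    approximable e sees. *)
Lemma functional_const : qf (cst 1) = e (fun (x : LqG) (y : LpG) => pair x (T y)).
Proof.
have [E1 B1] := smooth_extP mu_haar hc formed_const.
have B2 : bounded_bilinear (fun (x : LqG) (y : LpG) => pair x (T y)) (opnorm T).
  apply: (pairing_bilinear pp' (opnorm_ge0 T)); last exact: opnormP.
  by move=> a x y; rewrite linearP.
have E2 : extends h T (cst 1) (fun (x : LqG) (y : LpG) => pair x (T y)).
  by move=> g f gc fc; rewrite (smooth_form1 mu_haar hD pp' hc h0 h1 hT gc fc).
apply/eqP; rewrite -subr_eq0; apply/eqP/rnorm0_eq0/eqP; rewrite eq_le rnorm_ge0 andbT.
apply: (@ge0_small_le0 _ _ (opnorm T * 2)) => [|eps eps0]; first by rewrite mulr_ge0 ?opnorm_ge0.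
have [v hv] := extends_approx h eA eps0.
have l1 := hv _ _ _ _ E1 B1; have := hv _ _ _ _ E2 B2; rewrite rnormBC => l2.
rewrite -(subrKA (Cc_eval (smooth_form T (cst 1)) v)); apply: le_trans (ler_rnormD _ _) _.
by rewrite [leRHS](_ : _ = opnorm T * eps + opnorm T * eps); [exact: lerD|ring].
Qed.

Hypothesis e0 : forall s, e (fun (x : LqG) (y : LpG) => pair x (ltr s y)) = 0.

Lemma functional_Lambda w : qf (Lambda_p w) = 0.
Proof.
have [K K0 hK] := functional_bound mu_haar hc eA T.
apply: rnorm0_eq0; apply/eqP; rewrite eq_le rnorm_ge0 andbT.
apply: (ge0_small_le0 K0) => eps eps0.
have [psi psic F1] := Lambda_Cc_approx w eps0.
have F2 := formed_Cc mu_haar pp' hc T psic.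
have := functional_linear mu_haar hc eA 1 F1 F2.
rewrite scale1r subrK mul1r (functional_Cc mu_haar hc eA T e0 psic) addr0 => ->.
by rewrite mulrC; exact: hK.
Qed.

Lemma Bop_rnormE (E : normedModType R[i]) (b : Bop E R[i]) : rnorm b = opnorm b.
Proof. by []. Qed.

Lemma pcb_rep_formed phi (E : completeNormedModType R[i]) (alpha : G -> E)
    (beta : G -> Bop E R[i]) : pcb_rep p1 phi alpha beta ->
  let BA := sup (range (rnorm \o beta)) * sup (range (rnorm \o alpha)) in
  bounded_by phi BA /\ formed phi (5 * (BA * opnorm T)).
Proof.
move=> [hE [ca ba] [cb bb] phiE] BA.
set A := sup (range (rnorm \o alpha)); set B := sup (range (rnorm \o beta)).
have aA t : rnorm (alpha t) <= A by apply: ub_le_sup => //; exists t.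
have bB s x : rnorm (beta s x) <= B * rnorm x.
  rewrite (le_trans (opnormP _ _))// ler_wpM2r ?rnorm_ge0// -Bop_rnormE.
  by apply: ub_le_sup => //; exists s.
have B0 : 0 <= B by apply: le_trans (rnorm_ge0 (beta 1%g)) _; apply: ub_le_sup => //; exists 1%g.
(* Taking t = 1 shows that phi inherits continuity, hence measurability, from beta. *)
have phi1 s : phi s = beta s (alpha 1%g) by rewrite -phiE invg1 mulg1.
have mphi : cmeasurable (phi : borel G -> R[i]).
  apply: continuous_cmeasurable => s0; apply/cvg_rnormP => r r0.
  have [d d0 dr] := small_factor (rnorm_ge0 (alpha 1%g)) r0.
  have /cvg_rnormP/(_ _ d0) := cb s0; apply: filterS => s hs.
  rewrite !phi1 -[X in rnorm X]/((beta s0 - beta s : Bop E R[i]) (alpha 1%g)).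
  apply: le_lt_trans (opnormP _ _) (le_lt_trans _ dr).
  by rewrite ler_wpM2r ?rnorm_ge0// -Bop_rnormE ltW.
have bl s : scalar (beta s) by move=> a x y; rewrite linearP.
split; first exact: coefficient_bounded phiE bB aA.
exact: (formed_subquotient mu_haar pp' hD hc h0 h1 hT (SQ_subquotient hE) mphi B0 phiE bl bB aA).
Qed.

Lemma Mpcb_norm_approx phi (r : R) : Mpcb p1 phi -> 0 < r ->
  exists c, [/\ 0 <= Mpcb_norm p1 phi, c < Mpcb_norm p1 phi + r, bounded_by phi c &
    formed phi (5 * (c * opnorm T))].
Proof.
move=> [E0 [alpha0 [beta0 rep0]]] r0.
pose S := [set c | exists E alpha beta, @pcb_rep R G p p1 phi E alpha beta /\
  c = sup (range (rnorm \o alpha)) * sup (range (rnorm \o beta))].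
have S0 c : S c -> 0 <= c.
  move=> [E [alpha [beta [[_ [_ ba] [_ bb] _] ->]]]]; apply: mulr_ge0.
    by apply: le_trans (rnorm_ge0 (alpha 1%g)) _; apply: ub_le_sup => //; exists 1%g.
  by apply: le_trans (rnorm_ge0 (beta 1%g)) _; apply: ub_le_sup => //; exists 1%g.
have hS : has_inf S by split; [eexists; exists E0, alpha0, beta0; split=> //|exists 0 => c /S0].
have [c [E [alpha [beta [rep cE]]]] lt] := inf_adherent r0 hS.
have [b F] := pcb_rep_formed rep.
exists c; split => //; first by apply: lb_le_inf; [case: hS|move=> x /S0].
  by rewrite cE mulrC.
by rewrite cE [_ * sup (range (rnorm \o beta))]mulrC.
Qed.

Lemma Mpcb_formed phi : Mpcb p1 phi -> bounded_by phi (Mpcb_norm p1 phi) /\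
  formed phi (5 * (Mpcb_norm p1 phi * opnorm T)).
Proof.
move=> hphi; split=> [s|].
  by apply/ler_addgt0Pr => r r0; have [c [_ /ltW cr b _]] := Mpcb_norm_approx hphi r0;
    exact: le_trans (b s) cr.
have [c [n0 _ b [m _ _ _]]] := Mpcb_norm_approx hphi ltr01.
split=> //; [by exists c|by rewrite !mulr_ge0// opnorm_ge0|move=> g f gc fc].
have K0 : 0 <= 5 * opnorm T * (rnorm (clq g) * rnorm (clp f)).
  by rewrite !mulr_ge0 ?opnorm_ge0 ?rnorm_ge0.
rewrite -subr_le0; apply: (ge0_small_le0 K0) => r r0; rewrite lerBlDr.
have [c' [_ /ltW cr _ [_ _ _ F]]] := Mpcb_norm_approx hphi r0.
apply: le_trans (F g f gc fc) _.
rewrite [leLHS](_ : _ = 5 * opnorm T * (rnorm (clq g) * rnorm (clp f)) * c'); last by ring.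
rewrite [leRHS](_ : _ = 5 * opnorm T * (rnorm (clq g) * rnorm (clp f)) *
  (Mpcb_norm p1 phi + r)); last by ring.
by rewrite ler_wpM2l.
Qed.

Lemma Cc_eval_L1 v (d : R) : 0 < d -> exists N : Lp mu (lexx 1), forall phi M,
  cmeasurable phi -> bounded_by phi M ->
  rnorm (Cc_eval (smooth_form T phi) v - L1_functional N phi) <= d * M.
Proof.
elim: v d => [|[[g gc] [f fc]] v IH] d d0.
  exists 0 => phi M mphi phiM; have M0 : 0 <= M by exact: le_trans (rnorm_ge0 _) (phiM point).
  rewrite /Cc_eval big_nil sub0r rnormN (le_trans (L1_functional_bound 0 mphi phiM))//.
  by rewrite rnorm0 mulr0 mulr_ge0// ltW.
have d2 : 0 < d / 2 by rewrite divr_gt0.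
have [N hN] := IH _ d2; have [N' hN'] := smooth_form_L1 mu_haar pp' hc T gc fc d2.
exists (1 *: N' + N) => phi M mphi phiM.
rewrite (L1_functional_linear 1 N' N mphi phiM) mul1r /Cc_eval big_cons/= opprD addrACA.
rewrite (le_trans (ler_rnormD _ _))// [d]splitr mulrDl lerD//; first exact: hN'.
exact: hN.
Qed.

(** Two approximations are composed: e by finitely many pairs from C_c(G), then each b_phi(g, f) by
    an L_1 functional of phi. Both errors are controlled by the norm of phi in M_{p-cb}(G). *)
Lemma functional_Qpcb : Qpcb mu p1 qf.
Proof.
have [K K0 hK] := functional_bound mu_haar hc eA T.
split; first split.
- move=> a phi psi /Mpcb_formed[_ F1] /Mpcb_formed[_ F2].
  exact: (functional_linear mu_haar hc eA a F1 F2).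
- exists (5 * opnorm T * K) => phi /Mpcb_formed[_ F]; apply: le_trans (hK _ _ F) _.
  by rewrite le_eqVlt; apply/orP; left; apply/eqP; ring.
(* A quarter for each of the two approximations; the sum r / 2 keeps the inequality strict after the
   supremum. *)
move=> r r0; have r2 : 0 < r / 4 by rewrite divr_gt0.
have T0 : 0 <= 5 * opnorm T by rewrite mulr_ge0// opnorm_ge0.
have [d d0 /ltW dT] := small_factor T0 r2.
have [v hv] := functional_approx mu_haar hc eA T d0.
have [N hN] := Cc_eval_L1 v r2.
exists N; apply: (@le_lt_trans _ _ (r / 2)); last by rewrite ltr_pdivrMr// ltr_pMr// ltr1n.
have le phi : Mpcb p1 phi -> Mpcb_norm p1 phi <= 1 ->
    rnorm ((qf \- L1_functional N) phi) <= r / 2.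
  move=> hphi n1; have [b F] := Mpcb_formed hphi; have [m _ _ _] := F.
  have n0 : 0 <= Mpcb_norm p1 phi by exact: le_trans (rnorm_ge0 _) (b point).
  rewrite -[X in rnorm X]/(qf phi - L1_functional N phi).
  rewrite -(subrKA (Cc_eval (smooth_form T phi) v)); apply: le_trans (ler_rnormD _ _) _.
  rewrite (_ : r / 2 = r / 4 + r / 4); last by field.
  apply: lerD.
    apply: le_trans (hv _ _ F) (le_trans _ dT).
    by rewrite mulrC ler_wpM2l ?(ltW d0)// ler_wpM2l// ler_piMl ?opnorm_ge0.
  by apply: le_trans (hN _ _ m b) _; rewrite ler_piMr// ltW.
(* On the empty set the supremum is 0 by convention, and [ge_sup] wants a nonempty one. *)
have [E0|/set0P[x Ex]] := eqVneq
  [set rnorm ((qf \- L1_functional N) phi) | phi in Mpcb p1 `&` [set phi | Mpcb_norm p1 phi <= 1]] set0.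
  by rewrite /Mpcb_dual_norm E0 sup0 divr_ge0// ltW.
apply: ge_sup; first by exists x.
by move=> _ [phi [hphi n1] <-]; exact: le.
Qed.

End vanishing.

(** * Pseudomeasures *)

(** V is known only as a set of vectors. A matrix of maximal rank with rows in V has V as its row
    space, and some column of its cokernel detects t. *)
Lemma separation_rV (F : fieldType) n (V : set 'rV[F]_n) (t : 'rV[F]_n) :
  V 0 -> (forall a v w, V v -> V w -> V (a *: v + w)) -> ~ V t ->
  exists c : 'cV[F]_n, (forall v, V v -> v *m c = 0) /\ t *m c != 0.
Proof.
move=> V0 VL Vt.
pose Pr r := `[< exists2 A : 'M[F]_n, forall i, V (row i A) & \rank A = r >].
have exP : exists r, Pr r.
  exists 0%N; apply/asboolP; exists 0; last exact: mxrank0.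
  by move=> i; rewrite row0.
have ubP r : Pr r -> (r <= n)%N by move=> /asboolP[A _ <-]; exact: rank_leq_row.
case: (ex_maxnP exP ubP) => _ /asboolP[A AV <-] Amax.
have comb m (D : 'rV[F]_m) (A' : 'M[F]_(m, n)) : (forall i, V (row i A')) -> V (D *m A').
  move=> A'V; rewrite mulmx_sum_row; elim/big_ind: _ => // [v w vV wV|i _].
    by rewrite -[v]scale1r; exact: VL.
  by rewrite -[_ *: _]addr0; exact: VL.
have VA v : V v -> (v <= A)%MS.
  move=> Vv; have [_] := mxrank_leqif_sup (addsmxSl A v).
  suff -> : (\rank A == \rank (A + v)%MS) by move=> /esym/(submx_trans (addsmxSr _ _)).
  rewrite eqn_leq mxrankS ?addsmxSl//; apply: Amax; apply/asboolP.
  exists (A + v)%MS => // i; have /sub_addsmxP[[u1 u2] /= ->] := row_sub i (A + v)%MS.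
  rewrite -[_ *m A]scale1r; apply: VL; first exact: comb.
  by apply: comb => j; rewrite ord1 row_id.
have tA : t *m cokermx A != 0.
  by rewrite -submxE; apply/negP => /submxP[D tE]; apply: Vt; rewrite tE; exact: comb.
have /existsP[j tj] : [exists j, (t *m cokermx A) 0 j != 0].
  apply: contraNT tA; rewrite negb_exists => /forallP h.
  by apply/eqP/rowP => j; have := h j; rewrite negbK => /eqP ->; rewrite mxE.
exists (col j (cokermx A)); split=> [v /VA|].
  by rewrite submxE => /eqP vA; rewrite colE mulmxA vA mul0mx.
apply: contraNneq tj; rewrite colE mulmxA -colE => /matrixP/(_ 0 0).
by rewrite [LHS]mxE => ->; rewrite mxE.
Qed.

Lemma bounded_bilinear_linear (R : realType) (X Y : normedModType R[i])
    (a : R[i]) (B B' : X -> Y -> R[i]) (C C' : R) :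
  bounded_bilinear B C -> bounded_bilinear B' C' ->
  bounded_bilinear (fun x y => a * B x y + B' x y) (rnorm a * C + C').
Proof.
move=> [C0 [Bl Br] BC] [C'0 [Bl' Br'] BC']; split.
- by rewrite addr_ge0// mulr_ge0 ?rnorm_ge0.
- by split=> [y c x x'|x c y y']; rewrite ?Bl ?Bl' ?Br ?Br'; ring.
- move=> x y; rewrite (le_trans (ler_rnormD _ _))// rnormM mulrDl lerD//.
  by rewrite -mulrA ler_wpM2l ?rnorm_ge0.
Qed.

Lemma ptensor_eval_linear (R : realType) (X Y : normedModType R[i]) (u : ptensor X Y)
    (a : R[i]) (B B' : X -> Y -> R[i]) (C C' : R) :
  bounded_bilinear B C -> bounded_bilinear B' C' ->
  ptensor_eval (fun x y => a * B x y + B' x y) u = a * ptensor_eval B u + ptensor_eval B' u.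
Proof.
move=> BC BC'; have BC2 := bounded_bilinear_linear a BC BC'.
apply/eqP; rewrite -subr_eq0; apply/eqP/rnorm0_eq0/eqP; rewrite eq_le rnorm_ge0 andbT.
have [[C0 _ _] [C'0 _ _]] := (BC, BC').
apply: (@ge0_small_le0 _ _ (2 * (rnorm a * C + C'))) => [|e e0].
  by rewrite mulr_ge0// addr_ge0// mulr_ge0 ?rnorm_ge0.
have [N hN] := ptensor_eval_approx u e0; have {}hN := hN N (leqnn N).
have E : tensor_eval (fun x y => a * B x y + B' x y) (sval u N) =
    a * tensor_eval B (sval u N) + tensor_eval B' (sval u N).
  by rewrite /tensor_eval mulr_sumr -big_split.
have := hN _ _ BC2; rewrite E => l1.
rewrite [leRHS](_ : _ = (rnorm a * C + C') * e + (rnorm a * (C * e) + C' * e)); last by ring.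
exact: rnorm_linear_defect l1 (hN _ _ BC) (hN _ _ BC').
Qed.

Lemma pure_tensor_cauchy (R : realType) (X Y : normedModType R[i]) (x : X) (y : Y) :
  proj_cauchy (fun _ : nat => [:: (x, y)]).
Proof.
move=> e e0; exists 0%N => m n _ _; apply: le_lt_trans e0; apply: ge_inf.
  by exists 0 => _ [v _ <-]; apply: sumr_ge0 => z _; rewrite mulr_ge0 ?rnorm_ge0.
exists [::]; last by rewrite big_nil.
by move=> B Bb; rewrite (tensor_eval_sub _ _ Bb) subrr /tensor_eval big_nil.
Qed.

Definition pure_tensor (R : realType) (X Y : normedModType R[i]) (x : X) (y : Y) : ptensor X Y :=
  exist _ _ (pure_tensor_cauchy x y).

Lemma ptensor_eval_pure (R : realType) (X Y : normedModType R[i]) (B : X -> Y -> R[i]) x y :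
  ptensor_eval B (pure_tensor x y) = B x y.
Proof.
rewrite /ptensor_eval/= (_ : (fun n => _) = fun=> B x y); first exact: lim_cst.
by apply/funext => n; rewrite /tensor_eval big_seq1.
Qed.

(** * The weak* topology *)

Section weakstar.
Context (R : realType) (G : lcGroupType) (mu : {measure set (borel G) -> \bar R}).
Hypothesis mu_haar : left_haar mu.
Variables (p p' : R) (p1 : 1 < p) (pp' : p^-1 + p'^-1 = 1).
Local Notation P := (ltW p1).
Local Notation Q := (ltW (conj_gt1 p1 pp')).
Local Notation LpG := (Lp mu P).
Local Notation LqG := (Lp mu Q).
Local Notation pair := (@Lpair _ _ _ mu p p' P Q).
Local Notation Lpb := (@Lpair_bilinear _ _ _ mu p p' P Q pp').
Local Notation W := (weakstar_Bop mu p1 pp').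
Local Notation ptw := {ptws ptensor LqG LpG -> R[i]}.
Local Notation opp := (@op_pairing R G mu p p' p1 pp').
Implicit Types (S T : Bop LpG LpG) (A : set (Bop LpG LpG)).

Lemma op_pairing_bounded S :
  bounded_bilinear (fun (x : LqG) (y : LpG) => pair x (S y)) (opnorm S).
Proof.
apply: (pairing_bilinear pp' (opnorm_ge0 S)); last exact: opnormP.
by move=> a x y; rewrite linearP.
Qed.

Lemma op_pairing_linear a S T u : opp (a *: S + T) u = a * opp S u + opp T u.
Proof.
rewrite -(ptensor_eval_linear u a (op_pairing_bounded S) (op_pairing_bounded T)).
congr (ptensor_eval _ u); apply/funext => x; apply/funext => y.
by rewrite -(bilinearZr Lpb) -(bilinearDr Lpb).
Qed.

Lemma lin_span_linear A a S T : lin_span A S -> lin_span A T -> lin_span A (a *: S + T).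
Proof.
move=> [n [c [F [FA ->]]]] [m [c' [F' [F'A ->]]]]; exists (n + m)%N.
exists (fun i => match fintype.split i with inl j => a * c j | inr j => c' j end).
exists (fun i => match fintype.split i with inl j => F j | inr j => F' j end); split.
  by move=> i; case: fintype.split.
rewrite big_split_ord/=; congr (_ + _); first rewrite scaler_sumr; apply: eq_bigr => i _.
  by rewrite (unsplitK (inl i)) scalerA.
by rewrite (unsplitK (inr i)).
Qed.

Lemma lin_span0 A : lin_span A 0.
Proof. by exists 0%N, (fun=> 0), (fun=> 0); split=> [[]//|]; rewrite big_ord0. Qed.

(** The sets of operators that agree with S on finitely many tensors generate a filter that
    converges to S. Exact agreement is asked for, instead of agreement up to an error, since this is
    what linear algebra provides. *)
Lemma weakstar_nbhs S (A : set W) : nbhs (S : W) A ->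
  exists n (u : 'I_n -> ptensor LqG LpG), forall S' : Bop LpG LpG,
    (forall i, opp S' (u i) = opp S (u i)) -> A S'.
Proof.
move=> [U [[V oV <-] VS] VA].
pose D := {n & 'I_n -> ptensor LqG LpG}.
pose mk n u : D := existT (fun n => 'I_n -> ptensor LqG LpG) n u.
pose agree (d : D) : set (Bop LpG LpG) :=
  [set S' | forall i, opp S' (projT2 d i) = opp S (projT2 d i)].
pose F := filter_from setT agree.
have FF : Filter F.
  apply: filter_from_filter; first by exists (mk 0%N (fun=> pure_tensor 0 0)).
  move=> [n u] [m v] _ _.
  exists (mk (n + m)%N
    (fun i => match fintype.split i with inl j => u j | inr j => v j end)); first exact: I.
  move=> S' hS'; split=> i.
    by have := hS' (lshift m i); rewrite /= (unsplitK (inl i)).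
  by have := hS' (rshift n i); rewrite /= (unsplitK (inr i)).
have Fcvg : (opp : Bop LpG LpG -> ptw) @ F --> (opp S : ptw).
  apply/cvg_sup => u X [Y [[Z oZ <-] ZS] ZX].
  exists (mk 1%N (fun=> u)); first exact: I.
  move=> S' hS'; apply: ZX; rewrite /= (hS' ord0).
  exact: ZS.
have [|[n u] _ hu] := Fcvg V; first exact: open_nbhs_nbhs.
by exists n, u => S' hS'; apply: VA; exact: hu.
Qed.

Lemma weakstar_near S (u : ptensor LqG LpG) (e : R) : 0 < e ->
  nbhs (S : W) [set S' : W | rnorm (opp S u - opp S' u) < e].
Proof.
move=> e0.
have h1 : nbhs (opp S : ptw) [set f | rnorm (opp S u - f u) < e].
  have /cvg_sup/(_ u) h2 : nbhs (opp S : ptw) --> (opp S : ptw) by exact: cvg_id.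
  have h3 : nbhs (opp S u) [set z | rnorm (opp S u - z) < e] by apply/nbhs_rnormP; exists e.
  exact: (h2 _ (@initial_continuous _ _ (fun f : ptensor LqG LpG -> R[i] => f u) (opp S) _ h3)).
exact: (@initial_continuous _ _ (opp : Bop LpG LpG -> ptw) S _ h1).
Qed.

End weakstar.

Section pseudomeasures_convoluters.
Context (R : realType) (G : lcGroupType) (mu : {measure set (borel G) -> \bar R}).
Hypothesis mu_haar : left_haar mu.
Variables (Delta : G -> R) (hD : modular_function mu Delta).
Variables (p p' : R) (p1 : 1 < p) (pp' : p^-1 + p'^-1 = 1).
Local Notation P := (ltW p1).
Local Notation Q := (ltW (conj_gt1 p1 pp')).
Local Notation LpG := (Lp mu P).
Local Notation LqG := (Lp mu Q).
Local Notation clp := (Lp_class mu P).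
Local Notation clq := (Lp_class mu Q).
Local Notation pair := (@Lpair _ _ _ mu p p' P Q).
Local Notation Lpb := (@Lpair_bilinear _ _ _ mu p p' P Q pp').
Local Notation W := (weakstar_Bop mu p1 pp').
Local Notation opp := (@op_pairing R G mu p p' p1 pp').
Implicit Types (S T : Bop LpG LpG).

Lemma ltr_bounded s : (ltr s : LpG -> LpG) \in @bounded_linear R LpG LpG.
Proof.
rewrite inE; split; first exact: ltr_linear.
by exists 1 => x; rewrite mul1r (ltr_norm mu_haar).
Qed.

Definition lambda_op s : Bop LpG LpG := exist _ (ltr (s^-1)%g : LpG -> LpG) (ltr_bounded _).

Lemma lambda_opP s : lambda_ops (lambda_op s).
Proof. by exists s. Qed.

Lemma Bop_sumE n (c : 'I_n -> R[i]) (F : 'I_n -> Bop LpG LpG) x :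
  Bop_fun (\sum_i c i *: F i) x = \sum_i c i *: F i x.
Proof.
elim/big_rec2: _ => // i y S _ <-.
by [].
Qed.

Lemma lin_span_rtr S : lin_span (@lambda_ops R G mu p p1) S ->
  forall t (x : LpG), S (rtr t x) = rtr t (S x).
Proof.
move=> [n [c [F [hF ->]]]] t x; rewrite !Bop_sumE.
have rl : linear (rtr t : LpG -> LpG) by exact: (rtr_linear hD).
have r0 : rtr t (0 : LpG) = 0.
  by have := rl (-1) 0 0; rewrite scaler0 addr0 scaleN1r addNr.
elim/big_rec2: _ => // i y z _ ->.
rewrite rl; congr (_ *: _ + _); have [s hs] := hF i.
by rewrite !hs !lambda_pE (ltr_rtr mu_haar hD).
Qed.

Lemma Lpair_rtr s (g : LqG) (y : LpG) :
  pair g (rtr s y) = (Delta (s^-1)%g)%:C * pair (rtr (s^-1)%g g) y.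
Proof.
have [yp _] := cLfun_rtrans hD P s (Lp_cLfun y).
have [gq _] := cLfun_rtrans hD Q (s^-1)%g (Lp_cLfun g).
rewrite -{1}[g]Lp_classK /rtr (Lpair_class P Q pp' (Lp_cLfun g) yp) (Lpair_classl Q pp' y gq).
have [gy1 _] := cLfun_hoelder P Q pp' gq (Lp_cLfun y).
rewrite -(cintegral_rtrans hD s gy1); congr cintegral; apply/funext => t.
by rewrite /rtrans -mulgA mulgV mulg1.
Qed.

(** Commutation with a right translation is an equality between the values of T at two elementary
    tensors, by adjunction; such an equality passes to weak* limits. *)
Lemma PM_sub_CV : PM mu p1 pp' `<=` CV mu Delta p1.
Proof.
move=> T TPM; apply: (rtr_CV hD) => s x; apply/eqP; rewrite -subr_eq0; apply/eqP.
apply: (@Lpair_separates _ _ _ mu p p' P Q pp') => g; rewrite (bilinearBr Lpb).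
pose g' := (Delta (s^-1)%g)%:C *: rtr (s^-1)%g g.
have gg' y : pair g (rtr s y) = pair g' y by rewrite Lpair_rtr (bilinearZl Lpb).
pose u1 := pure_tensor g (rtr s x); pose u2 := pure_tensor g' x.
have o1 S : opp S u1 = pair g (S (rtr s x)) by exact: ptensor_eval_pure.
have o2 S : opp S u2 = pair g' (S x) by exact: ptensor_eval_pure.
apply: rnorm0_eq0; apply/eqP; rewrite eq_le rnorm_ge0 andbT.
apply: (@ge0_small_le0 _ _ 2) => // e e0.
have [S [Sspan [/= S1 S2]]] := TPM _ (filterI (weakstar_near T u1 e0) (weakstar_near T u2 e0)).
have E : opp S u1 = opp S u2 by rewrite o1 o2 (lin_span_rtr Sspan) gg'.
rewrite gg' -o1 -o2 -(subrKA (opp S u1)) (le_trans (ler_rnormD _ _))//.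
rewrite mulr_natl mulr2n; apply: lerD; first exact: ltW S1.
by rewrite E rnormBC; exact: ltW S2.
Qed.

Lemma pAP_functional T e : has_pAP mu p1 pp' -> CV mu Delta p1 T -> approximable e ->
  (forall s, e (fun (x : LqG) (y : LpG) => pair x (ltr s y)) = 0) ->
  e (fun (x : LqG) (y : LpG) => pair x (T y)) = 0.
Proof.
move=> [I [le [phi [[[i0] lerefl _ _] phiA phi1]]]] TCV eA e0.
have hT := CV_rtr hD TCV.
have [h [hc h0 h1]] := weight_exists mu_haar hD.
rewrite -(functional_const mu_haar hD hc h0 h1 hT eA).
have qQ := functional_Qpcb mu_haar hD hc h0 h1 hT eA.
have q1 := phi1 _ qQ.
apply: rnorm0_eq0; apply/eqP; rewrite eq_le rnorm_ge0 andbT.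
apply/ler_addgt0Pr => d d0; rewrite add0r.
set q := smooth_functional _ _ _ in q1 *.
have /q1[i hi] : nbhs (q (cst 1)) [set z | rnorm (q (cst 1) - z) < d].
  by apply/nbhs_rnormP; exists d.
(* A single term of the tail suffices, since q vanishes on every term of the net. *)
have := hi i (lerefl i) => /=; have [w _ wE] := phiA i.
have qw : q (Lambda_p w) = 0 by exact: (functional_Lambda mu_haar hD hc h0 h1 hT eA e0 w).
by rewrite -wE qw subr0 => /ltW.
Qed.

Lemma CV_sub_PM : has_pAP mu p1 pp' -> CV mu Delta p1 `<=` PM mu p1 pp'.
Proof.
move=> pAP T TCV A /weakstar_nbhs[n [u hu]].
pose vec S : 'rV[R[i]]_n := \row_i opp S (u i).
have vecE S i : vec S 0 i = opp S (u i) by rewrite mxE.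
pose V := [set vec S | S in lin_span (@lambda_ops R G mu p p1)].
suff [S Sspan vST] : V (vec T).
  exists S; split; first exact: Sspan.
  by apply: hu => i; rewrite -!vecE vST.
apply: contrapT => nV.
have vL a S S' : vec (a *: S + S') = a *: vec S + vec S'.
  by apply/rowP => i; rewrite vecE op_pairing_linear 2!mxE !vecE.
have [|||c [cV cT]] := @separation_rV _ n V (vec T).
- exists 0; first exact: lin_span0.
  by have := vL (-1) 0 0; rewrite scaler0 addr0 scaleN1r addNr.
- move=> a _ _ [S S1 <-] [S' S2 <-]; exists (a *: S + S'); last exact: vL.
  exact: lin_span_linear.
- exact: nV.
(* The tensor sum_i c_i u_i acting on forms: by the choice of c it kills every lambda_p(s) but not
   T. *)
pose e B := \sum_i c i 0 * ptensor_eval B (u i).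
have eA : approximable e.
  apply: (approximable_sum mu_haar) => i; exact: (approximable_ptensor mu_haar).
have eE S : vec S *m c = (e (fun (x : LqG) (y : LpG) => pair x (S y)))%:M.
  apply/matrixP => i j; rewrite !mxE !ord1 eqxx mulr1n; apply: eq_bigr => k _.
  by rewrite mxE mulrC.
have e0 s : e (fun (x : LqG) (y : LpG) => pair x (ltr s y)) = 0.
  have Vs : V (vec (lambda_op (s^-1)%g)).
    exists (lambda_op (s^-1)%g) => //; exists 1%N, (fun=> 1), (fun=> lambda_op (s^-1)%g).
    by split=> [_|]; [exact: lambda_opP|rewrite big_ord1 scale1r].
  have /matrixP/(_ 0 0) := cV _ Vs; rewrite eE !mxE eqxx mulr1n => es.
  rewrite -[RHS]es; congr e; apply/funext => x; apply/funext => y.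
  by rewrite -[Bop_fun (lambda_op _) y]/(ltr ((s^-1)^-1)%g y) invgK.
by move: cT; rewrite eE (pAP_functional pAP TCV eA e0) raddf0 eqxx.
Qed.

End pseudomeasures_convoluters.

Theorem theorem6p1 (R : realType) (G : lcGroupType)
    (mu : {measure set (borel G) -> \bar R}) (mu_haar : left_haar mu)
    (Delta : G -> R) (Delta_modular : modular_function mu Delta)
    (p p' : R) (p_gt1 : 1 < p) (pp' : p^-1 + p'^-1 = 1) :
  has_pAP mu p_gt1 pp' -> CV mu Delta p_gt1 = PM mu p_gt1 pp'.
Proof.
move=> pAP; apply/seteqP; split; first exact: (CV_sub_PM mu_haar Delta_modular pAP).
exact: (PM_sub_CV mu_haar Delta_modular).
Qed.
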